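(* $\mathsf{RCA}_0+\mathsf I\Sigma^0_2$ proves the following (Tietze extension theorem): for any continuous $f\colon C\to[-1,1]$ on a closed set $C\subseteq\mathbb R$, there is a continuous $h\colon\mathbb R\to[-1,1]$ with $f(x)=h(x)$ for all $x\in C$.
   Context: $\mathsf{RCA}_0$ is the usual base system of second-order arithmetic (basic arithmetic axioms, $\Sigma^0_1$-induction, $\Delta^0_1$-comprehension); $\mathsf I\Sigma^0_2$ is induction along $\mathbb N$ for $\Sigma^0_2$-formulas (with parameters). Reals. A real is a Cauchy sequence $x=(x_n)_{n\in\mathbb N}$ of rationals with no rate of convergence given: for each rational $\varepsilon>0$ there is an $N\in\mathbb N$ with $|x_m-x_n|<\varepsilon$ for all $m,n\geq N$. For reals $x,y$: $x\leq y$ means that for each rational $\varepsilon>0$ there is an $N$ with $x_n\leq y_n+\varepsilon$ for all $n\geq N$; $x=y$ means $x\leq y$ and $y\leq x$; $x<y$ means $x\leq y$ but not $x=y$. Addition, multiplication and absolute value are defined pointwise; rationals are identified with constant sequences. Put $B_\delta(y)=\{z\in\mathbb R:|y-z|<\delta\}$. Open and closed sets. A code for an open set is a set $U\subseteq\mathbb N\times\mathbb Q\times\mathbb Q_{>0}$. For a real $x$, write $x\in U$ if there are $N\in\mathbb N$ and $(a,r)\in\mathbb Q\times\mathbb Q_{>0}$ such that $x\in B_r(a)$ and $(n,a,r)\in U$ for all $n\geq N$. A closed set is the complement in $\mathbb R$ of an open set (given by a code for that open set). Continuous functions. A partial continuous function on $\mathbb R$ is (represented by) an arbitrary function $f\colon\mathbb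 Q\to\mathbb Q^{\mathbb N}$, $f(q)=(f(q)_i)_{i\in\mathbb N}$. A real $x$ lies in $\operatorname{dom}(f)$ if each $\varepsilon>0$ admits a (positive) $N\in\mathbb N$ such that $|f(q)_i-f(r)_j|<\varepsilon$ for all rationals $q,r\in B_{1/N}(x)$ and all $i,j\geq N$. For $x=(x_i)\in\operatorname{dom}(f)$ the value is the real $f(x)=(f(x_i)_i)_{i\in\mathbb N}$. A continuous function $f\colon D\to\mathbb R$ is such an $f$ with $D\subseteq\operatorname{dom}(f)$; $f\colon D\to E$ means in addition that $f(x)\in E$ for all $x\in D$. *)

(* Defs.v *)
(* Standard library only. *)
From Stdlib Require Import List.
Import ListNotations.

(** * The language of second-order arithmetic

    Two sorts, numbers and sets of numbers, each with its own de Bruijn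
    indices.  Terms contain no set variables, so binding a set variable does
    not affect the terms of a formula. *)

Inductive term : Set :=
| Var (i : nat)
| Zero
| One
| Add (s t : term)
| Mul (s t : term).

Inductive form : Set :=
| Bot
| Eqn (s t : term)
| Less (s t : term)
| Mem (t : term) (X : nat)
| Imp (p q : form)
| AllN (p : form)
| AllS (p : form).

Definition Not p := Imp p Bot.
Definition And p q := Not (Imp p (Not q)).
Definition Or p q := Imp (Not p) q.
Definition Iff p q := And (Imp p q) (Imp q p).
Definition ExN p := Not (AllN (Not p)).
Definition ExS p := Not (AllS (Not p)).

Fixpoint tsubst (s : nat -> term) (t : term) : term :=
  match t with
  | Var i => s i
  | Zero => Zero
  | One => One
  | Add u v => Add (tsubst s u) (tsubst s v)
  | Mul u v => Mul (tsubst s u) (tsubst s v)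
  end.

Definition shift : nat -> term := fun i => Var (S i).

Definition scons {A : Type} (a : A) (s : nat -> A) : nat -> A :=
  fun i => match i with 0 => a | S j => s j end.

Definition up (s : nat -> term) : nat -> term :=
  scons (Var 0) (fun i => tsubst shift (s i)).

Definition upS (r : nat -> nat) : nat -> nat := scons 0 (fun i => S (r i)).

(* Simultaneous substitution: [s] for number variables, [r] for set variables. *)
Fixpoint subst (s : nat -> term) (r : nat -> nat) (p : form) : form :=
  match p with
  | Bot => Bot
  | Eqn t u => Eqn (tsubst s t) (tsubst s u)
  | Less t u => Less (tsubst s t) (tsubst s u)
  | Mem t X => Mem (tsubst s t) (r X)
  | Imp p q => Imp (subst s r p) (subst s r q)
  | AllN p => AllN (subst (up s) r p)
  | AllS p => AllS (subst s (upS r) p)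
  end.

Definition id_set : nat -> nat := fun X => X.
Definition instN (t : term) : form -> form := subst (scons t Var) id_set.
Definition instS (X : nat) : form -> form := subst Var (scons X id_set).
Definition liftN : form -> form := subst shift id_set.
Definition liftS : form -> form := subst Var S.

(** * Classical natural deduction with equality

    The context of hypotheses is a list.  The non-logical axioms [T] are not
    lifted by the generalization rules, so an axiom with free variables has the
    force of its universal closure. *)

Inductive prv (T : form -> Prop) : list form -> form -> Prop :=
| prv_ax G p : T p -> prv T G p
| prv_hyp G p : In p G -> prv T G p
| prv_impI G p q : prv T (p :: G) q -> prv T G (Imp p q)
| prv_impE G p q : prv T G (Imp p q) -> prv T G p -> prv T G q
| prv_raa G p : prv T (Not p :: G) Bot -> prv T G p
| prv_allNI G p : prv T (map liftN G) p -> prv T G (AllN p)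
| prv_allNE G p t : prv T G (AllN p) -> prv T G (instN t p)
| prv_allSI G p : prv T (map liftS G) p -> prv T G (AllS p)
| prv_allSE G p X : prv T G (AllS p) -> prv T G (instS X p)
| prv_refl G t : prv T G (Eqn t t)
| prv_leibniz G p s t :
    prv T G (Eqn s t) -> prv T G (instN s p) -> prv T G (instN t p).

Definition provable (T : form -> Prop) (p : form) : Prop := prv T [] p.

(** * The arithmetical hierarchy

    Number and set parameters are allowed.  In a bounded quantifier the bound
    does not contain the quantified variable, hence the shift. *)

Inductive Delta0 : form -> Prop :=
| Delta0_bot : Delta0 Bot
| Delta0_eq s t : Delta0 (Eqn s t)
| Delta0_lt s t : Delta0 (Less s t)
| Delta0_mem t X : Delta0 (Mem t X)
| Delta0_imp p q : Delta0 p -> Delta0 q -> Delta0 (Imp p q)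
| Delta0_all t p :
    Delta0 p -> Delta0 (AllN (Imp (Less (Var 0) (tsubst shift t)) p))
| Delta0_ex t p :
    Delta0 p -> Delta0 (ExN (And (Less (Var 0) (tsubst shift t)) p)).

Inductive Sigma : nat -> form -> Prop :=
| Sigma_0 p : Delta0 p -> Sigma 0 p
| Sigma_S k p : Pi k p -> Sigma (S k) (ExN p)
with Pi : nat -> form -> Prop :=
| Pi_0 p : Delta0 p -> Pi 0 p
| Pi_S k p : Sigma k p -> Pi (S k) (AllN p).

(** * RCA0 and induction for Sigma^0_2-formulas *)

Definition suc (t : term) : term := Add t One.

Inductive basic_axiom : form -> Prop :=
| basic_suc_neq : basic_axiom (Not (Eqn (suc (Var 0)) Zero))
| basic_suc_inj :
    basic_axiom (Imp (Eqn (suc (Var 0)) (suc (Var 1))) (Eqn (Var 0) (Var 1)))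
| basic_add0 : basic_axiom (Eqn (Add (Var 0) Zero) (Var 0))
| basic_addS :
    basic_axiom (Eqn (Add (Var 0) (suc (Var 1))) (suc (Add (Var 0) (Var 1))))
| basic_mul0 : basic_axiom (Eqn (Mul (Var 0) Zero) Zero)
| basic_mulS :
    basic_axiom (Eqn (Mul (Var 0) (suc (Var 1)))
                    (Add (Mul (Var 0) (Var 1)) (Var 0)))
| basic_lt0 : basic_axiom (Not (Less (Var 0) Zero))
| basic_ltS :
    basic_axiom (Iff (Less (Var 0) (suc (Var 1)))
                     (Or (Less (Var 0) (Var 1)) (Eqn (Var 0) (Var 1)))).

(* Variable 0 of [p] is the induction variable; [subst] in the step replaces
   it by its successor without binding anything. *)
Definition induction_for (p : form) : form :=
  Imp (And (instN Zero p)
           (AllN (Imp p (subst (scons (suc (Var 0)) shift) id_set p))))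
      (AllN p).

Definition comprehension_for (p q : form) : form :=
  Imp (AllN (Iff p q)) (ExS (AllN (Iff (Mem (Var 0) 0) (liftS p)))).

Inductive RCA0 : form -> Prop :=
| RCA0_basic p : basic_axiom p -> RCA0 p
| RCA0_induction p : Sigma 1 p -> RCA0 (induction_for p)
| RCA0_comprehension p q : Sigma 1 p -> Pi 1 q -> RCA0 (comprehension_for p q).

Inductive ISigma2 : form -> Prop :=
| ISigma2_induction p : Sigma 2 p -> ISigma2 (induction_for p).

Definition RCA0_ISigma2 (p : form) : Prop := RCA0 p \/ ISigma2 p.

(** * A named layer over de Bruijn formulas

    A [tm], [sv] or [fm] is a term, set variable or formula that may be placed
    under any number of binders: the arguments are the numbers of enclosing
    number and set quantifiers.  The variable bound at depth [d] has index
    [d' - S d] at depth [d']. *)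

Definition tm := nat -> term.
Definition sv := nat -> nat.
Definition fm := nat -> nat -> form.

Definition close (p : fm) : form := p 0 0.

Definition allN (p : tm -> fm) : fm :=
  fun d e => AllN (p (fun d' => Var (d' - S d)) (S d) e).
Definition exN (p : tm -> fm) : fm :=
  fun d e => ExN (p (fun d' => Var (d' - S d)) (S d) e).
Definition allS (p : sv -> fm) : fm :=
  fun d e => AllS (p (fun e' => e' - S e) d (S e)).
Definition exS (p : sv -> fm) : fm :=
  fun d e => ExS (p (fun e' => e' - S e) d (S e)).

Definition notF (p : fm) : fm := fun d e => Not (p d e).
Definition impF (p q : fm) : fm := fun d e => Imp (p d e) (q d e).
Definition andF (p q : fm) : fm := fun d e => And (p d e) (q d e).
Definition orF (p q : fm) : fm := fun d e => Or (p d e) (q d e).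
Definition eqN (s t : tm) : fm := fun d _ => Eqn (s d) (t d).
Definition ltN (s t : tm) : fm := fun d _ => Less (s d) (t d).
Definition mem (t : tm) (X : sv) : fm := fun d e => Mem (t d) (X e).

Definition zero : tm := fun _ => Zero.
Definition one : tm := fun _ => One.
Definition add (s t : tm) : tm := fun d => Add (s d) (t d).
Definition mul (s t : tm) : tm := fun d => Mul (s d) (t d).

Declare Scope fm_scope.
Delimit Scope fm_scope with fm.
Declare Scope tm_scope.
Delimit Scope tm_scope with tm.
Bind Scope fm_scope with fm.
Bind Scope tm_scope with tm.
Notation "s + t" := (add s t) : tm_scope.
Notation "s * t" := (mul s t) : tm_scope.
Notation "'[~]' p" := (notF p) (at level 75, right associativity) : fm_scope.
Notation "p '[&]' q" := (andF p q) (at level 80, right associativity) : fm_scope.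
Notation "p '[|]' q" := (orF p q) (at level 85, right associativity) : fm_scope.
Notation "p '[>]' q" := (impF p q) (at level 90, right associativity) : fm_scope.
Notation "s == t" := (eqN s%tm t%tm) (at level 70) : fm_scope.
Notation "s < t" := (ltN s%tm t%tm) : fm_scope.
Notation "s <= t" := (orF (ltN s%tm t%tm) (eqN s%tm t%tm)) : fm_scope.
Notation "t '[in]' X" := (mem t%tm X) (at level 70) : fm_scope.
Notation "'alln' x .. y , p" := (allN (fun x => .. (allN (fun y => p%fm)) ..))
  (at level 200, x binder, y binder, right associativity) : fm_scope.
Notation "'exn' x .. y , p" := (exN (fun x => .. (exN (fun y => p%fm)) ..))
  (at level 200, x binder, y binder, right associativity) : fm_scope.
Notation "'alls' x .. y , p" := (allS (fun x => .. (allS (fun y => p%fm)) ..))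
  (at level 200, x binder, y binder, right associativity) : fm_scope.
Notation "'exs' x .. y , p" := (exS (fun x => .. (exS (fun y => p%fm)) ..))
  (at level 200, x binder, y binder, right associativity) : fm_scope.
Local Open Scope fm_scope.

(* Injective on pairs, since (i+j)^2 <= npair i j < (i+j+1)^2. *)
Definition npair (i j : tm) : tm := ((i + j) * (i + j) + i)%tm.

(** * Rational numbers *)

(* A fraction (pos - negp) / den built from terms. *)
Record frac := Frac { pos : tm; negp : tm; den : tm }.

Definition fzero : frac := Frac zero zero one.
Definition fone : frac := Frac one zero one.
Definition finv (n : tm) : frac := Frac one zero n.
Definition fopp (p : frac) : frac := Frac (negp p) (pos p) (den p).
Definition fadd (p q : frac) : frac :=
  Frac (pos p * den q + pos q * den p)%tm
       (negp p * den q + negp q * den p)%tm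
       (den p * den q)%tm.
Definition fsub (p q : frac) : frac := fadd p (fopp q).

Definition fle (p q : frac) : fm :=
  pos p * den q + negp q * den p <= pos q * den p + negp p * den q.
Definition flt (p q : frac) : fm :=
  pos p * den q + negp q * den p < pos q * den p + negp p * den q.
Definition feq (p q : frac) : fm :=
  pos p * den q + negp q * den p == pos q * den p + negp p * den q.

(* The absolute value of [p] satisfies [P]. *)
Definition fabs (p : frac) (P : frac -> fm) : fm :=
  (fle fzero p [&] P p) [|] (flt p fzero [&] P (fopp p)).

(* A triple of numbers a, b, c represents the rational (a - b) / (c + 1). *)
Definition triple_frac (a b c : tm) : frac := Frac a b (c + one)%tm.
Definition triple_code (a b c : tm) : tm := npair (npair a b) c.

(* The code of a rational is the least code of a triple representing it, so
   that distinct codes denote distinct rationals. *)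
Definition is_rat (q : tm) : fm :=
  exn a b c, q == triple_code a b c [&]
    alln a' b' c', feq (triple_frac a b c) (triple_frac a' b' c') [>]
      q <= triple_code a' b' c'.

(* [with_rat q P]: the number [q] codes a rational, and it satisfies [P]. *)
Definition with_rat (q : tm) (P : frac -> fm) : fm :=
  is_rat q [&] exn a b c, q == triple_code a b c [&] P (triple_frac a b c).

Definition all_rat (P : tm -> frac -> fm) : fm :=
  alln q, is_rat q [>] with_rat q (P q).
Definition ex_rat (P : tm -> frac -> fm) : fm :=
  exn q, with_rat q (P q).
Definition all_pos_rat (P : frac -> fm) : fm :=
  all_rat (fun _ eps => flt fzero eps [>] P eps).

(** * Real numbers *)

(* A sequence of rationals, given by how to assert a property of its [n]-th
   member. *)
Definition rseq := tm -> (frac -> fm) -> fm.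

Definition sconst (p : frac) : rseq := fun _ P => P p.
Definition ssub (x y : rseq) : rseq :=
  fun n P => x n (fun p => y n (fun q => P (fsub p q))).
Definition sabs (x : rseq) : rseq := fun n P => x n (fun p => fabs p P).

(* The sequence coded by the set [X] of all pairs (n, X_n). *)
Definition sval (X : sv) : rseq :=
  fun n P => exn q, npair n q [in] X [&] with_rat q P.

Definition is_rat_seq (X : sv) : fm :=
  (alln k, k [in] X [>] exn n q, k == npair n q [&] is_rat q) [&]
  (alln n, exn q, npair n q [in] X [&] alln q', npair n q' [in] X [>] q' == q).

Definition is_cauchy (x : rseq) : fm :=
  all_pos_rat (fun eps => exn N, alln m n,
    (N <= m [&] N <= n) [>]
    x m (fun p => x n (fun q => fabs (fsub p q) (fun r => flt r eps)))).

Definition is_real (X : sv) : fm := is_rat_seq X [&] is_cauchy (sval X).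

Definition rle (x y : rseq) : fm :=
  all_pos_rat (fun eps => exn N, alln n, N <= n [>]
    x n (fun p => y n (fun q => fle p (fadd q eps)))).
Definition req (x y : rseq) : fm := rle x y [&] rle y x.
Definition rlt (x y : rseq) : fm := rle x y [&] [~] req x y.

(* [z] lies in the open ball of radius [delta] around [y]. *)
Definition in_ball (delta y z : rseq) : fm := rlt (sabs (ssub y z)) delta.

(** * Open sets *)

Definition is_open_code (U : sv) : fm :=
  alln k, k [in] U [>]
    exn n, ex_rat (fun a _ => ex_rat (fun r pr =>
      flt fzero pr [&] k == npair (npair n a) r)).

Definition in_open (X U : sv) : fm :=
  exn N, ex_rat (fun a pa => ex_rat (fun r pr => flt fzero pr [&]
    (in_ball (sconst pr) (sconst pa) (sval X) [&]
     alln n, N <= n [>] npair (npair n a) r [in] U))).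

(** * Continuous functions *)

(* [F] is the set of all pairs ((q, i), f(q)_i), for f : Q -> Q^N. *)
Definition is_fun_code (F : sv) : fm :=
  (alln k, k [in] F [>]
     exn q i r, k == npair (npair q i) r [&] is_rat q [&] is_rat r) [&]
  (alln q i, is_rat q [>]
     exn r, npair (npair q i) r [in] F [&]
       alln r', npair (npair q i) r' [in] F [>] r' == r).

(* [fval F q i P]: the rational f(q)_i satisfies [P]. *)
Definition fval (F : sv) (q i : tm) (P : frac -> fm) : fm :=
  exn r, npair (npair q i) r [in] F [&] with_rat r P.

Definition in_dom (F X : sv) : fm :=
  all_pos_rat (fun eps => exn N, zero < N [&]
    all_rat (fun q pq => all_rat (fun r pr =>
      (in_ball (sconst (finv N)) (sval X) (sconst pq) [&]
       in_ball (sconst (finv N)) (sval X) (sconst pr)) [>]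
      alln i j, (N <= i [&] N <= j) [>]
        fval F q i (fun u => fval F r j (fun v =>
          fabs (fsub u v) (fun w => flt w eps)))))).

(* The real f(x) = (f(x_i)_i)_i. *)
Definition sapp (F X : sv) : rseq :=
  fun i P => exn q, npair i q [in] X [&] fval F q i P.

Definition in_unit_interval (x : rseq) : fm :=
  rle (sconst (fopp fone)) x [&] rle x (sconst fone).

(* [F] represents a continuous function from D to [-1, 1]. *)
Definition continuous_into_unit (F : sv) (D : sv -> fm) : fm :=
  is_fun_code F [&]
  alls X, (is_real X [&] D X) [>] (in_dom F X [&] in_unit_interval (sapp F X)).

Definition all_reals (X : sv) : fm := is_real X.
Definition closed_set (U X : sv) : fm := [~] in_open X U.

(** * The Tietze extension theorem *)

Definition tietze : form := close (
  alls U, is_open_code U [>]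
  alls F, continuous_into_unit F (closed_set U) [>]
  exs H, continuous_into_unit H all_reals [&]
    alls X, (is_real X [&] closed_set U X) [>] req (sapp F X) (sapp H X)).

(* Main.v *)
Require Import Defs.
From Stdlib Require List.
From HB Require Import structures.
From mathcomp Require Import all_boot all_order all_algebra.
From mathcomp Require Import boolp.
From mathcomp Require Import ring lra.
Import Defs.
Import Order.TTheory GRing.Theory Num.Theory.
Set Implicit Arguments.
Unset Strict Implicit.
Unset Printing Implicit Defensive.

(* By the completeness theorem, proved here for this calculus, one may argue in
   an arbitrary model of the axioms, whose rationals form an ordered field.  On
   the closed set, f(x) is the infimum of the cones v + 2|x - c|(k + 1) over all
   balls B(c, 1/(k + 1)) on which v >= -1 bounds f.  To make this infimum, cut
   off at 1, converge off the closed set as well, the cone number n is raised by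
   (n + 1)/(m + 1) min(1, r - |x - a|) for each ball B(a, r), with number m, of
   the complement: this is at most 0 on the closed set, and exceeds 2 near a
   point of the complement for all but boundedly many n.  Both "v bounds f on
   the ball" and "the ball belongs to the open set" are Pi^0_1; h(q)_i uses what
   is visible of them below i, and induction bounds the stage from which these
   approximations are correct for all numbers below a given one. *)

(** * Substitution *)

(** The obstacle is that neither Pi^0_1 condition can be decided when h(q)_i is computed, that f is
    arbitrary data off its domain, and that h must converge at every real. A wrong cone still
    visible at stage i may pull the infimum down, and a wrong ball may push a cone up. At a point of
    the complement only boundedly many cones stay below the cut-off, so from some stage on the
    visible ones among them are genuine. At a point of the closed set there is no such bound. There
    the lower estimate comes from letting a cone count near q only if its value bounds f(q)_i
    itself, and the upper estimate needs just one genuine cone over a small ball. The penalties on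
    that cone are harmless: (n + 1)/(m + 1) is small for large m, and the visible balls among the
    boundedly many others are eventually genuine, hence miss the point. The slope factor 2 lifts a
    cone to v + 2 >= 1 at the rim of its ball, because v >= -1; outside the ball the cut-off at 1
    hides it. *)

Lemma tsubst_comp s s' t :
  tsubst s' (tsubst s t) = tsubst (fun i => tsubst s' (s i)) t.
Proof. by elim: t => //= u -> v ->. Qed.

Lemma tsubst_Var t : tsubst Var t = t.
Proof. by elim: t => //= u -> v ->. Qed.

Lemma tsubst_up_shift s t : tsubst (up s) (tsubst shift t) = tsubst shift (tsubst s t).
Proof. by rewrite !tsubst_comp. Qed.

Lemma up_comp s s' :
  (fun i => tsubst (up s') (up s i)) = up (fun i => tsubst s' (s i)).
Proof. by apply: funext => -[|i] //=; rewrite tsubst_up_shift. Qed.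

Lemma up_Var : up Var = Var.
Proof. by apply: funext => -[]. Qed.

Lemma upS_comp r r' : (fun i => upS r' (upS r i)) = upS (fun i => r' (r i)).
Proof. by apply: funext => -[]. Qed.

Lemma upS_id : upS id_set = id_set.
Proof. by apply: funext => -[]. Qed.

Lemma subst_comp s r s' r' p :
  subst s' r' (subst s r p) = subst (fun i => tsubst s' (s i)) (fun i => r' (r i)) p.
Proof.
elim: p s r s' r' => //=.
- by move=> t u s r s' r'; rewrite !tsubst_comp.
- by move=> t u s r s' r'; rewrite !tsubst_comp.
- by move=> t X s r s' r'; rewrite !tsubst_comp.
- by move=> p IHp q IHq s r s' r'; rewrite IHp IHq.
- by move=> p IH s r s' r'; rewrite IH up_comp.
- by move=> p IH s r s' r'; rewrite IH upS_comp.
Qed.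

Lemma subst_id p : subst Var id_set p = p.
Proof.
elim: p => //= [t u|t u|t X|p -> q ->|p|p] //; rewrite ?tsubst_Var ?up_Var ?upS_id //.
- by move=> ->.
- by move=> ->.
Qed.

Lemma instN_up s r t p :
  instN t (subst (up s) r p) = subst (scons t s) r p.
Proof.
rewrite /instN subst_comp; congr (subst _ _ _); apply: funext => -[|i] //=.
by rewrite tsubst_comp /= tsubst_Var.
Qed.

Lemma instS_upS s r X p :
  instS X (subst s (upS r) p) = subst s (scons X r) p.
Proof.
rewrite /instS subst_comp; congr (subst _ _ _); apply: funext => i.
  by rewrite tsubst_Var.
by case: i.
Qed.

Lemma subst_instN s r t p :
  subst s r (instN t p) = instN (tsubst s t) (subst (up s) r p).
Proof.
rewrite instN_up /instN subst_comp; congr (subst _ _ _).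
by apply: funext => -[].
Qed.

Lemma subst_instS s r X p :
  subst s r (instS X p) = instS (r X) (subst s (upS r) p).
Proof.
rewrite instS_upS /instS subst_comp; congr (subst _ _ _).
by apply: funext => -[].
Qed.

Lemma subst_liftN s r p : subst (up s) r (liftN p) = liftN (subst s r p).
Proof. by rewrite /liftN !subst_comp. Qed.

Lemma subst_liftS s r p : subst s (upS r) (liftS p) = liftS (subst s r p).
Proof.
rewrite /liftS !subst_comp; congr (subst _ _ _).
by apply: funext => i; rewrite tsubst_Var.
Qed.

(* All variables of [p], of both sorts, are below [b]. *)
Definition bounded_vars (b : nat) (p : form) :=
  forall s s' r r', (forall i, i < b -> s i = s' i) ->
    (forall i, i < b -> r i = r' i) -> subst s r p = subst s' r' p.

Lemma term_bounded_vars t : exists b, forall s s' : nat -> term,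
  (forall i, i < b -> s i = s' i) -> tsubst s t = tsubst s' t.
Proof.
elim: t => [i|||u [b Hb] v [c Hc]|u [b Hb] v [c Hc]] /=; try by exists 0.
- by exists i.+1 => s s'; apply.
- exists (maxn b c) => s s' H; rewrite (Hb s s') ?(Hc s s') // => i Hi;
  by apply: H; rewrite leq_max Hi ?orbT.
- exists (maxn b c) => s s' H; rewrite (Hb s s') ?(Hc s s') // => i Hi;
  by apply: H; rewrite leq_max Hi ?orbT.
Qed.

Lemma bounded_vars_le b c p : b <= c -> bounded_vars b p -> bounded_vars c p.
Proof.
by move=> bc H s s' r r' Hs Hr; apply: H => i ib; [apply: Hs|apply: Hr];
  apply: leq_trans bc.
Qed.

Lemma form_bounded_vars p : exists b, bounded_vars b p.
Proof.
elim: p => [|t u|t u|t X|p [b Hb] q [c Hc]|p [b Hb]|p [b Hb]].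
- by exists 0.
- have [b Hb] := term_bounded_vars t; have [c Hc] := term_bounded_vars u.
  exists (maxn b c) => s s' r r' H _ /=; rewrite (Hb s s') ?(Hc s s') // => i Hi;
  by apply: H; rewrite leq_max Hi ?orbT.
- have [b Hb] := term_bounded_vars t; have [c Hc] := term_bounded_vars u.
  exists (maxn b c) => s s' r r' H _ /=; rewrite (Hb s s') ?(Hc s s') // => i Hi;
  by apply: H; rewrite leq_max Hi ?orbT.
- have [b Hb] := term_bounded_vars t; exists (maxn b X.+1) => s s' r r' H H' /=.
  rewrite (Hb s s') ?H' // => [|i Hi]; first by rewrite leq_max leqnn orbT.
  by apply: H; rewrite leq_max Hi.
- exists (maxn b c) => s s' r r' Hs Hr /=.
  rewrite (bounded_vars_le (leq_maxl b c) Hb Hs Hr).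
  by rewrite (bounded_vars_le (leq_maxr b c) Hc Hs Hr).
- exists b => s s' r r' Hs Hr /=; rewrite (Hb (up s) (up s') r r') //.
  by case=> //= i Hi; rewrite Hs // ltnW.
- exists b => s s' r r' Hs Hr /=; rewrite (Hb s s' (upS r) (upS r')) //.
  by case=> //= i Hi; rewrite Hr // ltnW.
Qed.

Lemma list_bounded_vars (G : list form) :
  exists b, forall p, List.In p G -> bounded_vars b p.
Proof.
elim: G => [|p G [b Hb]]; first by exists 0.
have [c Hc] := form_bounded_vars p; exists (maxn b c) => q /= [<-|/Hb].
  exact: bounded_vars_le (leq_maxr _ _) Hc.
exact: bounded_vars_le (leq_maxl _ _).
Qed.

(** * Completeness *)

Arguments prv_ax {T G p}.
Arguments prv_hyp {T G p}.
Arguments prv_impI {T G p q}.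
Arguments prv_impE {T G p q}.
Arguments prv_raa {T G p}.
Arguments prv_allNI {T G p}.
Arguments prv_allNE {T G p}.
Arguments prv_allSI {T G p}.
Arguments prv_allSE {T G p}.
Arguments prv_refl {T G}.
Arguments prv_leibniz {T G} p {s t}.

(** * Two-sorted structures and satisfaction *)

Record structure := Structure {
  dom : Type; sdom : Type;
  zeroM : dom; oneM : dom;
  addM : dom -> dom -> dom; mulM : dom -> dom -> dom;
  ltM : dom -> dom -> Prop;
  memM : dom -> sdom -> Prop }.

Section Semantics.
Variable S : structure.

Fixpoint eval (e : nat -> dom S) (t : term) : dom S :=
  match t with
  | Var i => e i
  | Zero => zeroM S
  | One => oneM S
  | Add u v => addM (eval e u) (eval e v)
  | Mul u v => mulM (eval e u) (eval e v)
  end.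

Fixpoint sat (e : nat -> dom S) (g : nat -> sdom S) (p : form) : Prop :=
  match p with
  | Bot => False
  | Eqn t u => eval e t = eval e u
  | Less t u => ltM (eval e t) (eval e u)
  | Mem t X => memM (eval e t) (g X)
  | Imp p q => sat e g p -> sat e g q
  | AllN p => forall m, sat (scons m e) g p
  | AllS p => forall X, sat e (scons X g) p
  end.

Lemma eval_tsubst e s t : eval e (tsubst s t) = eval (fun i => eval e (s i)) t.
Proof. by elim: t => //= u -> v ->. Qed.

Lemma sat_subst e g s r p :
  sat e g (subst s r p) <-> sat (fun i => eval e (s i)) (fun i => g (r i)) p.
Proof.
elim: p e g s r => //=.
- by move=> t u e g s r; rewrite !eval_tsubst.
- by move=> t u e g s r; rewrite !eval_tsubst.
- by move=> t X e g s r; rewrite !eval_tsubst.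
- by move=> p IHp q IHq e g s r; rewrite IHp IHq.
- move=> p IH e g s r; split=> H m; have := H m; rewrite IH.
    congr (sat _ _ _); apply: funext => -[|i] //=.
    by rewrite eval_tsubst.
  congr (sat _ _ _); apply: funext => -[|i] //=.
  by rewrite eval_tsubst.
- move=> p IH e g s r; split=> H X; have := H X; rewrite IH;
  by congr (sat _ _ _); apply: funext => -[|i].
Qed.

Definition models (T : form -> Prop) := forall p, T p -> forall e g, sat e g p.

End Semantics.

Section Provability.
Variable T : form -> Prop.
(** Generalization does not lift the axioms, so a derivation can be renamed only if every
    substitution instance of an axiom is itself derivable. *)
Hypothesis substT : forall p s r, T p -> prv T nil (subst s r p).

Lemma prv_weak G G' p : prv T G p -> (forall q, List.In q G -> List.In q G') ->
  prv T G' p.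
Proof.
move=> H; elim: H G' => {G p}.
- by move=> G p Hp G' _; apply: prv_ax.
- by move=> G p Hp G' HG; apply: prv_hyp; apply: HG.
- move=> G p q _ IH G' HG; apply: prv_impI; apply: IH => r /= [->|/HG]; by [left|right].
- by move=> G p q _ IH1 _ IH2 G' HG; apply: (prv_impE (IH1 _ HG) (IH2 _ HG)).
- move=> G p _ IH G' HG; apply: prv_raa; apply: IH => r /= [->|/HG]; by [left|right].
- move=> G p _ IH G' HG; apply: prv_allNI; apply: IH => r.
  by move=> /List.in_map_iff [q [<- /HG Hq]]; apply: List.in_map.
- by move=> G p t _ IH G' HG; apply: prv_allNE; apply: IH.
- move=> G p _ IH G' HG; apply: prv_allSI; apply: IH => r.
  by move=> /List.in_map_iff [q [<- /HG Hq]]; apply: List.in_map.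
- by move=> G p t _ IH G' HG; apply: prv_allSE; apply: IH.
- by move=> *; apply: prv_refl.
- by move=> G p s t _ IH1 _ IH2 G' HG; apply: (prv_leibniz _ (IH1 _ HG)); apply: IH2.
Qed.

Lemma prv_subst G p s r :
  prv T G p -> prv T (List.map (subst s r) G) (subst s r p).
Proof.
move=> H; elim: H s r => {G p}.
- by move=> G p Hp s r; apply: (prv_weak (substT s r Hp)).
- by move=> G p Hp s r; apply: prv_hyp; apply: List.in_map.
- by move=> G p q _ IH s r; apply: prv_impI; apply: IH.
- by move=> G p q _ IH1 _ IH2 s r; apply: (prv_impE (IH1 s r) (IH2 s r)).
- by move=> G p _ IH s r; apply: prv_raa; apply: IH.
- move=> G p _ IH s r; apply: prv_allNI; have := IH (up s) r.
  rewrite !List.map_map; congr (prv _ _ _).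
  by apply: List.map_ext => q; rewrite subst_liftN.
- by move=> G p t _ IH s r; rewrite subst_instN; apply: prv_allNE; apply: IH.
- move=> G p _ IH s r; apply: prv_allSI; have := IH s (upS r).
  rewrite !List.map_map; congr (prv _ _ _).
  by apply: List.map_ext => q; rewrite subst_liftS.
- by move=> G p X _ IH s r; rewrite subst_instS; apply: prv_allSE; apply: IH.
- by move=> *; apply: prv_refl.
- move=> G p u v _ IH1 _ IH2 s r; rewrite subst_instN.
  by apply: (prv_leibniz _ (IH1 s r)); rewrite -subst_instN.
Qed.

(** * Henkin extensions *)

Lemma prv_notE G p : prv T G (Not p) -> prv T G p -> prv T G Bot.
Proof. exact: prv_impE. Qed.

Definition consistent G := ~ prv T G Bot.

Lemma consistent_not G p :
  consistent G -> ~ consistent (p :: G) -> consistent (Not p :: G).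
Proof.
move=> HG /contrapT Hp Hn; apply: HG.
exact: prv_impE (prv_impI Hp) (prv_raa Hn).
Qed.

(** Variables themselves play the Henkin constants. As [x] occurs neither in [G] nor in [q],
    renaming it to the bound variable and shifting all others turns the derivation into a premise of
    [prv_allNI]. Contexts are finite lists, so fresh variables never run out. *)
Lemma witnessN G q x : (forall p, List.In p G -> bounded_vars x p) ->
  bounded_vars x q -> prv T G (instN (Var x) q) -> prv T G (AllN q).
Proof.
move=> HG Hq H; apply: prv_allNI.
pose s i := if i == x then Var 0 else Var i.+1.
have := prv_subst s id_set H; have -> : subst s id_set (instN (Var x) q) = q.
  rewrite /instN subst_comp -[RHS]subst_id; apply: Hq => // -[|i] ix /=.
    by rewrite /s eqxx.
  by rewrite /s ltn_eqF // ltnW.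
congr (prv _ _ _); apply: List.map_ext_in => p /HG; apply=> // i ix.
by rewrite /s ltn_eqF.
Qed.

Lemma witnessS G q x : (forall p, List.In p G -> bounded_vars x p) ->
  bounded_vars x q -> prv T G (instS x q) -> prv T G (AllS q).
Proof.
move=> HG Hq H; apply: prv_allSI.
pose r i := if i == x then 0 else i.+1.
have := prv_subst Var r H; have -> : subst Var r (instS x q) = q.
  rewrite /instS subst_comp -[RHS]subst_id; apply: Hq => // -[|i] ix /=.
    by rewrite /r eqxx.
  by rewrite /r ltn_eqF // ltnW.
congr (prv _ _ _); apply: List.map_ext_in => p /HG; apply=> // i ix.
by rewrite /r ltn_eqF.
Qed.

(** One Henkin step; the last two clauses name a counterexample whenever the negation of a universal
    formula is adopted. *)
Definition decides G p G' :=
  [/\ (forall q, List.In q G -> List.In q G'), consistent G',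
    List.In p G' \/ List.In (Not p) G',
    forall q, p = AllN q -> List.In (Not p) G' ->
      exists x, List.In (Not (instN (Var x) q)) G' &
    forall q, p = AllS q -> List.In (Not p) G' ->
      exists x, List.In (Not (instS x q)) G'].

Lemma decide G p : consistent G -> exists G', decides G p G'.
Proof.
move=> HG; have [Hp|/(consistent_not HG) Hn] := pselect (consistent (p :: G)).
  have Hnn : ~ List.In (Not p) (p :: G).
    by move=> /(@prv_hyp T) H; apply: Hp; apply: (prv_notE H); apply: prv_hyp; left.
  by exists (p :: G); split=> //; [right|left; left].
have [b Hb] := list_bounded_vars (p :: Not p :: G).
have HG' q : List.In q (Not p :: G) -> bounded_vars b q by move=> H; apply: Hb; right.
have Hp : prv T (Not p :: G) p -> False.
  by move=> H; apply: Hn; apply: prv_notE H; apply: prv_hyp; left.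
have cons_witness w : (prv T (Not p :: G) w -> False) -> consistent (Not w :: Not p :: G).
  by move=> Hw H; apply: Hw; apply: prv_raa.
have plain : (forall q, p <> AllN q) -> (forall q, p <> AllS q) ->
    exists G', decides G p G'.
  move=> nN nS; exists (Not p :: G); split=> //= [r Hr||q /nN|q /nS] //; first by right.
  by right; left.
case: p => [|t u|t u|t X|p q|q|q] in Hn Hb HG' Hp cons_witness plain *.
1-5: by apply: plain.
- have [c Hc] := form_bounded_vars q.
  (* Beyond all variables of the context and of the body, hence fresh. *)
  pose x := maxn b c; exists (Not (instN (Var x) q) :: Not (AllN q) :: G).
  split=> //=; auto.
    apply: cons_witness => H; apply: Hp; apply: witnessN H.
      by move=> p /HG'; apply: bounded_vars_le; apply: leq_maxl.
    by apply: bounded_vars_le Hc; apply: leq_maxr.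
  by move=> _ [<-] _; exists x; left.
- have [c Hc] := form_bounded_vars q.
  pose x := maxn b c; exists (Not (instS x q) :: Not (AllS q) :: G).
  split=> //=; auto.
    apply: cons_witness => H; apply: Hp; apply: witnessS H.
      by move=> p /HG'; apply: bounded_vars_le; apply: leq_maxl.
    by apply: bounded_vars_le Hc; apply: leq_maxr.
  by move=> _ [<-] _; exists x; left.
Qed.

(** * An injective numbering of the formulas *)

Fixpoint tree_of_term (t : term) : GenTree.tree nat :=
  match t with
  | Var i => GenTree.Leaf i
  | Zero => GenTree.Node 0 [::]
  | One => GenTree.Node 1 [::]
  | Add u v => GenTree.Node 2 [:: tree_of_term u; tree_of_term v]
  | Mul u v => GenTree.Node 3 [:: tree_of_term u; tree_of_term v]
  end.

Fixpoint tree_of_form (p : form) : GenTree.tree nat :=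
  match p with
  | Bot => GenTree.Node 0 [::]
  | Eqn t u => GenTree.Node 1 [:: tree_of_term t; tree_of_term u]
  | Less t u => GenTree.Node 2 [:: tree_of_term t; tree_of_term u]
  | Mem t X => GenTree.Node 3 [:: tree_of_term t; GenTree.Leaf X]
  | Imp q r => GenTree.Node 4 [:: tree_of_form q; tree_of_form r]
  | AllN q => GenTree.Node 5 [:: tree_of_form q]
  | AllS q => GenTree.Node 6 [:: tree_of_form q]
  end.

Lemma tree_of_term_inj : injective tree_of_term.
Proof.
elim=> [i|||u IHu v IHv|u IHu v IHv] [j|||u' v'|u' v'] //=.
- by case=> ->.
- by case=> /IHu -> /IHv ->.
- by case=> /IHu -> /IHv ->.
Qed.

Lemma tree_of_form_inj : injective tree_of_form.
Proof.
elim=> [|t u|t u|t X|p IHp q IHq|p IH|p IH] [|t' u'|t' u'|t' X'|p' q'|p'|p'] //=.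
- by case=> /tree_of_term_inj -> /tree_of_term_inj ->.
- by case=> /tree_of_term_inj -> /tree_of_term_inj ->.
- by case=> /tree_of_term_inj -> ->.
- by case=> /IHp -> /IHq ->.
- by case=> /IH ->.
- by case=> /IH ->.
Qed.

Definition form_code (p : form) : nat := pickle (tree_of_form p).

Lemma form_code_inj : injective form_code.
Proof. by move=> p q /(pcan_inj pickleK) /tree_of_form_inj. Qed.

Section MaximalExtension.
Variable G0 : list form.
Hypothesis cons0 : consistent G0.

Lemma ex_stages : exists G : nat -> list form, G 0 = G0 /\
  forall n, [/\ consistent (G n), forall q, List.In q (G n) -> List.In q (G n.+1) &
    forall p, form_code p = n -> decides (G n) p (G n.+1)].
Proof.
(* An extension is chosen for every number and consistent list. Consistency is kept in the type so
   that the recursion can continue; a number that codes no formula changes nothing. *)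
have /choice [f Hf] (np : nat * {G : list form | consistent G}) :
    exists G' : {G : list form | consistent G},
    (forall q, List.In q (proj1_sig np.2) -> List.In q (proj1_sig G')) /\
    forall p, form_code p = np.1 -> decides (proj1_sig np.2) p (proj1_sig G').
  case: np => n [G HG] /=; have [[p Hp]|np] := pselect (exists p, form_code p = n).
    have [G' HG'] := decide p HG; have HG'' : consistent G' by case: HG'.
    exists (exist _ G' HG''); split=> [q|q Hq] /=; first by case: HG' => H _ _ _ _; apply: H.
    by have -> : q = p by apply: form_code_inj; rewrite Hp.
  by exists (exist _ G HG); split=> // p Hp; case: np; exists p.
pose fix st n : {G : list form | consistent G} :=
  if n is k.+1 then f (k, st k) else exist _ G0 cons0.
exists (fun n => proj1_sig (st n)); split=> // n; split; first exact: (proj2_sig (st n)).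
  by case: (Hf (n, st n)).
by move=> p Hp; apply: (proj2 (Hf (n, st n))).
Qed.

(** The clauses are those of a truth definition. [D] collects what some stage derives, which makes
    it deductively closed at once; completeness and witnesses come from the stage that decides the
    formula in question. *)
Lemma ex_maximal : exists D : form -> Prop,
  [/\ (forall p, List.In p G0 -> D p) /\ (forall p s r, T p -> D (subst s r p)),
    ~ D Bot /\ (forall p q, D (Imp p q) <-> (D p -> D q)),
    forall q, D (AllN q) <-> forall t, D (instN t q),
    forall q, D (AllS q) <-> forall X, D (instS X q) &
    (forall t, D (Eqn t t)) /\
    (forall p s t, D (Eqn s t) -> D (instN s p) -> D (instN t p))].
Proof.
have [G [G_0 HG]] := ex_stages.
have mono m n q : m <= n -> List.In q (G m) -> List.In q (G n).
  move=> /subnK <-; elim: (n - m)%N => //= k IH /IH; by have [_ H _] := HG (k + m)%N; apply: H.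
pose D p := exists n, prv T (G n) p.
have join p q r : (forall n, prv T (G n) p -> prv T (G n) q -> prv T (G n) r) ->
    D p -> D q -> D r.
  move=> H [m Hm] [n Hn]; exists (maxn m n).
  by apply: H; [apply: prv_weak Hm _|apply: prv_weak Hn _] => s; apply: mono;
    rewrite ?leq_maxl ?leq_maxr.
have lift1 p q : (forall n, prv T (G n) p -> prv T (G n) q) -> D p -> D q.
  by move=> H [n Hn]; exists n; apply: H.
have DBot : ~ D Bot by case=> n; case: (HG n).
have Dnot p : D (Not p) -> D p -> False.
  by move=> H1 H2; apply: DBot; move: H1 H2; apply: join => n; apply: prv_notE.
have dec p : D p \/ D (Not p).
  have [_ _ /(_ p erefl) [_ _ [H|H] _ _]] := HG (form_code p); [left|right];
  by exists (form_code p).+1; apply: prv_hyp.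
have Din n p : List.In p (G n) -> D p by move=> H; exists n; apply: prv_hyp.
have wN q : D (AllN q) \/ exists x, D (Not (instN (Var x) q)).
  have [_ _ /(_ _ erefl) [_ _ [/Din H|H] HN _]] := HG (form_code (AllN q)); first by left.
  by right; have [x /Din Hx] := HN q erefl H; exists x.
have wS q : D (AllS q) \/ exists x, D (Not (instS x q)).
  have [_ _ /(_ _ erefl) [_ _ [/Din H|H] _ HS]] := HG (form_code (AllS q)); first by left.
  by right; have [x /Din Hx] := HS q erefl H; exists x.
exists D; split.
- split=> [p|p s r /(substT s r) H]; first by rewrite -G_0; apply: Din.
  by exists 0; apply: prv_weak H _.
- split=> // p q; split; first by apply: join => n; apply: prv_impE.
  have [Hq|Hq] := dec q.
    move=> _; move: Hq; apply: lift1 => n Hn; apply: prv_impI; apply: prv_weak Hn _.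
    by move=> r; right.
  have [Hp /(_ Hp) /(Dnot _ Hq)//|Hp _] := dec p.
  move: Hp; apply: lift1 => n Hn; apply: prv_impI; apply: prv_raa.
  apply: (@prv_notE _ p); last by apply: prv_hyp; right; left.
  by apply: prv_weak Hn _ => r; right; right.
- move=> q; split=> [H t|H]; first by move: H; apply: lift1 => n; apply: prv_allNE.
  by have [//|[x /Dnot/(_ (H _))]] := wN q.
- move=> q; split=> [H t|H]; first by move: H; apply: lift1 => n; apply: prv_allSE.
  by have [//|[x /Dnot/(_ (H _))]] := wS q.
- split=> [t|p s t]; first by exists 0; apply: prv_refl.
  by apply: join => n; apply: prv_leibniz.
Qed.

End MaximalExtension.

(** If [p] were not derivable, [Not p] would be consistent and its maximal extension the theory of a
    term model: numbers are terms up to provable equality, sets are the set variables. The language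
    has no equality of sets, so these need no quotient. *)
Theorem completeness p :
  (forall S, models S T -> forall e g, @sat S e g p) -> provable T p.
Proof.
move=> Hp; apply: prv_raa; apply: contrapT => cons0.
have [D [[D0 DT] [DB DI] DN DS [Drefl Dleib]]] := ex_maximal cons0.
have Dsym s t : D (Eqn s t) -> D (Eqn t s).
  move=> H; have := Dleib (Eqn (Var 0) (tsubst shift s)) s t H.
  rewrite /instN /= !tsubst_comp /= !tsubst_Var; apply; exact: Drefl.
have inst_shift s t : tsubst (scons s Var) (tsubst shift t) = t.
  by rewrite tsubst_comp /= tsubst_Var.
have Dctx v s t : D (Eqn s t) ->
    D (Eqn (tsubst (scons s Var) v) (tsubst (scons t Var) v)).
  move=> H; have := Dleib (Eqn (tsubst shift (tsubst (scons s Var) v)) v) s t H.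
  by rewrite /instN /= !inst_shift; apply; apply: Drefl.
have Dtrans s t u : D (Eqn s t) -> D (Eqn t u) -> D (Eqn s u).
  move=> H1 H2; have := Dleib (Eqn (tsubst shift s) (Var 0)) t u H2.
  by rewrite /instN /= !inst_shift; apply.
have Dadd s s' t t' : D (Eqn s s') -> D (Eqn t t') -> D (Eqn (Add s t) (Add s' t')).
  move=> H1 H2; apply: (@Dtrans _ (Add s' t)).
    by have := Dctx (Add (Var 0) (tsubst shift t)) _ _ H1; rewrite /= !inst_shift.
  by have := Dctx (Add (tsubst shift s') (Var 0)) _ _ H2; rewrite /= !inst_shift.
have Dmul s s' t t' : D (Eqn s s') -> D (Eqn t t') -> D (Eqn (Mul s t) (Mul s' t')).
  move=> H1 H2; apply: (@Dtrans _ (Mul s' t)).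
    by have := Dctx (Mul (Var 0) (tsubst shift t)) _ _ H1; rewrite /= !inst_shift.
  by have := Dctx (Mul (tsubst shift s') (Var 0)) _ _ H2; rewrite /= !inst_shift.
have Dlt s s' t t' : D (Eqn s s') -> D (Eqn t t') -> D (Less s t) -> D (Less s' t').
  move=> H1 H2 H; have := Dleib (Less (Var 0) (tsubst shift t)) s s' H1.
  rewrite /instN /= !inst_shift => /(_ H) H'.
  have := Dleib (Less (tsubst shift s') (Var 0)) t t' H2.
  by rewrite /instN /= !inst_shift; apply.
have Dmem s s' X : D (Eqn s s') -> D (Mem s X) -> D (Mem s' X).
  by move=> H1 H; have := Dleib (Mem (Var 0) X) s s' H1; apply.
pose M := {c : term -> Prop | exists t, c = fun u => D (Eqn t u)}.
pose q t : M := exist _ (fun u => D (Eqn t u)) (ex_intro _ t erefl).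
have q_eq s t : q s = q t <-> D (Eqn s t).
  split=> [[/(congr1 (fun c => c t)) /= ->]|H]; first exact: Drefl.
  apply: eq_exist; apply: funext => u; apply: propext.
  by split; apply: Dtrans => //; apply: Dsym.
have /choice [rep Hrep] (m : M) : exists t, q t = m.
  by case: m => c [t Ht]; exists t; apply: eq_exist.
have rep_q t : D (Eqn (rep (q t)) t) by apply/q_eq; rewrite Hrep.
pose S := @Structure M nat (q Zero) (q One) (fun m n => q (Add (rep m) (rep n)))
  (fun m n => q (Mul (rep m) (rep n))) (fun m n => D (Less (rep m) (rep n)))
  (fun m X => D (Mem (rep m) X)).
have eval_q s t : @eval S (fun i => q (s i)) t = q (tsubst s t).
  by elim: t => //= u -> v ->; apply/q_eq; [apply: Dadd|apply: Dmul].
(* Stated for all substitutions at once, since the quantifier cases extend the environment. *)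
have truth r : forall s g, @sat S (fun i => q (s i)) g r <-> D (subst s g r).
  elim: r => /= [|t u|t u|t X|r1 IH1 r2 IH2|r IH|r IH] s g.
  - by split=> // /DB.
  - by rewrite !eval_q q_eq.
  - by rewrite !eval_q; split; apply: Dlt => //; apply: Dsym.
  - by rewrite !eval_q; split; apply: Dmem => //; apply: Dsym.
  - by rewrite DI IH1 IH2.
  - rewrite DN; split=> [H t|H m].
      rewrite instN_up; apply/IH; have := H (q t); congr (sat _ _ _).
      by apply: funext => -[].
    have := H (rep m); rewrite instN_up => /IH; congr (sat _ _ _).
    by apply: funext => -[|i] //=; rewrite Hrep.
  - rewrite DS; split=> [H X|H X].
      by rewrite instS_upS; apply/IH.
    by have := H X; rewrite instS_upS => /IH.
have modT : models S T.
  move=> r Tr e g; have -> : e = fun i => q (rep (e i)) by apply: funext => i; rewrite Hrep.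
  by apply/truth; apply: DT.
have := Hp S modT (fun i => q (Var i)) id => /truth.
rewrite -[id]/id_set subst_id => Dp; apply: DB.
by apply: (proj1 (DI _ _) (D0 (Not p) _) Dp); left.
Qed.

End Provability.
(** * Closure of the axioms under substitution *)

Lemma Delta0_subst p : Delta0 p -> forall s r, Delta0 (subst s r p).
Proof.
move=> H; elim: H => {p} /=; try by constructor.
- move=> t p _ IH s r; rewrite tsubst_up_shift; exact: Delta0_all.
- move=> t p _ IH s r; rewrite tsubst_up_shift; exact: Delta0_ex.
Qed.

Lemma hierarchy_subst k p s r :
  (Sigma k p -> Sigma k (subst s r p)) /\ (Pi k p -> Pi k (subst s r p)).
Proof.
elim: k p s r => [|k IH] p s r; split=> H; inversion H; subst => /=.
- by constructor; apply: Delta0_subst.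
- by constructor; apply: Delta0_subst.
- by constructor; apply IH.
- by constructor; apply IH.
Qed.

Lemma subst_induction_for s r p :
  subst s r (induction_for p) = induction_for (subst (up s) r p).
Proof.
rewrite /induction_for /= subst_instN; congr (Imp (Not (Imp _ (Not (AllN (Imp _ _))))) _).
rewrite !subst_comp; congr (subst _ _ _); apply: funext => -[|i] //=.
by rewrite tsubst_comp.
Qed.

Lemma subst_comprehension_for s r p q :
  subst s r (comprehension_for p q) =
  comprehension_for (subst (up s) r p) (subst (up s) r q).
Proof. by rewrite /comprehension_for /= !subst_liftS. Qed.

(** The schemes are closed under substitution outright. A basic axiom has at most the variables 0
    and 1, so generalizing twice and instantiating with [s 1] and [s 0] gives the instance. *)
Lemma axioms_subst p s r :
  RCA0_ISigma2 p -> prv RCA0_ISigma2 nil (subst s r p).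
Proof.
case=> [[{}p Hp|{}p Hp|{}p q Hp Hq]|[{}p Hp]].
- have H : prv RCA0_ISigma2 nil p by apply: prv_ax; left; constructor.
  have -> : subst s r p = instN (s 0) (subst (up (scons (s 1) Var)) id_set p).
    by rewrite instN_up; case: Hp.
  apply: prv_allNE; apply: (@prv_allNE _ _ (AllN p) (s 1)).
  by apply: prv_allNI; apply: prv_allNI.
- rewrite subst_induction_for; apply: prv_ax; left; apply: RCA0_induction.
  by apply: (proj1 (hierarchy_subst _ _ _ _)).
- rewrite subst_comprehension_for; apply: prv_ax; left; apply: RCA0_comprehension.
    by apply: (proj1 (hierarchy_subst _ _ _ _)).
  by apply: (proj2 (hierarchy_subst _ _ _ _)).
- rewrite subst_induction_for; apply: prv_ax; right; constructor.
  by apply: (proj1 (hierarchy_subst _ _ _ _)).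
Qed.

(** * Definability in a structure *)

Section Definability.
Variable S : structure.
Notation M := (dom S).

Lemma sat_Not e g p : @sat S e g (Not p) <-> ~ sat e g p.
Proof. by []. Qed.

Lemma sat_And e g p q : @sat S e g (And p q) <-> sat e g p /\ sat e g q.
Proof.
split=> [/= H|[/= Hp Hq] H]; last exact: H.
by split; apply: contrapT => H'; apply: H => // Hp _; apply: H'.
Qed.

Lemma sat_Or e g p q : @sat S e g (Or p q) <-> sat e g p \/ sat e g q.
Proof.
split=> [/= H|[Hp /= /(_ Hp)//|Hq _ //]].
by have [Hp|/H] := pselect (sat e g p); [left|right].
Qed.

Lemma sat_Iff e g p q : @sat S e g (Iff p q) <-> (sat e g p <-> sat e g q).
Proof. by rewrite sat_And /=; split=> -[]. Qed.

Lemma sat_ExN e g p : @sat S e g (ExN p) <-> exists m, sat (scons m e) g p.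
Proof.
split=> [H|[m Hm] H]; last exact: (H m).
by apply: contrapT => H'; apply: H => m Hm; apply: H'; exists m.
Qed.

Lemma sat_ExS e g p : @sat S e g (ExS p) <-> exists X, sat e (scons X g) p.
Proof.
split=> [H|[m Hm] H]; last exact: (H m).
by apply: contrapT => H'; apply: H => m Hm; apply: H'; exists m.
Qed.

(* Each variable of a defining formula stands either for a coordinate of the
   argument or for a parameter from the structure. *)
Definition fill (v : nat -> nat + M) (e : nat -> M) : nat -> M :=
  fun i => match v i with inl j => e j | inr m => m end.

Definition tdef (t : (nat -> M) -> M) :=
  exists u v, forall e, eval (fill v e) u = t e.

(** Stated for predicates on environments instead of formulas: the closure properties below then let
    proof search find a defining formula. *)
Definition ddef (P : (nat -> M) -> Prop) :=
  exists p v g, Delta0 p /\ forall e, sat (fill v e) g p <-> P e.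

(** Two defining formulas get disjoint variables: one is moved to the even numbers, the other to the
    odd ones. *)
Definition merge {A} (v w : nat -> A) : nat -> A :=
  fun i => if odd i then w i./2 else v i./2.

Lemma merge_even {A} (v w : nat -> A) i : merge v w i.*2 = v i.
Proof. by rewrite /merge odd_double doubleK. Qed.

Lemma merge_odd {A} (v w : nat -> A) i : merge v w i.*2.+1 = w i.
Proof. by rewrite /merge /= odd_double /= uphalf_double. Qed.

Definition evenV i := Var i.*2.
Definition oddV i := Var i.*2.+1.

Lemma fill_even v w e : (fun i => eval (fill (merge v w) e) (evenV i)) = fill v e.
Proof. by apply: funext => i; rewrite /= /fill merge_even. Qed.

Lemma fill_odd v w e : (fun i => eval (fill (merge v w) e) (oddV i)) = fill w e.
Proof. by apply: funext => i; rewrite /= /fill merge_odd. Qed.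

Lemma ddef_merge P Q : ddef P -> ddef Q -> exists p q v g,
  [/\ Delta0 p, Delta0 q, forall e, sat (fill v e) g p <-> P e &
      forall e, sat (fill v e) g q <-> Q e].
Proof.
move=> [p [v [g [Dp Hp]]]] [q [w [h [Dq Hq]]]].
exists (subst evenV double p), (subst oddV (fun i => i.*2.+1) q), (merge v w), (merge g h).
split; try exact: Delta0_subst.
- move=> e; rewrite sat_subst fill_even -Hp.
  by under eq_fun do rewrite merge_even.
- move=> e; rewrite sat_subst fill_odd -Hq.
  by under eq_fun do rewrite merge_odd.
Qed.

Lemma ddef_ext P Q : (forall e, P e <-> Q e) -> ddef P -> ddef Q.
Proof.
move=> PQ [p [v [g [Dp Hp]]]]; exists p, v, g; split=> // e; by rewrite Hp.
Qed.

Lemma tdef_var i : tdef (fun e => e i).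
Proof. by exists (Var 0), (fun _ => inl i). Qed.

Lemma tdef_const m : tdef (fun _ => m).
Proof. by exists (Var 0), (fun _ => inr m). Qed.

Lemma tdef_add s t : tdef s -> tdef t -> tdef (fun e => addM (s e) (t e)).
Proof.
move=> [u [v Hu]] [u' [v' Hu']].
exists (Add (tsubst evenV u) (tsubst oddV u')), (merge v v') => e /=.
by rewrite !eval_tsubst fill_even fill_odd Hu Hu'.
Qed.

Lemma tdef_mul s t : tdef s -> tdef t -> tdef (fun e => mulM (s e) (t e)).
Proof.
move=> [u [v Hu]] [u' [v' Hu']].
exists (Mul (tsubst evenV u) (tsubst oddV u')), (merge v v') => e /=.
by rewrite !eval_tsubst fill_even fill_odd Hu Hu'.
Qed.

Lemma ddef_eq (i0 : sdom S) s t : tdef s -> tdef t -> ddef (fun e => s e = t e).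
Proof.
move=> [u [v Hu]] [u' [v' Hu']].
exists (Eqn (tsubst evenV u) (tsubst oddV u')), (merge v v'), (fun _ => i0).
split=> [|e /=]; first by constructor.
by rewrite !eval_tsubst fill_even fill_odd Hu Hu'.
Qed.

Lemma ddef_lt (i0 : sdom S) s t : tdef s -> tdef t -> ddef (fun e => ltM (s e) (t e)).
Proof.
move=> [u [v Hu]] [u' [v' Hu']].
exists (Less (tsubst evenV u) (tsubst oddV u')), (merge v v'), (fun _ => i0).
split=> [|e /=]; first by constructor.
by rewrite !eval_tsubst fill_even fill_odd Hu Hu'.
Qed.

Lemma ddef_mem X t : tdef t -> ddef (fun e => memM (t e) X).
Proof.
move=> [u [v Hu]]; exists (Mem u 0), v, (fun _ => X).
by split=> [|e /=]; [constructor|rewrite Hu].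
Qed.

Lemma ddef_imp P Q : ddef P -> ddef Q -> ddef (fun e => P e -> Q e).
Proof.
move=> HP /(ddef_merge HP) [p [q [v [g [Dp Dq Hp Hq]]]]].
exists (Imp p q), v, g; split=> [|e /=]; first exact: Delta0_imp.
by rewrite Hp Hq.
Qed.

Lemma ddef_not P : ddef P -> ddef (fun e => ~ P e).
Proof.
move=> [p [v [g [Dp Hp]]]]; exists (Not p), v, g.
split=> [|e]; first by apply: Delta0_imp => //; apply: Delta0_bot.
by rewrite sat_Not Hp.
Qed.

Lemma ddef_and P Q : ddef P -> ddef Q -> ddef (fun e => P e /\ Q e).
Proof.
move=> HP HQ; apply: (ddef_ext _ (ddef_not (ddef_imp HP (ddef_not HQ)))) => e.
by rewrite not_implyE notK.
Qed.

Lemma ddef_or P Q : ddef P -> ddef Q -> ddef (fun e => P e \/ Q e).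
Proof.
move=> HP HQ; apply: (ddef_ext _ (ddef_imp (ddef_not HP) HQ)) => e.
split=> [H|[//|//]]; by have [p|/H q] := pselect (P e); [left|right].
Qed.

Lemma ddef_ball Q t : ddef (fun e => Q (e 0) (fun i => e i.+1)) -> tdef t ->
  ddef (fun e => forall x, ltM x (t e) -> Q x e).
Proof.
move=> [p [v [g [Dp Hp]]]] [u [w Hu]].
(* Under the new quantifier the even variable [i.*2] has index [i.*2.+1]; variables that stand for
   coordinate 0 become the bound one. *)
pose s i := if v i is inl 0 then Var 0 else Var i.*2.+1.
pose v' i := match v i with inl j => inl j.-1 | inr m => inr m end.
exists (AllN (Imp (Less (Var 0) (tsubst shift (tsubst oddV u))) (subst s id_set p))),
  (merge v' w), g.
split=> [|e /=]; first by apply: Delta0_all; apply: Delta0_subst.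
have E x : (sat (scons x (fill (merge v' w) e)) g (subst s id_set p)) <-> Q x e.
  rewrite sat_subst -(Hp (scons x e)).
  suff -> : (fun i => eval (scons x (fill (merge v' w) e)) (s i)) = fill v (scons x e) by [].
  apply: funext => i; rewrite /s /fill.
  by case Ei: (v i) => [[|j]|m] //=; rewrite /fill merge_even /v' Ei.
have Et x : eval (scons x (fill (merge v' w) e)) (tsubst shift (tsubst oddV u)) = t e.
  by rewrite eval_tsubst /= eval_tsubst fill_odd Hu.
by split=> H x; have := H x; rewrite Et E.
Qed.

Lemma ddef_bex Q t : ddef (fun e => Q (e 0) (fun i => e i.+1)) -> tdef t ->
  ddef (fun e => exists x, ltM x (t e) /\ Q x e).
Proof.
move=> HQ Ht.
have H := @ddef_ball (fun x e => ~ Q x e) t (ddef_not HQ) Ht.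
apply: (ddef_ext _ (ddef_not H)) => e; split=> [H'|[x [xt Qx]] /(_ x xt)//].
apply: contrapT => H''; apply: H' => x xt Qx; apply: H''; by exists x.
Qed.

Definition cutoff k (e E : nat -> M) : nat -> M := fun i => if i < k then e i else E (i - k)%N.

(** The axiom schemes want the arguments in the variables below [k] and the parameters behind them.
    Coordinates from [k] on are frozen at zero, which does not affect a predicate of [k]
    arguments. *)
Lemma ddef_cutoff P Q k : ddef P -> ddef Q -> exists p q E g,
  [/\ Delta0 p, Delta0 q,
    forall e, sat (cutoff k e E) g p <-> P (cutoff k e (fun _ => zeroM S)) &
    forall e, sat (cutoff k e E) g q <-> Q (cutoff k e (fun _ => zeroM S))].
Proof.
move=> HP /(ddef_merge HP) [p [q [v [g [Dp Dq Hp Hq]]]]].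
pose s i := match v i with inl j => if j < k then Var j else Var (k + i)
                         | inr _ => Var (k + i) end.
pose E i := match v i with inl _ => zeroM S | inr m => m end.
exists (subst s id_set p), (subst s id_set q), E, g.
have Es e : (fun i => eval (cutoff k e E) (s i)) =
            fill v (cutoff k e (fun _ => zeroM S)).
  apply: funext => i; rewrite /s /fill.
  have Ek : cutoff k e E (k + i) = E i.
    by rewrite /cutoff ltnNge leq_addr /= addKn.
  case Ei: (v i) => [j|m]; last by rewrite /= Ek /E Ei.
  case: ifP => jk /=; first by rewrite /cutoff jk.
  by rewrite Ek /E Ei /cutoff jk.
split; try exact: Delta0_subst; move=> e; rewrite sat_subst Es; [exact: Hp|exact: Hq].
Qed.

End Definability.
(** * Induction and comprehension in a model *)

Lemma ddef_rename (S : structure) (P : (nat -> dom S) -> Prop) f :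
  ddef P -> ddef (fun e => P (fun i => e (f i))).
Proof.
move=> [p [v [g [Dp Hp]]]].
exists p, (fun i => match v i with inl j => inl (f j) | inr m => inr m end), g.
split=> // e; rewrite -Hp.
suff -> : fill (fun i => match v i with inl j => inl (f j) | inr m => inr m end) e =
  fill v (fun i => e (f i)) by [].
by apply: funext => i; rewrite /fill; case: (v i).
Qed.

Section Model.
Variable S : structure.
Hypothesis HS : models S RCA0_ISigma2.
Notation M := (dom S).
Notation "m .+" := (addM m (oneM S)) (at level 2, format "m .+").

Lemma induction_sat p E g : Sigma 2 p -> let P n := sat (scons n E) g p in
  P (zeroM S) -> (forall n : M, P n -> P n.+) -> forall n, P n.
Proof.
move=> Sp P P0 PS; have Hax : RCA0_ISigma2 (induction_for p) by right; constructor.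
have H : sat E g (And (instN Zero p)
    (AllN (Imp p (subst (scons (suc (Var 0)) shift) id_set p)))) -> sat E g (AllN p) := HS Hax E g.
apply: H; apply/sat_And; split.
  apply/sat_subst; suff -> : (fun i => eval E (scons Zero Var i)) = scons (zeroM S) E by [].
  by apply: funext => -[].
move=> n /= Hn; apply/sat_subst.
suff -> : (fun i => eval (scons n E) (scons (suc (Var 0)) shift i)) = scons n.+ E.
  exact: PS.
by apply: funext => -[].
Qed.

Lemma sigma2_induction (P : M -> Prop) (Q : M -> M -> M -> Prop) :
  ddef (fun e => Q (e 0) (e 1) (e 2)) ->
  (forall n, P n <-> exists x, forall y, Q y x n) ->
  P (zeroM S) -> (forall n, P n -> P n.+) -> forall n, P n.
Proof.
move=> dQ PQ P0 PS n; have [p [q [E [g [Dp _ Hp _]]]]] := ddef_cutoff 3 dQ dQ.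
have HP m : sat (scons m E) g (ExN (AllN p)) <-> P m.
  rewrite sat_ExN PQ /=.
  have H x y : sat (scons y (scons x (scons m E))) g p <-> Q y x m.
    have cut : cutoff 3 (scons y (scons x (scons m E))) E = scons y (scons x (scons m E)).
      by apply: funext => -[|[|[|i]]] //=; rewrite /cutoff /= subSS subn2.
    by have := Hp (scons y (scons x (scons m E))); rewrite cut.
  by split=> -[x Hx]; exists x => y; apply/H.
apply/HP; apply: induction_sat; first by do 3 constructor.
  exact/HP.
by move=> m /HP /PS /HP.
Qed.

Lemma sigma1_induction (P : M -> Prop) (Q : M -> M -> Prop) :
  ddef (fun e => Q (e 0) (e 1)) -> (forall n, P n <-> exists x, Q x n) ->
  P (zeroM S) -> (forall n, P n -> P n.+) -> forall n, P n.
Proof.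
move=> dQ PQ; apply: (@sigma2_induction P (fun _ x n => Q x n)).
  exact: (ddef_rename (fun i => i.+1) dQ).
by move=> n; rewrite PQ; split=> -[x Hx]; exists x => //; apply: Hx; exact: (zeroM S).
Qed.

Lemma delta0_induction (P : M -> Prop) :
  ddef (fun e => P (e 0)) ->
  P (zeroM S) -> (forall n, P n -> P n.+) -> forall n, P n.
Proof.
move=> dP; apply: (@sigma1_induction P (fun _ n => P n)).
  exact: (ddef_rename (fun i => i.+1) dP).
by move=> n; split=> [|[x]//]; exists (zeroM S).
Qed.

Lemma delta1_comprehension (P : M -> Prop) (A B : M -> M -> Prop) :
  ddef (fun e => A (e 0) (e 1)) -> ddef (fun e => B (e 0) (e 1)) ->
  (forall n, P n <-> exists x, A x n) -> (forall n, P n <-> forall x, B x n) ->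
  exists X : sdom S, forall n, memM n X <-> P n.
Proof.
move=> dA dB PA PB; have [p [q [E [g [Dp Dq Hp Hq]]]]] := ddef_cutoff 2 dA dB.
have cut x n : cutoff 2 (scons x (scons n E)) E = scons x (scons n E).
  by apply: funext => -[|[|i]] //=; rewrite /cutoff /= subn2.
have HA n : sat (scons n E) g (ExN p) <-> P n.
  rewrite sat_ExN PA; split=> -[x Hx]; exists x; move: Hx;
  by have := Hp (scons x (scons n E)); rewrite cut /cutoff /= => ->.
have HB n : sat (scons n E) g (AllN q) <-> P n.
  rewrite PB /=; split=> H x; move: (H x);
  by have := Hq (scons x (scons n E)); rewrite cut /cutoff /= => ->.
have Hax : RCA0_ISigma2 (comprehension_for (ExN p) (AllN q)).
  by left; apply: RCA0_comprehension; do 2 constructor.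
have H : sat E g (comprehension_for (ExN p) (AllN q)) := HS Hax E g.
have HI n : sat (scons n E) g (Iff (ExN p) (AllN q)).
  by apply/sat_Iff; apply: iff_trans (HA n) (iff_sym (HB n)).
have {HI} H : sat E g (ExS (AllN (Iff (Mem (Var 0) 0) (liftS (ExN p))))) := H HI.
have [X HX] := proj1 (@sat_ExS _ _ _ _) H.
have HXn n : sat (scons n E) (scons X g) (Iff (Mem (Var 0) 0) (liftS (ExN p))) := HX n.
exists X => n; move: (HXn n) => /sat_Iff; rewrite /liftS sat_subst.
by move=> {}HX; rewrite -HA; exact: HX.
Qed.

End Model.
(** * The ordered field of fractions of a discretely ordered semiring *)

(** The order is not a separate datum: a <= b is read as solvability of b = a + k, with totality in
    [ototal] and discreteness in [osucc]. *)
Record osemiring := OSemiring {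
  ocar :> Type;
  ozero : ocar; oone : ocar;
  oadd : ocar -> ocar -> ocar; omul : ocar -> ocar -> ocar;
  oaddA : associative oadd; oaddC : commutative oadd;
  oadd0 : left_id ozero oadd;
  omulA : associative omul; omulC : commutative omul;
  omul1 : left_id oone omul;
  omulDl : left_distributive omul oadd;
  omul0 : left_zero ozero omul;
  oone_neq0 : oone <> ozero;
  oaddI : forall a b c, oadd c a = oadd c b -> a = b;
  ototal : forall a b, (exists k, b = oadd a k) \/ (exists k, a = oadd b k);
  oadd_eq0 : forall a b, oadd a b = ozero -> a = ozero;
  omul_eq0 : forall a b, omul a b = ozero -> a = ozero \/ b = ozero;
  osucc : forall a, a <> ozero -> exists b, a = oadd b oone }.

HB.instance Definition _ (R : osemiring) := gen_eqMixin (ocar R).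
HB.instance Definition _ (R : osemiring) := gen_choiceMixin (ocar R).
HB.instance Definition _ (R : osemiring) :=
  GRing.isNmodule.Build (ocar R) (@oaddA R) (@oaddC R) (@oadd0 R).
HB.instance Definition _ (R : osemiring) :=
  GRing.Nmodule_isComNzSemiRing.Build (ocar R) (@omulA R) (@omulC R) (@omul1 R)
    (@omulDl R) (@omul0 R) (introN eqP (@oone_neq0 R)).

Local Open Scope ring_scope.

(** * The ring of formal differences *)

Definition zeqv (R : osemiring) (p q : R * R) : Prop := p.1 + q.2 = q.1 + p.2.

Definition zring (R : osemiring) :=
  {c : R * R -> Prop | exists p, c = zeqv p}.

Section Integers.
Variable R : osemiring.
Notation Z := (zring R).
Implicit Types a b c : R.

Lemma oaddrI a b c : c + a = c + b -> a = b.
Proof. exact: oaddI. Qed.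

Definition zcls (p : R * R) : Z := exist _ (zeqv p) (ex_intro _ p erefl).

Lemma zcls_eq p q : zcls p = zcls q <-> zeqv p q.
Proof.
split=> [[/(congr1 (fun f => f q)) /= ->]//|H].
apply: eq_exist; apply: funext => -[u v]; apply: propext.
case: p q H => [a b] [c d]; rewrite /zeqv /= => H; split=> H'.
- apply: (@oaddrI _ _ (a + b)).
  have -> : a + b + (c + v) = (a + v) + (c + b) by ring.
  by rewrite -H H'; ring.
- apply: (@oaddrI _ _ (c + d)).
  have -> : c + d + (a + v) = (c + v) + (a + d) by ring.
  by rewrite H H'; ring.
Qed.

Lemma zcls_surj (x : Z) : exists p, x = zcls p.
Proof. by case: x => c [p Hp]; exists p; apply: eq_exist. Qed.

Definition zrep (x : Z) : R * R := projT1 (cid (zcls_surj x)).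

Lemma zrepK x : zcls (zrep x) = x.
Proof. by rewrite /zrep; case: cid. Qed.

Lemma zrep_eqv p : zeqv (zrep (zcls p)) p.
Proof. by apply/zcls_eq; rewrite zrepK. Qed.

Definition zadd (x y : Z) := zcls ((zrep x).1 + (zrep y).1, (zrep x).2 + (zrep y).2).
Definition zopp (x : Z) := zcls ((zrep x).2, (zrep x).1).
Definition zmul (x y : Z) :=
  zcls ((zrep x).1 * (zrep y).1 + (zrep x).2 * (zrep y).2,
        (zrep x).1 * (zrep y).2 + (zrep x).2 * (zrep y).1).

Lemma zaddE a b c d : zadd (zcls (a, b)) (zcls (c, d)) = zcls (a + c, b + d).
Proof.
apply/zcls_eq; move: (zrep_eqv (a, b)) (zrep_eqv (c, d)).
case: (zrep (zcls (a, b))) (zrep (zcls (c, d))) => [x y] [z t].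
rewrite /zeqv /= => H1 H2.
have -> : x + z + (b + d) = (x + b) + (z + d) by ring.
by rewrite H1 H2; ring.
Qed.

Lemma zoppE a b : zopp (zcls (a, b)) = zcls (b, a).
Proof.
apply/zcls_eq; move: (zrep_eqv (a, b)).
case: (zrep (zcls (a, b))) => [x y]; rewrite /zeqv /= => H.
by rewrite addrC -H addrC.
Qed.

Lemma zmulE a b c d : zmul (zcls (a, b)) (zcls (c, d)) = zcls (a * c + b * d, a * d + b * c).
Proof.
apply/zcls_eq; move: (zrep_eqv (a, b)) (zrep_eqv (c, d)).
case: (zrep (zcls (a, b))) (zrep (zcls (c, d))) => [x y] [z t].
(* After adding this summand, both sides are combinations of [x + b], [a + y], [z + d] and [c + t],
   to which the two equivalences apply. *)
rewrite /zeqv /= => H1 H2; apply: (@oaddrI _ _ (a * t + b * z + (a * z + b * t))).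
transitivity ((x + b) * z + (a + y) * t + (a * (z + d) + b * (c + t))); first by ring.
transitivity ((a + y) * z + (x + b) * t + (a * (c + t) + b * (z + d))); last by ring.
by rewrite H1 H2.
Qed.

Definition zzero := zcls (0, 0).
Definition zone := zcls (1, 0).

Ltac zsurj x := let p := fresh in have [p ->] := zcls_surj x; case: p.

Lemma zaddA : associative zadd.
Proof. by move=> x y z; zsurj x => a b; zsurj y => c d; zsurj z => e f; rewrite !zaddE !addrA. Qed.
Lemma zaddC : commutative zadd.
Proof. by move=> x y; zsurj x => a b; zsurj y => c d; rewrite !zaddE addrC (addrC b). Qed.
Lemma zadd0 : left_id zzero zadd.
Proof. by move=> x; zsurj x => a b; rewrite zaddE !add0r. Qed.
Lemma zaddN : left_inverse zzero zopp zadd.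
Proof.
move=> x; zsurj x => a b; rewrite zoppE zaddE; apply/zcls_eq; rewrite /zeqv /=; ring.
Qed.

HB.instance Definition _ := gen_eqMixin Z.
HB.instance Definition _ := gen_choiceMixin Z.
HB.instance Definition _ := GRing.isZmodule.Build Z zaddA zaddC zadd0 zaddN.

Lemma zmulA : associative zmul.
Proof.
move=> x y z; zsurj x => a b; zsurj y => c d; zsurj z => e f; rewrite !zmulE.
by apply/zcls_eq; rewrite /zeqv /=; ring.
Qed.
Lemma zmulC : commutative zmul.
Proof.
move=> x y; zsurj x => a b; zsurj y => c d; rewrite !zmulE.
by apply/zcls_eq; rewrite /zeqv /=; ring.
Qed.
Lemma zmul1 : left_id zone zmul.
Proof. by move=> x; zsurj x => a b; rewrite zmulE !mul1r !mul0r !addr0. Qed.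
Lemma zmulDl : left_distributive zmul zadd.
Proof.
move=> x y z; zsurj x => a b; zsurj y => c d; zsurj z => e f; rewrite !(zmulE, zaddE).
by apply/zcls_eq; rewrite /zeqv /=; ring.
Qed.
Lemma zone_neq0 : zone != 0.
Proof.
apply/eqP => /zcls_eq; rewrite /zeqv /= !addr0 => /eqP; apply/negP; exact: oner_neq0.
Qed.

HB.instance Definition _ :=
  GRing.Zmodule_isComNzRing.Build Z zmulA zmulC zmul1 zmulDl zone_neq0.

Definition ofM a : Z := zcls (a, 0).

Lemma ofMD a b : ofM (a + b) = ofM a + ofM b.
Proof. by rewrite /ofM [RHS]zaddE addr0. Qed.
Lemma ofMM a b : ofM (a * b) = ofM a * ofM b.
Proof. by rewrite /ofM [RHS]zmulE !mulr0 !mul0r !addr0. Qed.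
Lemma ofM_inj : injective ofM.
Proof. by move=> a b /zcls_eq; rewrite /zeqv /= !addr0. Qed.
Lemma ofM0 : ofM 0 = 0. Proof. by []. Qed.
Lemma ofM1 : ofM 1 = 1. Proof. by []. Qed.

Lemma ofM_sign (x : Z) : exists a, x = ofM a \/ x = - ofM a.
Proof.
zsurj x => a b; have [[k ->]|[k ->]] := ototal b a; exists k; [left|right].
  by apply/zcls_eq; rewrite /zeqv /= addr0 addrC.
by rewrite [RHS]zoppE; apply/zcls_eq; rewrite /zeqv /= add0r.
Qed.

(** Inverses have to be supplied before the integral domain structure; they are picked by choice. *)
Definition zunit : {pred Z} := fun x => `[< exists y, y * x = 1 >].
Definition zinv (x : Z) : Z :=
  if pselect (exists y, y * x = 1) is left H then projT1 (cid H) else x.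

Lemma zmulVx : {in zunit, left_inverse 1 zinv *%R}.
Proof.
move=> x /asboolP H; rewrite /zinv; case: pselect => [H'|//].
by case: cid.
Qed.
Lemma zunitPl x y : y * x = 1 -> zunit x.
Proof. by move=> H; apply/asboolP; exists y. Qed.
Lemma zinv_out : {in [predC zunit], zinv =1 id}.
Proof.
by move=> x /negP H; rewrite /zinv; case: pselect => // H'; case: H; apply/asboolP.
Qed.

HB.instance Definition _ := GRing.ComNzRing_hasMulInverse.Build Z zmulVx zunitPl zinv_out.

Lemma zmul_eq0 (x y : Z) : x * y = 0 -> (x == 0) || (y == 0).
Proof.
have E a b : ofM a * ofM b = 0 -> (ofM a == 0) || (ofM b == 0).
  rewrite -ofMM -ofM0 => /ofM_inj /omul_eq0 [] ->; by rewrite eqxx ?orbT.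
have [a [->|->]] := ofM_sign x; have [b [->|->]] := ofM_sign y;
by rewrite ?mulNr ?mulrN ?opprK ?oppr_eq0 => H; apply: E => //; apply/eqP; move/eqP: H;
   rewrite ?oppr_eq0.
Qed.

HB.instance Definition _ := GRing.ComUnitRing_isIntegral.Build Z zmul_eq0.

End Integers.

(** * The field of fractions and its order *)

Definition ofrac (R : osemiring) := {fraction zring R}.
HB.instance Definition _ (R : osemiring) := GRing.Field.copy (ofrac R) {fraction zring R}.

Lemma add_div_eq0 (F : fieldType) (x y z t : F) :
  y != 0 -> t != 0 -> - (x / y) = z / t -> x * t + z * y = 0.
Proof.
move=> y0 t0 /(congr1 (+%R (x / y))); rewrite subrr addf_div // => /esym /eqP.
by rewrite mulf_eq0 invr_eq0 mulf_eq0 (negbTE y0) (negbTE t0) !orbF => /eqP.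
Qed.

Section Fractions.
Variable R : osemiring.
Notation K := (ofrac R).

Definition iota (a : R) : K := FracField.tofrac (ofM a).

Lemma iotaD a b : iota (a + b) = iota a + iota b.
Proof. by rewrite /iota ofMD rmorphD. Qed.
Lemma iotaM a b : iota (a * b) = iota a * iota b.
Proof. by rewrite /iota ofMM rmorphM. Qed.
Lemma iota0 : iota 0 = 0. Proof. by rewrite /iota ofM0 rmorph0. Qed.
Lemma iota1 : iota 1 = 1. Proof. by rewrite /iota ofM1 rmorph1. Qed.
Lemma iota_inj : injective iota.
Proof. by move=> a b /eqP; rewrite /iota tofrac_eq => /eqP /ofM_inj. Qed.
Lemma iota_eq0 a : (iota a == 0) = (a == 0).
Proof. by rewrite -iota0 (inj_eq iota_inj). Qed.

(** The cone of nonnegative elements, 0 included; order and absolute value are both read off from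
    it. *)
Definition kpos (x : K) : bool := `[< exists a d, d <> 0 /\ x = iota a / iota d >].
Definition kle (x y : K) := kpos (y - x).
Definition klt (x y : K) := (y != x) && kle x y.
Definition kabs (x : K) := if kpos x then x else - x.

Lemma kposP x : kpos x <-> exists a d, d <> 0 /\ x = iota a / iota d.
Proof. by split=> [/asboolP|H]//; apply/asboolP. Qed.

Lemma omul_neq0 (a b : R) : a <> 0 -> b <> 0 -> a * b <> 0.
Proof. by move=> Ha Hb /omul_eq0 [/Ha|/Hb]. Qed.

Lemma iota_neq0 a : a <> 0 -> iota a != 0.
Proof. by move=> /eqP; rewrite iota_eq0. Qed.

Lemma kposD x y : kpos x -> kpos y -> kpos (x + y).
Proof.
move=> /kposP [a [d [d0 ->]]] /kposP [b [e [e0 ->]]]; apply/kposP.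
exists (a * e + b * d), (d * e); split; first exact: omul_neq0.
by rewrite iotaD !iotaM addf_div ?iota_neq0.
Qed.

Lemma kposM x y : kpos x -> kpos y -> kpos (x * y).
Proof.
move=> /kposP [a [d [d0 ->]]] /kposP [b [e [e0 ->]]]; apply/kposP.
exists (a * b), (d * e); split; first exact: omul_neq0.
by rewrite !iotaM mulf_div.
Qed.

Lemma kpos_anti x : kpos x -> kpos (- x) -> x = 0.
Proof.
move=> /kposP [a [d [d0 ->]]] /kposP [b [e [e0 H]]].
have : iota (a * e + b * d) = iota 0.
  rewrite iotaD !iotaM iota0; have := iota_neq0 e0; have := iota_neq0 d0; move: H.
  by move=> H d0' e0'; apply: add_div_eq0 H.
move=> /iota_inj /oadd_eq0 /omul_eq0 [->|//].
by rewrite iota0 mul0r.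
Qed.

Lemma kpos_total x : kpos x || kpos (- x).
Proof.
(* A representative of the class gives numerator and denominator. Each is the image of an element of
   [R] up to sign, and the two signs combine into one. *)
have [n [m [m0 Hx]]] : exists n m : zring R,
    m != 0 /\ x * FracField.tofrac m = FracField.tofrac n.
  elim/quotW: x => r; exists (fraction.frac r).1, (fraction.frac r).2; split; first exact: denom_ratioP.
  unlock FracField.tofrac; rewrite -[LHS]FracField.pi_mul; apply/eqmodP.
  rewrite /= /FracField.equivf /FracField.mulf.
  by rewrite !numden_Ratio ?oner_neq0 ?mulr1 ?denom_ratioP // mulrC.
have {Hx} -> : x = FracField.tofrac n / FracField.tofrac m.
  by rewrite -Hx mulfK // tofrac_eq0.
have E a d : d <> 0 -> kpos (iota a / iota d) by move=> d0; apply/kposP; exists a, d.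
have [a [Ea|Ea]] := ofM_sign n; have [d [Ed|Ed]] := ofM_sign m;
  have {}m0 : d <> 0 by (move=> d0; move: m0; rewrite Ed d0 ofM0 ?oppr0 eqxx).
- by rewrite Ea Ed E.
- by rewrite Ea Ed tofracN invrN mulrN opprK E // orbT.
- by rewrite Ea Ed tofracN mulNr opprK E // orbT.
- by rewrite Ea Ed !tofracN invrN mulrNN E.
Qed.

Lemma kle0_add x y : kle 0 x -> kle 0 y -> kle 0 (x + y).
Proof. by rewrite /kle !subr0; apply: kposD. Qed.
Lemma kle0_mul x y : kle 0 x -> kle 0 y -> kle 0 (x * y).
Proof. by rewrite /kle !subr0; apply: kposM. Qed.
Lemma kle0_anti x : kle 0 x -> kle x 0 -> x = 0.
Proof. by rewrite /kle subr0 sub0r; apply: kpos_anti. Qed.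
Lemma kle_sub_ge0 x y : kle 0 (y - x) = kle x y.
Proof. by rewrite /kle subr0. Qed.
Lemma kle0_total x : kle 0 x || kle x 0.
Proof. by rewrite /kle subr0 sub0r kpos_total. Qed.
Lemma kabsN x : kabs (- x) = kabs x.
Proof.
rewrite /kabs opprK; case: ifP => Hn; case: ifP => // Hp.
  by rewrite (kpos_anti Hp Hn) oppr0.
by move: (kpos_total x); rewrite Hp Hn.
Qed.
Lemma kge0_abs x : kle 0 x -> kabs x = x.
Proof. by rewrite /kle subr0 /kabs => ->. Qed.
Lemma klt_def x y : klt x y = (y != x) && kle x y.
Proof. by []. Qed.

HB.instance Definition _ := Num.IntegralDomain_isLeReal.Build K
  kle0_add kle0_mul kle0_anti kle_sub_ge0 kle0_total kabsN kge0_abs klt_def.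

End Fractions.

Lemma ofrac_le (R : osemiring) (a b : R) :
  iota a <= iota b <-> exists k, b = a + k.
Proof.
have E (x y : ofrac R) : (x <= y) = kpos (y - x) by [].
have ge0 (c : R) : 0 <= iota c.
  rewrite E subr0; apply/kposP; exists c, 1; split; first exact: oone_neq0.
  by rewrite iota1 divr1.
split=> [H|[k ->]]; last by rewrite iotaD lerDl.
have [|[k Hk]] := ototal a b; first by [].
exists 0; rewrite addr0; apply: iota_inj; apply/le_anti; rewrite H andbT.
by rewrite Hk iotaD lerDl.
Qed.

(** Nonzero denominators are successors; the form c + 1 is the one used by the coding of
    rationals. *)
Lemma ofrac_repr (R : osemiring) (x : ofrac R) :
  exists a b c, x = (iota a - iota b) / (iota c + 1).
Proof.
have H y : kpos y -> exists a c : R, y = iota a / (iota c + 1).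
  move=> /kposP [a [d [/osucc [c ->] ->]]]; exists a, c.
  by rewrite iotaD iota1.
have /orP [/H [a [c ->]]|/H [a [c Hx]]] := kpos_total x.
  by exists a, 0, c; rewrite iota0 subr0.
by exists 0, a, c; rewrite iota0 sub0r mulNr -Hx opprK.
Qed.

Lemma field_of_fractions (R : osemiring) :
  exists (K : realFieldType) (f : R -> K),
  [/\ f (ozero R) = 0 /\ f (oone R) = 1, forall a b, f (oadd a b) = f a + f b,
      forall a b, f (omul a b) = f a * f b,
      forall a b, f a <= f b <-> exists k, b = oadd a k &
      forall x, exists a b c, x = (f a - f b) / (f c + 1)].
Proof.
exists (ofrac R : realFieldType), (@iota R); split.
- by rewrite iota0 iota1.
- exact: iotaD.
- exact: iotaM.
- exact: ofrac_le.
- exact: ofrac_repr.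
Qed.
(** * Arithmetic in a model *)

Ltac definable_step := cbv beta; first
  [ assumption
  | apply: tdef_var | apply: tdef_add | apply: tdef_mul | apply: tdef_const
  | apply: ddef_ball | apply: ddef_bex
  | apply: ddef_mem | apply: ddef_eq | apply: ddef_lt
  | apply: ddef_and | apply: ddef_or | apply: ddef_not
  | apply: ddef_imp ].
Ltac definable := repeat definable_step.

Section Arithmetic.
Local Close Scope ring_scope.
Variable S : structure.
Hypothesis HS : models S RCA0_ISigma2.
Variable X0 : sdom S.
Notation M := (dom S).
Local Notation "0" := (zeroM S).
Local Notation "1" := (oneM S).
Local Notation "m + n" := (addM m n).
Local Notation "m * n" := (mulM m n).
Local Notation "m < n" := (ltM m n).
Implicit Types a b c k m n : M.

Let basic p (b : basic_axiom p) x y := HS (or_introl (RCA0_basic p b)) (scons x (scons y (fun _ => 0))) (fun _ => X0).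

Lemma succ_neq0 m : m + 1 <> 0.
Proof. exact: (basic basic_suc_neq m m). Qed.
Lemma succ_inj m n : m + 1 = n + 1 -> m = n.
Proof. exact: (basic basic_suc_inj m n). Qed.
Lemma addm0 m : m + 0 = m.
Proof. exact: (basic basic_add0 m m). Qed.
Lemma addmS m n : m + (n + 1) = m + n + 1.
Proof. exact: (basic basic_addS m n). Qed.
Lemma mulm0 m : m * 0 = 0.
Proof. exact: (basic basic_mul0 m m). Qed.
Lemma mulmS m n : m * (n + 1) = m * n + m.
Proof. exact: (basic basic_mulS m n). Qed.
Lemma ltm0 m : ~ m < 0.
Proof. exact: (basic basic_lt0 m m). Qed.
Lemma ltmS m n : m < n + 1 <-> m < n \/ m = n.
Proof.
have /sat_Iff := basic basic_ltS m n; rewrite sat_Or; exact.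
Qed.

Lemma ind (P : M -> Prop) : ddef (fun e => P (e O)) ->
  P 0 -> (forall n, P n -> P (n + 1)) -> forall n, P n.
Proof. exact: delta0_induction. Qed.

Ltac induct n := pattern n; apply: (ind _ _ _ n); [by definable| |].

Lemma addmA a b c : a + (b + c) = a + b + c.
Proof.
induct c; first by rewrite !addm0.
by move=> {}c IH; rewrite !addmS IH.
Qed.

Lemma add0m a : 0 + a = a.
Proof.
induct a; first by rewrite addm0.
by move=> {}a IH; rewrite addmS IH.
Qed.

Lemma addSm a b : a + 1 + b = a + b + 1.
Proof.
induct b; first by rewrite !addm0.
by move=> {}b IH; rewrite !addmS IH.
Qed.

Lemma addmC a b : a + b = b + a.
Proof.
induct b; first by rewrite addm0 add0m.
by move=> {}b IH; rewrite addmS addSm IH.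
Qed.

Lemma mul0m a : 0 * a = 0.
Proof.
induct a; first by rewrite mulm0.
by move=> {}a IH; rewrite mulmS IH addm0.
Qed.

Lemma mulSm a b : (a + 1) * b = a * b + b.
Proof.
induct b; first by rewrite !mulm0 addm0.
move=> {}b IH; rewrite !mulmS IH -!addmA; congr (_ + _).
by rewrite !addmS (addmC a).
Qed.

Lemma mulmC a b : a * b = b * a.
Proof.
induct b; first by rewrite mulm0 mul0m.
by move=> {}b IH; rewrite mulmS mulSm IH.
Qed.

Lemma mulmDr a b c : a * (b + c) = a * b + a * c.
Proof.
induct c; first by rewrite mulm0 !addm0.
by move=> {}c IH; rewrite addmS !mulmS IH addmA.
Qed.

Lemma mulmA a b c : a * (b * c) = a * b * c.
Proof.
induct c; first by rewrite !mulm0.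
by move=> {}c IH; rewrite !mulmS mulmDr IH.
Qed.

Lemma mulmDl a b c : (a + b) * c = a * c + b * c.
Proof. by rewrite !(mulmC _ c) mulmDr. Qed.

Lemma mul1m a : 1 * a = a.
Proof. by rewrite -[1]add0m mulSm mul0m add0m. Qed.

Lemma addIm a b c : c + a = c + b -> a = b.
Proof.
move=> H; have {}H : a + c = b + c by rewrite !(addmC _ c).
move: H; induct c; first by rewrite !addm0.
by move=> {}c IH; rewrite !addmS => /succ_inj.
Qed.

Lemma zero_or_succ a : a = 0 \/ exists b, a = b + 1.
Proof.
pattern a; apply: (@sigma1_induction _ HS _ (fun b a => a = 0 \/ a = b + 1) _ _ _ _ a).
- by definable.
- move=> n; split=> [[->|[b ->]]|[b [->|->]]]; [|exists b|left|right]; last by exists b.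
  by exists 0; left. by right. by [].
- by left.
- by move=> n _; right; exists n.
Qed.

Lemma totalm a b : (exists k, b = a + k) \/ (exists k, a = b + k).
Proof.
pattern a; apply: (@sigma1_induction _ HS _ (fun k a => b = a + k \/ a = b + k) _ _ _ _ a).
- by definable.
- move=> n; split=> [[[k H]|[k H]]|[k [H|H]]]; try (exists k); auto.
    by left; exists k. by right; exists k.
- by left; exists b; rewrite add0m.
- move=> n [[k ->]|[k ->]]; last by right; exists (k + 1); rewrite addmS.
  have [->|[j ->]] := zero_or_succ k; first by right; exists 1; rewrite addm0.
  by left; exists j; rewrite addmS addSm.
Qed.

Lemma addm_eq0 a b : a + b = 0 -> a = 0.
Proof.
by have [->|[c ->]] := zero_or_succ b; [rewrite addm0|rewrite addmS => /succ_neq0].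
Qed.

Lemma mulm_eq0 a b : a * b = 0 -> a = 0 \/ b = 0.
Proof.
have [->|[c ->]] := zero_or_succ b; first by right.
by rewrite mulmS addmC => /addm_eq0; left.
Qed.

Lemma ltmE a b : a < b <-> exists k, b = a + k + 1.
Proof.
have lt_succ k : a < a + k + 1.
  induct k; first by apply/ltmS; right; rewrite addm0.
  by move=> {}k IH; apply/ltmS; left; rewrite addmS.
split=> [|[k ->]//].
(* The witness stands in front of the implication, so that the induction statement is Sigma^0_1. *)
pattern b; apply: (@sigma1_induction _ HS _ (fun k b => a < b -> b = a + k + 1) _ _ _ _ b).
- by definable.
- move=> n; split=> [H|[k H] an]; last by exists k; apply: H.
  by have [/H [k Hk]|H'] := pselect (a < n); [exists k|exists 0].
- by move=> /ltm0.
- move=> n IH /ltmS [/IH [k ->]|->]; first by exists (k + 1); rewrite addmS.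
  by exists 0; rewrite addm0.
Qed.

Lemma neq0_succ a : a <> 0 -> exists b, a = b + 1.
Proof. by have [->|] := zero_or_succ a. Qed.

Lemma one_neq0m : 1 <> 0.
Proof. by rewrite -[1]add0m; apply: succ_neq0. Qed.

Definition model_osemiring := @OSemiring M 0 1 (@addM S) (@mulM S)
  addmA addmC add0m mulmA mulmC mul1m mulmDl mul0m
  one_neq0m
  addIm totalm addm_eq0 mulm_eq0 neq0_succ.

Lemma model_field : exists (K : realFieldType) (f : M -> K),
  [/\ f 0 = 0%R /\ f 1 = 1%R, forall a b, f (a + b) = (f a + f b)%R,
      forall a b, f (a * b) = (f a * f b)%R,
      forall a b, a < b <-> (f a < f b)%R &
      forall x, exists a b c, x = ((f a - f b) / (f c + 1))%R].
Proof.
have [K [f [f01 fD fM fle fK]]] := @field_of_fractions model_osemiring.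
exists K, f; split=> // a b; rewrite ltmE lt_def; split=> [[k ->]|/andP [ne /fle [k Hk]]].
  apply/andP; split; last by apply/fle; exists (k + 1); exact: esym (addmA a k 1).
  apply/eqP => E; have /fle [j /= Hj] : (f (addM (addM a k) (oneM S)) <= f a)%R by rewrite E.
  have {}Hj : a + 0 = a + (k + j + 1) by rewrite addm0 {1}Hj -!addmA (addmC j).
  by apply: (@succ_neq0 (k + j)); rewrite -(addIm Hj).
have [k0|[j kj]] := zero_or_succ k.
  by move: ne; rewrite Hk k0 /= addm0 eqxx.
by exists j; rewrite -addmA -kj.
Qed.

End Arithmetic.
(** * Rational numbers of a model *)

(** A model together with an ordered field generated by its numbers, so that inequalities between
    rationals of the model become goals for [lra] and [nra]. *)
Record arith_model := ArithModel {
  astr :> structure;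
  amodels : models astr RCA0_ISigma2;
  aset : sdom astr;
  afld : realFieldType;
  num : dom astr -> afld;
  num01 : num (zeroM astr) = 0%R /\ num (oneM astr) = 1%R;
  numD : forall a b, num (addM a b) = (num a + num b)%R;
  numM : forall a b, num (mulM a b) = (num a * num b)%R;
  num_lt : forall a b, ltM a b <-> (num a < num b)%R;
  num_frac : forall x, exists a b c, x = ((num a - num b) / (num c + 1))%R }.

Section Rationals.
Local Open Scope ring_scope.
Variable A : arith_model.
Notation M := (dom A).
Notation K := (afld A).
Local Notation "n %:K" := (@num A n) (at level 2, left associativity, format "n %:K").
Implicit Types a b c n m q : M.

Lemma num0 : (zeroM A)%:K = 0. Proof. by case: (num01 A). Qed.
Lemma num1 : (oneM A)%:K = 1. Proof. by case: (num01 A). Qed.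

Lemma numS n : (addM n (oneM A))%:K = n%:K + 1.
Proof. by rewrite numD num1. Qed.

Let HA := @amodels A.
Let A0 := aset A.

Lemma num_inj a b : a%:K = b%:K -> a = b.
Proof.
move=> E; have nlt x y : x%:K = y%:K -> ~ ltM x y by move=> E' /num_lt; rewrite E' ltxx.
have [[k Hk]|[k Hk]] := @totalm _ HA A0 a b.
  have [k0|[j kj]] := zero_or_succ HA A0 k; first by rewrite Hk k0 (addm0 HA A0).
  by case: (nlt _ _ E); apply/(ltmE HA A0); exists j; rewrite Hk kj (addmA HA A0).
have [k0|[j kj]] := zero_or_succ HA A0 k; first by rewrite Hk k0 (addm0 HA A0).
by case: (nlt _ _ (esym E)); apply/(ltmE HA A0); exists j; rewrite Hk kj (addmA HA A0).
Qed.

Lemma num_le a b : (ltM a b \/ a = b) <-> a%:K <= b%:K.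
Proof.
rewrite le_eqVlt; split=> [[/num_lt ->|->]|/orP [/eqP /num_inj ->|/num_lt]]; rewrite ?orbT ?eqxx //;
  by [right|left].
Qed.

Lemma num_ge0 a : 0 <= a%:K.
Proof.
rewrite -num0; apply/num_le; have [->|[b ->]] := zero_or_succ HA A0 a; first by right.
by left; apply/(ltmE HA A0); exists b; rewrite (add0m HA A0).
Qed.

Lemma num_succ_le a b : a%:K < b%:K -> a%:K + 1 <= b%:K.
Proof.
move=> /num_lt /(ltmE HA A0) [k ->]; rewrite !numD num1.
by have := num_ge0 k; lra.
Qed.

Lemma num_lt_succ a b : a%:K < b%:K + 1 -> a%:K <= b%:K.
Proof. by move=> H; rewrite leNgt; apply/negP => /num_succ_le; lra. Qed.

(** The Archimedean property relative to the numbers of the model, which may be nonstandard. *)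
Lemma num_bound (x : K) : exists n, x <= n%:K.
Proof.
have [a [b [c ->]]] := num_frac x; exists a; rewrite ler_pdivrMr; last first.
  by have := num_ge0 c; lra.
have := num_ge0 a; have := num_ge0 b; have := num_ge0 c; nra.
Qed.

Definition ninv n : K := (n%:K + 1)^-1.

Lemma succ_gt0 n : 0 < n%:K + 1.
Proof. by have := num_ge0 n; lra. Qed.

Lemma ninv_gt0 n : 0 < ninv n.
Proof. by rewrite invr_gt0 succ_gt0. Qed.

Lemma ninv_mul n : ninv n * (n%:K + 1) = 1.
Proof. by rewrite mulVf // gt_eqF ?succ_gt0. Qed.

Lemma exists_ninv (x : K) : 0 < x -> exists n, ninv n < x.
Proof.
move=> x0; have [n Hn] := num_bound x^-1; exists n.
rewrite invf_plt ?posrE ?succ_gt0 //; lra.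
Qed.

(** The field is no sort of the model, so a function into it counts as definable when numerator and
    denominator are terms. *)
Definition rdef (t : (nat -> M) -> K) :=
  exists p n d : (nat -> M) -> M, [/\ tdef p, tdef n, tdef d &
    forall e, t e = ((p e)%:K - (n e)%:K) * ninv (d e)].

Lemma ninv0 : ninv (zeroM A) = 1.
Proof. by rewrite /ninv num0 add0r invr1. Qed.

Lemma rdef_num t : tdef t -> rdef (fun e => (t e)%:K).
Proof.
move=> dt; exists t, (fun _ => zeroM A), (fun _ => zeroM A).
by split=> [|||e]; rewrite ?num0 ?ninv0 ?subr0 ?mulr1 //; apply: tdef_const.
Qed.

Lemma rdef_const x : rdef (fun _ => x).
Proof.
have [a [b [c ->]]] := num_frac x.
by exists (fun _ => a), (fun _ => b), (fun _ => c); split=> //; apply: tdef_const.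
Qed.

Lemma rdef_ninv t : tdef t -> rdef (fun e => ninv (t e)).
Proof.
move=> dt; exists (fun _ => oneM A), (fun _ => zeroM A), t.
by split=> [|||e]; rewrite ?num0 ?num1 ?subr0 ?mul1r //; apply: tdef_const.
Qed.

Lemma rdef_opp t : rdef t -> rdef (fun e => - t e).
Proof.
move=> [p [n [d [dp dn dd H]]]]; exists n, p, d; split=> // e.
by rewrite H -mulNr opprB.
Qed.

(** Denominators are stored less one, and [dmul a b] plus 1 is (a + 1)(b + 1). *)
Definition dmul a b := addM (mulM a b) (addM a b).

Lemma ninvM a b : ninv (dmul a b) = ninv a * ninv b.
Proof. by rewrite /ninv -invfM !numD numM; congr (_^-1); ring. Qed.

Lemma rdef_mul s t : rdef s -> rdef t -> rdef (fun e => s e * t e).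
Proof.
move=> [p [n [d [dp dn dd H]]]] [p' [n' [d' [dp' dn' dd' H']]]].
exists (fun e => addM (mulM (p e) (p' e)) (mulM (n e) (n' e))),
  (fun e => addM (mulM (p e) (n' e)) (mulM (n e) (p' e))), (fun e => dmul (d e) (d' e)).
split=> [|||e]; last by rewrite H H' ninvM !(numD, numM); ring.
all: by rewrite /dmul; definable.
Qed.

Lemma rdef_add s t : rdef s -> rdef t -> rdef (fun e => s e + t e).
Proof.
move=> [p [n [d [dp dn dd H]]]] [p' [n' [d' [dp' dn' dd' H']]]].
exists (fun e => addM (mulM (p e) (addM (d' e) (oneM A))) (mulM (p' e) (addM (d e) (oneM A)))),
  (fun e => addM (mulM (n e) (addM (d' e) (oneM A))) (mulM (n' e) (addM (d e) (oneM A)))),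
  (fun e => dmul (d e) (d' e)).
split=> [|||e]; [by definable|by definable|by rewrite /dmul; definable|].
rewrite H H' ninvM !(numD, numM) num1.
have := ninv_mul (d e); have := ninv_mul (d' e).
set x := ninv (d e); set y := ninv (d' e) => Hy Hx.
transitivity (((p e)%:K - (n e)%:K) * x * (y * ((d' e)%:K + 1)) +
  ((p' e)%:K - (n' e)%:K) * y * (x * ((d e)%:K + 1))); first by rewrite Hx Hy !mulr1.
by ring.
Qed.

Lemma ddef_rle s t : rdef s -> rdef t -> ddef (fun e => s e <= t e).
Proof.
move=> [p [n [d [dp dn dd H]]]] [p' [n' [d' [dp' dn' dd' H']]]].
apply: (@ddef_ext _ (fun e => ~ ltM
  (addM (mulM (p' e) (addM (d e) (oneM A))) (mulM (n e) (addM (d' e) (oneM A))))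
  (addM (mulM (p e) (addM (d' e) (oneM A))) (mulM (n' e) (addM (d e) (oneM A)))))).
  move=> e; rewrite num_lt !(numD, numM) num1 H H' /ninv.
  rewrite ler_pdivrMr ?succ_gt0 // mulrAC ler_pdivlMr ?succ_gt0 //.
  set u := (p e)%:K; set v := (p' e)%:K; set x := (n e)%:K; set y := (n' e)%:K.
  set d1 := (d e)%:K; set d2 := (d' e)%:K.
  split=> [/negP|H1]; last apply/negP; rewrite -leNgt; nra.
apply: ddef_not; apply: ddef_lt; first exact: (aset A).
all: definable.
Qed.

Lemma ddef_rlt s t : rdef s -> rdef t -> ddef (fun e => s e < t e).
Proof.
move=> ds dt; apply: (@ddef_ext _ (fun e => ~ (t e <= s e))).
  by move=> e; rewrite ltNge; split=> /negP.
by apply: ddef_not; apply: ddef_rle.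
Qed.

Lemma ddef_req s t : rdef s -> rdef t -> ddef (fun e => s e = t e).
Proof.
move=> ds dt; apply: (@ddef_ext _ (fun e => s e <= t e /\ t e <= s e)).
  by move=> e; split=> [[H1 H2]|->//]; apply/le_anti; rewrite H1 H2.
by apply: ddef_and; apply: ddef_rle.
Qed.

Lemma least (P : M -> Prop) : ddef (fun e => P (e O)) -> (exists n, P n) ->
  exists n, P n /\ forall m, P m -> n%:K <= m%:K.
Proof.
move=> dP [n Pn]; apply: contrapT => H.
have {}H m : P m -> exists k, P k /\ k%:K < m%:K.
  move=> Pm; apply: contrapT => H'; apply: H; exists m; split=> // k Pk.
  by rewrite leNgt; apply/negP => km; apply: H'; exists k.
suff /(_ n Pn) : forall m, ~ P m by [].
suff all_lt : forall m k, ltM k m -> ~ P k.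
  by move=> m; apply: (all_lt (addM m (oneM A))); apply/num_lt; rewrite numS; lra.
apply: (delta0_induction HA).
- by apply: ddef_ball; [apply: ddef_not; exact: (ddef_rename (fun _ => O) dP)|definable].
- by move=> k /(ltm0 HA A0).
- move=> m IH k /(ltmS HA A0) [/IH//|-> /H [j [Pj /num_lt /IH]]].
  by apply.
Qed.

(** * Codes of pairs and of rationals *)

Definition pr i j : M := addM (mulM (addM i j) (addM i j)) i.

Lemma num_pr i j : (pr i j)%:K = (i%:K + j%:K) ^+ 2 + i%:K.
Proof. by rewrite /pr !(numD, numM). Qed.

Lemma pr_inj i j i' j' : pr i j = pr i' j' -> i = i' /\ j = j'.
Proof.
have H x y x' y' : x%:K + y%:K < x'%:K + y'%:K -> (pr x y)%:K < (pr x' y')%:K.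
  rewrite -!numD => /num_succ_le; rewrite !num_pr !numD.
  have := num_ge0 x; have := num_ge0 y; have := num_ge0 x'; have := num_ge0 y'; nra.
move=> E; have E' := congr1 (@num A) E.
have : i%:K + j%:K = i'%:K + j'%:K.
  apply/le_anti; rewrite !leNgt; apply/andP; split; apply/negP => /H; rewrite E ltxx //.
move: E'; rewrite !num_pr => + E2; rewrite E2 => /addrI E3.
by split; apply: num_inj => //; lra.
Qed.

Lemma num_01_ge1 i : i%:K = 0 \/ 1 <= i%:K.
Proof.
have [->|i0] := pselect (i = zeroM A); [by left; rewrite num0|right].
have := @num_succ_le (zeroM A) i; rewrite num0 add0r; apply.
rewrite lt_def num_ge0 andbT; apply/eqP => H; apply: i0; apply: num_inj.
by rewrite num0.
Qed.

Lemma pr_gel i j : i%:K <= (pr i j)%:K.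
Proof. rewrite num_pr; have := sqr_ge0 (i%:K + j%:K); lra. Qed.

Lemma pr_ger i j : j%:K <= (pr i j)%:K.
Proof.
rewrite num_pr; have := num_ge0 i; have := num_ge0 j.
have [->|] := num_01_ge1 j; nra.
Qed.

(** Total, with value 0 off the codes of pairs, so that every number can later be read as the code
    of a cone or of a ball. *)
Definition pfst (n : M) : M :=
  if pselect (exists i, exists j, n = pr i j) is left H then projT1 (cid H) else zeroM A.
Definition psnd (n : M) : M :=
  if pselect (exists j, exists i, n = pr i j) is left H then projT1 (cid H) else zeroM A.

Lemma pfst_pr i j : pfst (pr i j) = i.
Proof.
rewrite /pfst; case: pselect => [H|[]]; last by exists i, j.
by case: cid => i' /= [j' /pr_inj [->]].
Qed.
Lemma psnd_pr i j : psnd (pr i j) = j.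
Proof.
rewrite /psnd; case: pselect => [H|[]]; last by exists j, i.
by case: cid => i' /= [j' /pr_inj [_ ->]].
Qed.

Lemma psnd_le n : (psnd n)%:K <= n%:K.
Proof.
rewrite /psnd; case: pselect => [H|_]; last by rewrite num0 num_ge0.
by case: cid => i' /= [j' ->]; apply: pr_ger.
Qed.

Definition tri a b c : M := pr (pr a b) c.
Definition trv a b c : K := (a%:K - b%:K) * ninv c.

Lemma tri_ge a b c : [/\ a%:K <= (tri a b c)%:K, b%:K <= (tri a b c)%:K & c%:K <= (tri a b c)%:K].
Proof.
split; last exact: pr_ger.
- exact: le_trans (pr_gel _ _) (pr_gel _ _).
- exact: le_trans (pr_ger _ _) (pr_gel _ _).
Qed.

Definition israt q := exists a b c, q = tri a b c /\
  forall a' b' c', trv a b c = trv a' b' c' -> q%:K <= (tri a' b' c')%:K.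

(* Meaningful for the codes [q] of triples only. *)
Definition ratv q : K := trv (pfst (pfst q)) (psnd (pfst q)) (psnd q).

Lemma ratv_tri a b c : ratv (tri a b c) = trv a b c.
Proof. by rewrite /ratv /tri !(pfst_pr, psnd_pr). Qed.

Lemma israt_inj q q' : israt q -> israt q' -> ratv q = ratv q' -> q = q'.
Proof.
move=> [a [b [c [-> H]]]] [a' [b' [c' [-> H']]]]; rewrite !ratv_tri => E.
by apply: num_inj; apply/le_anti; rewrite H // H'.
Qed.

Lemma rdef_trv s t u : tdef s -> tdef t -> tdef u -> rdef (fun e => trv (s e) (t e) (u e)).
Proof. by move=> ds dt du; exists s, t, u. Qed.

Lemma tdef_pr s t : tdef s -> tdef t -> tdef (fun e => pr (s e) (t e)).
Proof. by move=> ds dt; rewrite /pr; definable. Qed.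

Lemma tdef_tri s t u : tdef s -> tdef t -> tdef u -> tdef (fun e => tri (s e) (t e) (u e)).
Proof. by move=> ds dt du; apply: tdef_pr => //; apply: tdef_pr. Qed.

Lemma ltM_succ a b : ltM a (addM b (oneM A)) <-> a%:K <= b%:K.
Proof. by rewrite num_lt numS; split=> [/num_lt_succ|]//; lra. Qed.

Lemma rat_exists (x : K) : exists q, israt q /\ ratv q = x.
Proof.
(* The components of a triple are at most its code, so the bounds lose nothing; they make [P]
   Delta^0_0, as [least] demands. *)
pose P q := exists a, ltM a (addM q (oneM A)) /\ exists b, ltM b (addM q (oneM A)) /\
  exists c, ltM c (addM q (oneM A)) /\ (q = tri a b c /\ trv a b c = x).
have PE a b c : trv a b c = x -> P (tri a b c).
  move=> E; have [Ha Hb Hc] := tri_ge a b c.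
  exists a; split; [exact/ltM_succ|exists b; split; [exact/ltM_succ|exists c; split=> //; exact/ltM_succ]].
have [||q [[a [_ [b [_ [c [_ [-> E]]]]]]] Hq]] := @least P.
- apply: ddef_bex; last by definable.
  apply: ddef_bex; last by definable.
  apply: ddef_bex; last by definable.
  cbv beta; apply: ddef_and; first by apply: (ddef_eq A0); [definable|apply: tdef_tri; definable].
  by apply: ddef_req; [apply: rdef_trv; definable|apply: rdef_const].
- by have [a [b [c E]]] := num_frac x; exists (tri a b c); apply: PE; rewrite E.
- exists (tri a b c); rewrite ratv_tri; split=> //; exists a, b, c; split=> // a' b' c' E'.
  by apply: Hq; apply: PE; rewrite -E'.
Qed.

Definition is_tri q := q = tri (pfst (pfst q)) (psnd (pfst q)) (psnd q).

Lemma is_triP a b c : is_tri (tri a b c).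
Proof. by rewrite /is_tri /tri !(pfst_pr, psnd_pr). Qed.

(** Comparing with all triples of the same value amounts to comparing with smaller codes. Together
    with decoding, itself a bounded search, this makes being a rational code Delta^0_0. *)
Lemma isratE q : israt q <->
  is_tri q /\ forall q', ltM q' q -> is_tri q' -> ratv q' <> ratv q.
Proof.
split=> [[a [b [c [-> H]]]]|[Hq H]].
  split=> [|q' qq' Hq']; first exact: is_triP.
  rewrite ratv_tri /ratv => E; have := H _ _ _ (esym E); rewrite -Hq' leNgt.
  by move/num_lt: qq' => ->.
exists (pfst (pfst q)), (psnd (pfst q)), (psnd q); split=> // a b c E.
rewrite leNgt; apply/negP => /num_lt /H /(_ (is_triP _ _ _)); apply.
by rewrite ratv_tri -E.
Qed.

End Rationals.
(** * Meaning of the named formulas *)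

Section Denotation.
Local Open Scope ring_scope.
Variable A : arith_model.
Notation M := (dom A).
Notation SS := (sdom A).
Notation K := (afld A).
Local Notation "n %:K" := (@num A n) (at level 2, left associativity, format "n %:K").

(* The values of the enclosing quantified variables, innermost first. *)
Definition world := (seq M * seq SS)%type.

(** A named variable computes its index from the depth at which it is used. A denotation therefore
    has to hold under all further binders, that is, in all extensions of the world. *)
Definition extends (w v : world) := exists l k, v = (l ++ w.1, k ++ w.2).

Variables (ne0 : nat -> M) (se0 : nat -> SS).
Definition numenv (w : world) : nat -> M := fun i => nth (ne0 (i - size w.1)%N) w.1 i.
Definition setenv (w : world) : nat -> SS := fun i => nth (se0 (i - size w.2)%N) w.2 i.

Definition holds (w : world) (p : fm) : Prop :=
  sat (numenv w) (setenv w)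
    (p (size w.1) (size w.2)).

Definition tden (t : tm) (w : world) (m : M) := forall v, extends w v ->
  eval (numenv v) (t (size v.1)) = m.

Definition sden (X : sv) (w : world) (s : SS) := forall v, extends w v ->
  setenv v (X (size v.2)) = s.

Definition pden (p : fm) (w : world) (P : Prop) := forall v, extends w v -> (holds v p <-> P).

Definition fden (p : frac) (w : world) (x : K) := exists a b c,
  [/\ tden (pos p) w a, tden (negp p) w b, tden (den p) w c &
      0 < c%:K /\ x = (a%:K - b%:K) / c%:K].

Lemma ext_refl w : extends w w.
Proof. by exists [::], [::]; case: w. Qed.

Lemma ext_trans u v w : extends u v -> extends v w -> extends u w.
Proof.
move=> [l [k ->]] [l' [k' ->]]; exists (l' ++ l), (k' ++ k).
by rewrite /= !catA.
Qed.

Lemma tden_ext t w v m : extends w v -> tden t w m -> tden t v m.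
Proof. by move=> wv H u vu; apply: H; apply: ext_trans vu. Qed.

Lemma sden_ext X w v s : extends w v -> sden X w s -> sden X v s.
Proof. by move=> wv H u vu; apply: H; apply: ext_trans vu. Qed.

Lemma fden_ext p w v x : extends w v -> fden p w x -> fden p v x.
Proof.
move=> wv [a [b [c [Ha Hb Hc Hx]]]]; exists a, b, c; split=> //; exact: tden_ext wv _.
Qed.

Lemma pden_iff p w P Q : (P <-> Q) -> pden p w P -> pden p w Q.
Proof. by move=> PQ H v wv; rewrite H. Qed.

Lemma pden_allN p w (P : M -> Prop) :
  (forall v x m, extends w v -> tden x v m -> pden (p x) v (P m)) ->
  pden (allN p) w (forall m, P m).
Proof.
move=> H v wv; rewrite /holds /allN /=.
have E m : sat (scons m (numenv v)) (setenv v)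
    (p (fun d' => Var (d' - (size v.1).+1)) (size v.1).+1 (size v.2)) <-> P m.
  pose u : world := (m :: v.1, v.2).
  have -> : scons m (numenv v) = (numenv u).
    by apply: funext => -[].
  apply: (H u _ m) (ext_refl u); first by apply: ext_trans wv _; exists [:: m], [::].
  move=> _ [l [k ->]] /=.
  by rewrite /numenv /setenv /= size_cat /= addnK nth_cat ltnn subnn.
by split=> H' m; apply/E.
Qed.

Lemma pden_allS p w (P : SS -> Prop) :
  (forall v x s, extends w v -> sden x v s -> pden (p x) v (P s)) ->
  pden (allS p) w (forall s, P s).
Proof.
move=> H v wv; rewrite /holds /allS /=.
have E s : sat (numenv v) (scons s (setenv v))
    (p (fun e' => e' - (size v.2).+1)%N (size v.1) (size v.2).+1) <-> P s.
  pose u : world := (v.1, s :: v.2).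
  have -> : scons s (setenv v) = (setenv u).
    by apply: funext => -[].
  apply: (H u _ s) (ext_refl u); first by apply: ext_trans wv _; exists [::], [:: s].
  move=> _ [l [k ->]] /=.
  by rewrite /numenv /setenv /= size_cat /= addnK nth_cat ltnn subnn.
by split=> H' m; apply/E.
Qed.

Lemma pden_not p w P : pden p w P -> pden (notF p) w (~ P).
Proof. by move=> H v wv; rewrite /holds /notF sat_Not -/(holds v p) H. Qed.

(** The right side needs a meaning only where the left side holds: the members of a coded sequence,
    for instance, make sense only once it is known to be one. *)
Lemma pden_imp p q w (P Q : Prop) : pden p w P -> (P -> pden q w Q) ->
  pden (impF p q) w (P -> Q).
Proof.
move=> Hp Hq v wv; rewrite /holds /impF /= -/(holds v p) -/(holds v q) Hp //.
by split=> H HP; apply/(Hq HP _ wv); apply: H.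
Qed.

Lemma pden_and p q w (P Q : Prop) : pden p w P -> (P -> pden q w Q) ->
  pden (andF p q) w (P /\ Q).
Proof.
move=> Hp Hq v wv; rewrite /holds /andF sat_And -/(holds v p) -/(holds v q) Hp //.
by split=> -[HP HQ]; split=> //; apply/(Hq HP _ wv).
Qed.

Lemma pden_or p q w (P Q : Prop) : pden p w P -> pden q w Q ->
  pden (orF p q) w (P \/ Q).
Proof.
by move=> Hp Hq v wv; rewrite /holds /orF sat_Or -/(holds v p) -/(holds v q) Hp // Hq.
Qed.

Lemma pden_exN p w (P : M -> Prop) :
  (forall v x m, extends w v -> tden x v m -> pden (p x) v (P m)) ->
  pden (exN p) w (exists m, P m).
Proof.
move=> H; apply: (@pden_iff _ _ (~ forall m, ~ P m)).
  by rewrite -existsNP; split=> -[m] H'; exists m; [apply: contrapT|].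
apply: (@pden_not (allN (fun x => notF (p x)))); apply: pden_allN => v x m wv xm.
by apply: pden_not; apply: H.
Qed.

Lemma pden_exS p w (P : SS -> Prop) :
  (forall v x m, extends w v -> sden x v m -> pden (p x) v (P m)) ->
  pden (exS p) w (exists m, P m).
Proof.
move=> H; apply: (@pden_iff _ _ (~ forall m, ~ P m)).
  by rewrite -existsNP; split=> -[m] H'; exists m; [apply: contrapT|].
apply: (@pden_not (allS (fun x => notF (p x)))); apply: pden_allS => v x m wv xm.
by apply: pden_not; apply: H.
Qed.

Lemma pden_eq s t w a b : tden s w a -> tden t w b -> pden (eqN s t) w (a = b).
Proof. by move=> Ha Hb v wv; rewrite /holds /eqN /= Ha // Hb. Qed.

Lemma pden_lt s t w a b : tden s w a -> tden t w b -> pden (ltN s t) w (a%:K < b%:K).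
Proof. by move=> Ha Hb v wv; rewrite /holds /ltN /= Ha // Hb // num_lt. Qed.

Lemma pden_le s t w a b : tden s w a -> tden t w b ->
  pden (orF (ltN s t) (eqN s t)) w (a%:K <= b%:K).
Proof.
move=> Ha Hb; apply: pden_iff (pden_or (pden_lt Ha Hb) (pden_eq Ha Hb)).
by rewrite -num_le num_lt.
Qed.

Lemma pden_mem t X w a s : tden t w a -> sden X w s -> pden (mem t X) w (memM a s).
Proof. by move=> Ha Hs v wv; rewrite /holds /mem /= Ha // Hs. Qed.

Lemma tden_zero w : tden zero w (zeroM A). Proof. by []. Qed.
Lemma tden_add s t w a b : tden s w a -> tden t w b -> tden (add s t) w (addM a b).
Proof. by move=> Ha Hb v wv /=; rewrite Ha // Hb. Qed.
Lemma tden_mul s t w a b : tden s w a -> tden t w b -> tden (mul s t) w (mulM a b).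
Proof. by move=> Ha Hb v wv /=; rewrite Ha // Hb. Qed.
Lemma tden_npair s t w a b : tden s w a -> tden t w b -> tden (npair s t) w (pr a b).
Proof. by move=> Ha Hb; do ![apply: tden_add => //|apply: tden_mul => //]. Qed.

Lemma fden_zero w : fden fzero w 0.
Proof.
exists (zeroM A), (zeroM A), (oneM A); split=> //.
by rewrite num1 subrr mul0r.
Qed.

Lemma fden_one w : fden fone w 1.
Proof.
exists (oneM A), (zeroM A), (oneM A); split=> //.
by rewrite num1 num0 subr0 divr1.
Qed.

Lemma fden_inv t w n : 0 < n%:K -> tden t w n -> fden (finv t) w n%:K^-1.
Proof.
move=> n0 Hn; exists (oneM A), (zeroM A), n; split=> //.
by rewrite num1 num0 subr0 mul1r.
Qed.

Lemma fden_opp p w x : fden p w x -> fden (fopp p) w (- x).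
Proof.
move=> [a [b [c [Ha Hb Hc [c0 ->]]]]]; exists b, a, c; split=> //; split=> //.
by rewrite -mulNr opprB.
Qed.

Lemma fden_add p q w x y : fden p w x -> fden q w y -> fden (fadd p q) w (x + y).
Proof.
move=> [a [b [c [Ha Hb Hc [c0 ->]]]]] [a' [b' [c' [Ha' Hb' Hc' [c0' ->]]]]].
exists (addM (mulM a c') (mulM a' c)), (addM (mulM b c') (mulM b' c)), (mulM c c').
split; try by do ![apply: tden_add => //|apply: tden_mul => //].
rewrite !(numD, numM); split; first exact: mulr_gt0.
by field; rewrite !gt_eqF.
Qed.

Lemma fden_sub p q w x y : fden p w x -> fden q w y -> fden (fsub p q) w (x - y).
Proof. by move=> Hp Hq; apply: fden_add => //; apply: fden_opp. Qed.

Lemma fden_triple s t u w a b c : tden s w a -> tden t w b -> tden u w c ->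
  fden (triple_frac s t u) w (trv a b c).
Proof.
move=> Ha Hb Hc; exists a, b, (addM c (oneM A)); split=> //; first exact: tden_add.
by rewrite numS succ_gt0.
Qed.

Lemma cross_le (a b c a' b' c' : K) : 0 < c -> 0 < c' ->
  (a * c' + b' * c <= a' * c + b * c') = ((a - b) / c <= (a' - b') / c').
Proof.
move=> c0 c0'; rewrite ler_pdivrMr // mulrAC ler_pdivlMr //.
by rewrite -subr_ge0 -[RHS]subr_ge0; congr (0 <= _); ring.
Qed.

Section Comparison.
Variables (p q : frac) (w : world) (x y : K).
Hypotheses (Hp : fden p w x) (Hq : fden q w y).

Lemma pden_fle : pden (fle p q) w (x <= y).
Proof.
move: Hp Hq => [a [b [c [Ha Hb Hc [c0 ->]]]]] [a' [b' [c' [Ha' Hb' Hc' [c0' ->]]]]].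
apply: pden_iff; last by apply: pden_le; do ![apply: tden_add|apply: tden_mul|eassumption].
by rewrite !(numD, numM) cross_le.
Qed.

Lemma pden_flt : pden (flt p q) w (x < y).
Proof.
move: Hp Hq => [a [b [c [Ha Hb Hc [c0 ->]]]]] [a' [b' [c' [Ha' Hb' Hc' [c0' ->]]]]].
apply: pden_iff; last by apply: pden_lt; do ![apply: tden_add|apply: tden_mul|eassumption].
by rewrite !(numD, numM) !ltNge cross_le.
Qed.

Lemma pden_feq : pden (feq p q) w (x = y).
Proof.
move: Hp Hq => [a [b [c [Ha Hb Hc [c0 ->]]]]] [a' [b' [c' [Ha' Hb' Hc' [c0' ->]]]]].
apply: pden_iff; last by apply: pden_eq; do ![apply: tden_add|apply: tden_mul|eassumption].
have E1 := cross_le a%:K b%:K a'%:K b'%:K c0 c0'.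
have E2 := cross_le a'%:K b'%:K a%:K b%:K c0' c0.
split=> [/(congr1 (@num A))|E]; rewrite ?(numD, numM).
  by move=> E; apply/le_anti; rewrite -E1 -E2 E lexx.
by apply: num_inj; apply/le_anti; rewrite !(numD, numM) E1 E2 E lexx.
Qed.

End Comparison.

Lemma pden_fabs p w x P B : fden p w x ->
  (forall p', fden p' w `|x| -> pden (P p') w B) -> pden (fabs p P) w B.
Proof.
move=> Hp HP; apply: (@pden_iff _ _ ((0 <= x /\ B) \/ (x < 0 /\ B))).
  by split=> [[[]|[]]//|HB]; have [H|H] := lerP 0 x; [left|right].
apply: pden_or; apply: pden_and.
- by apply: pden_fle => //; apply: fden_zero.
- by move=> x0; apply: HP; rewrite ger0_norm.
- by apply: pden_flt => //; apply: fden_zero.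
- by move=> x0; apply: HP; rewrite ltr0_norm //; apply: fden_opp.
Qed.

Lemma tden_triple s t u w a b c : tden s w a -> tden t w b -> tden u w c ->
  tden (triple_code s t u) w (tri a b c).
Proof. by move=> Ha Hb Hc; do ![apply: tden_npair => //]. Qed.

Lemma pden_is_rat q w m : tden q w m -> pden (is_rat q) w (israt m).
Proof.
move=> Hq; apply: pden_exN => v1 x1 a e1 H1; apply: pden_exN => v2 x2 b e2 H2.
apply: pden_exN => v3 x3 c e3 H3.
have Hq3 := tden_ext (ext_trans e1 (ext_trans e2 e3)) Hq.
have {}H1 := tden_ext (ext_trans e2 e3) H1; have {}H2 := tden_ext e3 H2.
apply: pden_and => [|_]; first by apply: pden_eq => //; apply: tden_triple.
apply: pden_allN => v4 x4 a' e4 H4; apply: pden_allN => v5 x5 b' e5 H5.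
apply: pden_allN => v6 x6 c' e6 H6.
have e36 := ext_trans e4 (ext_trans e5 e6).
have {}H4 := tden_ext (ext_trans e5 e6) H4; have {}H5 := tden_ext e6 H5.
apply: pden_imp => [|_].
  by apply: pden_feq; apply: fden_triple => //; apply: tden_ext e36 _.
by apply: pden_le; [apply: tden_ext e36 _|apply: tden_triple].
Qed.

Lemma pden_with_rat q w m P B : tden q w m ->
  (israt m -> forall v p, extends w v -> fden p v (ratv m) -> pden (P p) v B) ->
  pden (with_rat q P) w (israt m /\ B).
Proof.
move=> Hq HP; apply: pden_and; first exact: pden_is_rat.
move=> Hm; apply: (@pden_iff _ _ (exists a b c, m = tri a b c /\ B)).
  split=> [[a [b [c [_ //]]]]|HB].
  by have [a [b [c [E _]]]] := Hm; exists a, b, c.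
apply: pden_exN => v1 x1 a e1 H1; apply: pden_exN => v2 x2 b e2 H2.
apply: pden_exN => v3 x3 c e3 H3.
have e := ext_trans e1 (ext_trans e2 e3).
have {}H1 := tden_ext (ext_trans e2 e3) H1; have {}H2 := tden_ext e3 H2.
apply: pden_and => [|E]; first by apply: pden_eq; [apply: tden_ext e _|apply: tden_triple].
by apply: HP => //; rewrite E ratv_tri; apply: fden_triple.
Qed.

Lemma pden_all_rat P w (B : M -> Prop) :
  (forall v q p m, extends w v -> tden q v m -> israt m -> fden p v (ratv m) ->
     pden (P q p) v (B m)) ->
  pden (all_rat P) w (forall m, israt m -> B m).
Proof.
move=> H; apply: (@pden_iff _ _ (forall m, israt m -> israt m /\ B m)).
  by split=> H' m Hm; have := H' m Hm => // -[].
apply: pden_allN => v x m wv xm; apply: pden_imp; first exact: pden_is_rat.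
move=> Hm; apply: pden_with_rat => // _ u p vu pm.
by apply: H => //; [apply: ext_trans vu|apply: tden_ext xm].
Qed.

Lemma pden_ex_rat P w (B : M -> Prop) :
  (forall v q p m, extends w v -> tden q v m -> israt m -> fden p v (ratv m) ->
     pden (P q p) v (B m)) ->
  pden (ex_rat P) w (exists m, israt m /\ B m).
Proof.
move=> H; apply: pden_exN => v x m wv xm.
apply: pden_with_rat => // Hm u p vu pm.
by apply: H => //; [apply: ext_trans vu|apply: tden_ext xm].
Qed.

(** Every field element is the value of some code, so quantifying over codes of rationals amounts to
    quantifying over the field. *)
Lemma pden_all_pos_rat P w (B : K -> Prop) :
  (forall v p x, extends w v -> 0 < x -> fden p v x -> pden (P p) v (B x)) ->
  pden (all_pos_rat P) w (forall x, 0 < x -> B x).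
Proof.
move=> H; apply: (@pden_iff _ _ (forall m, israt m -> 0 < ratv m -> B (ratv m))).
  split=> [H' x|H' m _]; last exact: H'.
  by have [q [Hq <-]] := rat_exists x; apply: H'.
apply: pden_all_rat => v q p m wv qm Hm pm.
apply: pden_imp; first by apply: pden_flt => //; apply: fden_zero.
by move=> m0; apply: H.
Qed.

(** Members of a sequence are accessible only through assertions about them. The sequence denotes
    [s] if asserting [P] of its member number [m] means what [P] means for every fraction denoting
    [s m]. *)
Definition sqden (x : rseq) (w : world) (s : M -> K) := forall v n m P B,
  extends w v -> tden n v m ->
  (forall u p, extends v u -> fden p u (s m) -> pden (P p) u B) -> pden (x n P) v B.

Lemma sqden_const p w x : fden p w x -> sqden (sconst p) w (fun _ => x).
Proof.
move=> Hp v n m P B wv nm; apply; [exact: ext_refl|exact: fden_ext Hp].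
Qed.

Lemma sqden_sub x y w s t : sqden x w s -> sqden y w t ->
  sqden (ssub x y) w (fun n => s n - t n).
Proof.
move=> Hx Hy v n m P B wv nm HP; apply: (Hx v n m) => // u p vu ps.
apply: (Hy u n m) => //; [exact: ext_trans vu|exact: tden_ext nm|].
move=> u' q uu' qt; apply: HP; first exact: ext_trans uu'.
by apply: fden_sub => //; apply: fden_ext ps.
Qed.

Lemma sqden_abs x w s : sqden x w s -> sqden (sabs x) w (fun n => `|s n|).
Proof.
move=> Hx v n m P B wv nm HP; apply: (Hx v n m) => // u p vu ps.
by apply: (pden_fabs ps) => p' Hp'; apply: HP.
Qed.

Definition ratseq (s : SS) :=
  (forall k, memM k s -> exists n q, k = pr n q /\ israt q) /\
  (forall n, exists q, memM (pr n q) s /\ forall q', memM (pr n q') s -> q' = q).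

Lemma pden_is_rat_seq X w s : sden X w s -> pden (is_rat_seq X) w (ratseq s).
Proof.
move=> HX; apply: pden_and => [|_].
  apply: pden_allN => v1 k k' e1 H1; apply: pden_imp.
    by apply: pden_mem => //; apply: sden_ext HX.
  move=> _; apply: pden_exN => v2 n n' e2 H2; apply: pden_exN => v3 q q' e3 H3.
  have {}H2 := tden_ext e3 H2; apply: pden_and => [|_]; last exact: pden_is_rat.
  by apply: pden_eq; [apply: tden_ext (ext_trans e2 e3) _|apply: tden_npair].
apply: pden_allN => v1 n n' e1 H1; apply: pden_exN => v2 q q' e2 H2.
have {}H1 := tden_ext e2 H1; have e12 := ext_trans e1 e2.
apply: pden_and => [|_].
  by apply: pden_mem; [apply: tden_npair|apply: sden_ext HX].
apply: pden_allN => v3 r r' e3 H3.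
apply: pden_imp => [|_].
  apply: pden_mem; last by apply: sden_ext (ext_trans e12 e3) HX.
  by apply: tden_npair => //; apply: tden_ext e3 _.
by apply: pden_eq => //; apply: tden_ext e3 _.
Qed.

(* The code of the [n]-th member of the sequence [s]. *)
Definition seqc (s : SS) (n : M) : M :=
  if pselect (exists q, memM (pr n q) s) is left H then projT1 (cid H) else zeroM A.
Definition seqv (s : SS) (n : M) : K := ratv (seqc s n).

Lemma seqcP s : ratseq s -> forall n,
  israt (seqc s n) /\ forall q, memM (pr n q) s <-> q = seqc s n.
Proof.
move=> [Hs1 Hs2] n; have [q [Hq Hu]] := Hs2 n.
have Hc : memM (pr n (seqc s n)) s.
  by rewrite /seqc; case: pselect => [H|[]]; [case: cid|exists q].
split; first by have [n' [q' [/pr_inj [_ ->]]]] := Hs1 _ Hc.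
by move=> q'; split=> [/Hu ->|->//]; rewrite (Hu _ Hc).
Qed.

Lemma sqden_val X w s : sden X w s -> ratseq s -> sqden (sval X) w (seqv s).
Proof.
move=> HX Hs v n m P B wv nm HP; have [Hc Hu] := seqcP Hs m.
apply: (@pden_iff _ _ (exists q, memM (pr m q) s /\ israt q /\ B)).
  split=> [[q [_ [_ //]]]|HB]; exists (seqc s m).
  by split; [apply/Hu|].
apply: pden_exN => u q q' vu qq'; apply: pden_and.
  apply: pden_mem; last exact: sden_ext (ext_trans wv vu) HX.
  by apply: tden_npair => //; apply: tden_ext nm.
move=> /Hu E; apply: pden_with_rat => // _ u' p uu' pq.
by apply: HP; [apply: ext_trans uu'|rewrite /seqv -E].
Qed.

Definition cauchyK (s : M -> K) := forall x, 0 < x -> exists N : M, forall m n,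
  N%:K <= m%:K /\ N%:K <= n%:K -> `|s m - s n| < x.

Lemma pden_is_cauchy x w s : sqden x w s -> pden (is_cauchy x) w (cauchyK s).
Proof.
move=> Hx; apply: pden_all_pos_rat => v1 p e e1 e0 pe.
apply: pden_exN => v2 N N' e2 HN.
apply: pden_allN => v3 m m' e3 Hm; apply: pden_allN => v4 n n' e4 Hn.
have {}HN := tden_ext (ext_trans e3 e4) HN; have {}Hm := tden_ext e4 Hm.
have e14 := ext_trans e2 (ext_trans e3 e4).
apply: pden_imp; first by apply: pden_and => [|_]; apply: pden_le.
move=> _; apply: (Hx _ _ m') => //; first exact: ext_trans e1 e14.
move=> v5 q e5 Hq; apply: (Hx _ _ n'); first exact: ext_trans e1 (ext_trans e14 e5).
  exact: tden_ext Hn.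
move=> v6 r e6 Hr; have {}Hq := fden_ext e6 Hq.
apply: (pden_fabs (fden_sub Hq Hr)) => t Ht.
by apply: pden_flt => //; apply: fden_ext pe; apply: ext_trans e14 (ext_trans e5 e6).
Qed.

Definition rleK (s t : M -> K) := forall x, 0 < x -> exists N : M, forall n : M,
  N%:K <= n%:K -> s n <= t n + x.
Definition rltK s t := rleK s t /\ ~ (rleK s t /\ rleK t s).

Lemma pden_rle x y w s t : sqden x w s -> sqden y w t -> pden (rle x y) w (rleK s t).
Proof.
move=> Hx Hy; apply: pden_all_pos_rat => v1 p e e1 e0 pe.
apply: pden_exN => v2 N N' e2 HN; apply: pden_allN => v3 n n' e3 Hn.
have {}HN := tden_ext e3 HN; have e13 := ext_trans e2 e3; have ew3 := ext_trans e1 e13.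
apply: pden_imp; first exact: pden_le.
move=> _; apply: (Hx _ _ n') => // v4 q e4 Hq.
apply: (Hy _ _ n'); [exact: ext_trans ew3 e4|exact: tden_ext Hn|].
move=> v5 r e5 Hr; apply: pden_fle; first exact: fden_ext Hq.
by apply: fden_add => //; apply: fden_ext pe; apply: ext_trans e13 (ext_trans e4 e5).
Qed.

Lemma pden_req x y w s t : sqden x w s -> sqden y w t ->
  pden (req x y) w (rleK s t /\ rleK t s).
Proof. by move=> Hx Hy; apply: pden_and => [|_]; apply: pden_rle. Qed.

Lemma pden_rlt x y w s t : sqden x w s -> sqden y w t -> pden (rlt x y) w (rltK s t).
Proof.
move=> Hx Hy; apply: pden_and => [|_]; first exact: pden_rle.
by apply: pden_not; apply: pden_req.
Qed.

Definition ballK (d : K) (y z : M -> K) := rltK (fun n => `|y n - z n|) (fun _ => d).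

Lemma pden_ball p y z w d s t : fden p w d -> sqden y w s -> sqden z w t ->
  pden (in_ball (sconst p) y z) w (ballK d s t).
Proof.
move=> Hp Hy Hz; apply: pden_rlt; last exact: sqden_const.
by apply: sqden_abs; apply: sqden_sub.
Qed.

Definition inopen (s : M -> K) (U : SS) := exists N a, israt a /\ exists r, israt r /\
  (0 < ratv r /\ (ballK (ratv r) (fun _ => ratv a) s /\
   forall n : M, N%:K <= n%:K -> memM (pr (pr n a) r) U)).

Lemma pden_in_open X U w s u : sden X w s -> ratseq s -> sden U w u ->
  pden (in_open X U) w (inopen (seqv s) u).
Proof.
move=> HX Hs HU; apply: pden_exN => v1 N N' e1 HN.
apply: pden_ex_rat => v2 a pa a' e2 Ha Ra Hpa.
apply: pden_ex_rat => v3 r pr' r' e3 Hr Rr Hpr.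
have e13 := ext_trans e1 (ext_trans e2 e3).
apply: pden_and => [|_]; first by apply: pden_flt => //; apply: fden_zero.
apply: pden_and => [|_].
  apply: pden_ball => //; last by apply: sqden_val => //; apply: sden_ext HX.
  by apply: sqden_const; apply: fden_ext Hpa.
apply: pden_allN => v4 n n' e4 Hn; apply: pden_imp.
  by apply: pden_le => //; apply: tden_ext (ext_trans e2 (ext_trans e3 e4)) HN.
move=> _; apply: pden_mem; last exact: sden_ext (ext_trans e13 e4) HU.
apply: tden_npair; last exact: tden_ext Hr.
by apply: tden_npair => //; apply: tden_ext (ext_trans e3 e4) Ha.
Qed.

Definition funcode (F : SS) :=
  (forall k, memM k F -> exists q i r, k = pr (pr q i) r /\ israt q /\ israt r) /\
  (forall q i, israt q -> exists r, memM (pr (pr q i) r) F /\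
     forall r', memM (pr (pr q i) r') F -> r' = r).

Lemma pden_is_fun_code X w F : sden X w F -> pden (is_fun_code X) w (funcode F).
Proof.
move=> HX; apply: pden_and => [|_].
  apply: pden_allN => v1 k k' e1 H1; apply: pden_imp.
    by apply: pden_mem => //; apply: sden_ext HX.
  move=> _; apply: pden_exN => v2 q q' e2 H2; apply: pden_exN => v3 i i' e3 H3.
  apply: pden_exN => v4 r r' e4 H4.
  have {}H2 := tden_ext (ext_trans e3 e4) H2; have {}H3 := tden_ext e4 H3.
  apply: pden_and => [|_].
    apply: pden_eq; first exact: tden_ext (ext_trans e2 (ext_trans e3 e4)) H1.
    by do ![apply: tden_npair => //].
  by apply: pden_and => [|_]; apply: pden_is_rat.
apply: pden_allN => v1 q q' e1 H1; apply: pden_allN => v2 i i' e2 H2.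
have {}H1 := tden_ext e2 H1; apply: pden_imp => [|_]; first exact: pden_is_rat.
apply: pden_exN => v3 r r' e3 H3.
have {}H1 := tden_ext e3 H1; have {}H2 := tden_ext e3 H2.
have e13 := ext_trans e1 (ext_trans e2 e3).
apply: pden_and => [|_].
  by apply: pden_mem; [do ![apply: tden_npair => //]|apply: sden_ext HX].
apply: pden_allN => v4 t t' e4 H4; apply: pden_imp => [|_].
  apply: pden_mem; last exact: sden_ext (ext_trans e13 e4) HX.
  by do ![apply: tden_npair => //]; apply: tden_ext e4 _.
by apply: pden_eq => //; apply: tden_ext e4 _.
Qed.

Definition fnc (F : SS) (q i : M) : M := seqc F (pr q i).
Definition fnv (F : SS) (q i : M) : K := ratv (fnc F q i).

Lemma fncP F : funcode F -> forall q i, israt q ->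
  israt (fnc F q i) /\ forall r, memM (pr (pr q i) r) F <-> r = fnc F q i.
Proof.
move=> [HF1 HF2] q i Rq; have [r [Hr Hu]] := HF2 q i Rq.
have Hc : memM (pr (pr q i) (fnc F q i)) F.
  by rewrite /fnc /seqc; case: pselect => [H|[]]; [case: cid|exists r].
split; first by have [q' [i' [r' [/pr_inj [_ ->] [_]]]]] := HF1 _ Hc.
by move=> r'; split=> [/Hu ->|->//]; rewrite (Hu _ Hc).
Qed.

Lemma pden_fval X w F q i m n P B : sden X w F -> funcode F -> tden q w m -> israt m ->
  tden i w n ->
  (forall v p, extends w v -> fden p v (fnv F m n) -> pden (P p) v B) ->
  pden (fval X q i P) w B.
Proof.
move=> HX HF Hq Rm Hi HP; have [Hc Hu] := fncP HF n Rm.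
apply: (@pden_iff _ _ (exists r, memM (pr (pr m n) r) F /\ israt r /\ B)).
  split=> [[r [_ [_ //]]]|HB]; exists (fnc F m n).
  by split; [apply/Hu|].
apply: pden_exN => u r r' wu Hr; apply: pden_and.
  apply: pden_mem; last exact: sden_ext HX.
  by do ![apply: tden_npair => //]; apply: tden_ext wu _.
move=> /Hu E; apply: pden_with_rat => // _ u' p uu' pq.
by apply: HP; [apply: ext_trans uu'|rewrite /fnv -E].
Qed.

Definition indom (F : SS) (s : M -> K) := forall x, 0 < x -> exists N : M, 0 < N%:K /\
  forall q, israt q -> forall r, israt r ->
    ballK N%:K^-1 s (fun _ => ratv q) /\ ballK N%:K^-1 s (fun _ => ratv r) ->
    forall i j : M, N%:K <= i%:K /\ N%:K <= j%:K -> `|fnv F q i - fnv F r j| < x.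

Lemma pden_in_dom Y X w F s : sden Y w F -> funcode F -> sden X w s -> ratseq s ->
  pden (in_dom Y X) w (indom F (seqv s)).
Proof.
move=> HY HF HX Hs; apply: pden_all_pos_rat => v1 p e e1 e0 pe.
apply: pden_exN => v2 N N' e2 HN; apply: pden_and.
  by rewrite -(num0 A); apply: pden_lt => //; apply: tden_zero.
move=> N0; apply: pden_all_rat => v3 q pq q' e3 Hq Rq Hpq.
apply: pden_all_rat => v4 r pr' r' e4 Hr Rr Hpr.
have e34 := e4; have e24 := ext_trans e3 e4; have e14 := ext_trans e2 e24.
have ew4 := ext_trans e1 e14.
have {}HN := tden_ext e24 HN; have {}Hq := tden_ext e4 Hq; have {}Hpq := fden_ext e4 Hpq.
have {}HX := sden_ext ew4 HX; have {}HY := sden_ext ew4 HY; have {}pe := fden_ext e14 pe.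
apply: pden_imp.
  by apply: pden_and => [|_]; apply: pden_ball;
    [apply: fden_inv|apply: sqden_val|apply: sqden_const|
     apply: fden_inv|apply: sqden_val|apply: sqden_const].
move=> _; apply: pden_allN => v5 i i' e5 Hi; apply: pden_allN => v6 j j' e6 Hj.
have e46 := ext_trans e5 e6; have {}Hi := tden_ext e6 Hi.
apply: pden_imp; first by apply: pden_and => [|_]; apply: pden_le => //; apply: tden_ext HN.
move=> _; apply: (pden_fval (sden_ext e46 HY) HF (tden_ext e46 Hq) Rq Hi) => v7 u e7 Hu.
have e47 := ext_trans e46 e7.
apply: (pden_fval (sden_ext e47 HY) HF (tden_ext e47 Hr) Rr (tden_ext e7 Hj)) => v8 t e8 Ht.
apply: (pden_fabs (fden_sub (fden_ext e8 Hu) Ht)) => z Hz.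
by apply: pden_flt => //; apply: fden_ext (ext_trans e47 e8) pe.
Qed.

Definition appK (F s : SS) (i : M) : K := fnv F (seqc s i) i.

Lemma sqden_app Y X w F s : sden Y w F -> funcode F -> sden X w s -> ratseq s ->
  sqden (sapp Y X) w (appK F s).
Proof.
move=> HY HF HX Hs v n m P B wv nm HP; have [Hc Hu] := seqcP Hs m.
apply: (@pden_iff _ _ (exists q, memM (pr m q) s /\ B)).
  by split=> [[q []//]|HB]; exists (seqc s m); split=> //; apply/Hu.
apply: pden_exN => u q q' vu qq'; apply: pden_and.
  apply: pden_mem; last exact: sden_ext (ext_trans wv vu) HX.
  by apply: tden_npair => //; apply: tden_ext nm.
move=> /Hu E; rewrite E in qq'.
apply: (pden_fval (sden_ext (ext_trans wv vu) HY) HF qq' Hc (tden_ext vu nm)) => u' p uu' Hp.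
by apply: HP => //; apply: ext_trans uu'.
Qed.

Definition unitK (s : M -> K) := rleK (fun _ => - 1) s /\ rleK s (fun _ => 1).

Lemma pden_unit x w s : sqden x w s -> pden (in_unit_interval x) w (unitK s).
Proof.
move=> Hx; apply: pden_and => [|_]; apply: pden_rle => //; apply: sqden_const.
  by apply: fden_opp; apply: fden_one.
exact: fden_one.
Qed.

Definition realM (s : SS) := ratseq s /\ cauchyK (seqv s).

Lemma pden_is_real X w s : sden X w s -> pden (is_real X) w (realM s).
Proof.
move=> HX; apply: pden_and => [|Hs]; first exact: pden_is_rat_seq.
by apply: pden_is_cauchy; apply: sqden_val.
Qed.

Definition contK (F : SS) (D : SS -> Prop) := funcode F /\
  forall s, realM s /\ D s -> indom F (seqv s) /\ unitK (appK F s).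

Lemma pden_continuous Y w F (P : sv -> fm) (D : SS -> Prop) : sden Y w F ->
  (forall v X s, extends w v -> sden X v s -> realM s -> pden (P X) v (D s)) ->
  pden (continuous_into_unit Y P) w (contK F D).
Proof.
move=> HY HP; apply: pden_and => [|HF]; first exact: pden_is_fun_code.
apply: pden_allS => v X s wv HX; have {}HY := sden_ext wv HY.
apply: pden_imp; first by apply: pden_and => [|Rs]; [apply: pden_is_real|apply: HP].
move=> [[Hs _] _]; apply: pden_and => [|_]; first exact: pden_in_dom.
by apply: pden_unit; apply: sqden_app.
Qed.

Definition tietzeK := forall U F : SS,
  contK F (fun s => ~ inopen (seqv s) U) ->
  exists H : SS, contK H realM /\
    forall s, realM s -> ~ inopen (seqv s) U ->
      rleK (appK F s) (appK H s) /\ rleK (appK H s) (appK F s).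

Lemma pden_is_open_code X w U : sden X w U -> exists P, pden (is_open_code X) w P.
Proof.
move=> HX; exists (forall k, memM k U -> exists n a, israt a /\ exists r, israt r /\
  (0 < ratv r /\ k = pr (pr n a) r)).
apply: pden_allN => v1 k k' e1 Hk; apply: pden_imp => [|_].
  by apply: pden_mem => //; apply: sden_ext HX.
apply: pden_exN => v2 n n' e2 Hn.
apply: pden_ex_rat => v3 a pa a' e3 Ha Ra Hpa.
apply: pden_ex_rat => v4 r pr' r' e4 Hr Rr Hpr.
apply: pden_and => [|_]; first by apply: pden_flt => //; apply: fden_zero.
apply: pden_eq; first exact: tden_ext (ext_trans e2 (ext_trans e3 e4)) Hk.
apply: tden_npair => //; apply: tden_npair; first exact: tden_ext (ext_trans e3 e4) Hn.
exact: tden_ext e4 Ha.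
Qed.

Lemma sat_tietze : tietzeK -> sat ne0 se0 tietze.
Proof.
move=> HT; have -> : ne0 = numenv ([::], [::]).
  by apply: funext => i; rewrite /numenv nth_nil subn0.
have -> : se0 = setenv ([::], [::]).
  by apply: funext => i; rewrite /setenv nth_nil subn0.
pose OK (p : fm) w := forall v, extends w v -> holds v p.
have OKall p w : (forall v x s, extends w v -> sden x v s -> OK (p x) v) -> OK (allS p) w.
  (* Truth of all instances is the same as expressing [True], so [pden_allS] can be reused. *)
  move=> H v wv; suff /(_ v wv) [_] : pden (allS p) w (forall s : SS, True) by apply.
  by apply: pden_allS => u x s wu xs u' uu'; split=> // _; apply: (H u x s).
pose ext U F := exS (fun H => andF (continuous_into_unit H all_reals)
    (allS (fun X => impF (andF (is_real X) (closed_set U X)) (req (sapp F X) (sapp H X))))).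
suff H : OK (allS (fun U => impF (is_open_code U)
    (allS (fun F => impF (continuous_into_unit F (closed_set U)) (ext U F))))) ([::], [::]).
  exact: (H _ (ext_refl _)).
apply: (OKall _ _ _) => v1 U u e1 HU.
have HUF : OK (allS (fun F => impF (continuous_into_unit F (closed_set U)) (ext U F))) v1; last first.
  move=> v2 e2; have [P HP] := pden_is_open_code HU.
  rewrite /holds /impF /= => _; exact: HUF.
apply: (OKall _ _ _) => v2 F f e2 HF v3 e3; have {}HU := sden_ext (ext_trans e2 e3) HU.
have {}HF := sden_ext e3 HF.
have closedP v X s : extends v3 v -> sden X v s -> realM s ->
    pden (closed_set U X) v (~ inopen (seqv s) u).
  move=> e HX [Hs _]; apply: pden_not; apply: pden_in_open => //; exact: sden_ext e HU.
have HC : pden (continuous_into_unit F (closed_set U)) v3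
    (contK f (fun s => ~ inopen (seqv s) u)) by apply: pden_continuous.
rewrite /holds /impF /= -/(holds v3 _) => /(HC _ (ext_refl _)) Hf.
have {}HT := HT u f Hf.
suff : pden (ext U F) v3 (exists H : SS, contK H realM /\
    forall s, realM s /\ ~ inopen (seqv s) u ->
      rleK (appK f s) (appK H s) /\ rleK (appK H s) (appK f s)).
  move=> /(_ _ (ext_refl _)) [_]; apply; have [H [H1 H2]] := HT.
  by exists H; split=> // s [] ; apply: H2.
apply: pden_exS => v4 H h e4 HH; apply: pden_and => [|[Hh _]].
  by apply: pden_continuous => // v X s _ HX _; apply: pden_is_real.
apply: pden_allS => v5 X s e5 HX; have e35 := ext_trans e4 e5.
apply: pden_imp => [|[[Hs _] _]].
  by apply: pden_and => [|Hs]; [apply: pden_is_real|apply: closedP].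
apply: pden_req; apply: sqden_app => //; [exact: sden_ext e35 HF|by case: Hf|exact: sden_ext e5 HH].
Qed.

End Denotation.

Theorem tietze_from_fields :
  (forall A : arith_model, tietzeK A) -> provable RCA0_ISigma2 tietze.
Proof.
move=> H; apply: completeness; first exact: axioms_subst.
move=> S HS e g; have [K [f [f01 fD fM flt_ ffrac]]] := model_field HS (g O).
exact: (@sat_tietze (ArithModel HS (g O) f01 fD fM flt_ ffrac)).
Qed.
(** * Definability with decoding *)

Section Decoding.
Local Open Scope ring_scope.
Variable A : arith_model.
Notation M := (dom A).
Notation K := (afld A).
Notation env := (nat -> M).
Local Notation "n %:K" := (@num A n) (at level 2, left associativity, format "n %:K").

Definition renaming_closed V (base : (env -> V) -> Prop) := forall r f, base r ->
  base (fun e => r (fun i => e (f i))).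

(* Decoding is not polynomial: the definability of a function [t] is expressed
   by eliminating [t] from definable predicates, which a bounded search does. *)
Definition vdef V (base : (env -> V) -> Prop) (t : env -> V) :=
  forall f (Q : V -> env -> Prop),
    (forall r g, base r -> ddef (fun e => Q (r e) (fun i => e (g i)))) ->
    ddef (fun e => Q (t (fun i => e (f i))) e).

Lemma vdef_base V (base : (env -> V) -> Prop) t : renaming_closed base -> base t -> vdef base t.
Proof. by move=> Hb Ht f Q H; apply: (H _ id); apply: Hb. Qed.

Lemma vdef_comp1 V W (b : (env -> V) -> Prop) (b' : (env -> W) -> Prop) (op : V -> W) t :
  (forall r, b r -> vdef b' (fun e => op (r e))) -> vdef b t -> vdef b' (fun e => op (t e)).
Proof.
move=> Hop Ht f Q H; apply: (Ht f (fun x e => Q (op x) e)) => r g br.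
apply: (Hop _ br id (fun y e => Q y (fun i => e (g i)))) => r' g' br'.
exact: (H _ (fun i => g' (g i))).
Qed.

(** Eliminating [s] leaves a basic function [r]. Eliminating [t] afterwards changes the environment
    once more, and [r] survives this because [b1] is closed under renaming. *)
Lemma vdef_comp2 V1 V2 W (b1 : (env -> V1) -> Prop) (b2 : (env -> V2) -> Prop)
    (b' : (env -> W) -> Prop) (op : V1 -> V2 -> W) s t : renaming_closed b1 ->
  (forall r r', b1 r -> b2 r' -> vdef b' (fun e => op (r e) (r' e))) ->
  vdef b1 s -> vdef b2 t -> vdef b' (fun e => op (s e) (t e)).
Proof.
move=> Hb Hop Hs Ht f Q H.
apply: (Hs f (fun x e => Q (op x (t (fun i => e (f i)))) e)) => r g br.
apply: (Ht (fun i => g (f i)) (fun y e => Q (op (r e) y) (fun i => e (g i)))) => r' g' br'.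
apply: (Hop (fun e => r (fun i => e (g' i))) r' (Hb _ _ br) br' id
  (fun y e => Q y (fun i => e (g' (g i))))) => r'' g'' br''.
exact: (H _ (fun i => g'' (g' (g i)))).
Qed.

Lemma ddef_comp1 V (b : (env -> V) -> Prop) (R : V -> Prop) t :
  (forall r, b r -> ddef (fun e => R (r e))) -> vdef b t -> ddef (fun e => R (t e)).
Proof. by move=> HR Ht; apply: (Ht id (fun x _ => R x)) => r g; apply: HR. Qed.

Lemma ddef_comp2 V1 V2 (b1 : (env -> V1) -> Prop) (b2 : (env -> V2) -> Prop)
    (R : V1 -> V2 -> Prop) s t : renaming_closed b1 ->
  (forall r r', b1 r -> b2 r' -> ddef (fun e => R (r e) (r' e))) ->
  vdef b1 s -> vdef b2 t -> ddef (fun e => R (s e) (t e)).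
Proof.
move=> Hb HR Hs Ht; apply: (Hs id (fun x e => R x (t e))) => r g br.
apply: (Ht g (fun y e => R (r e) y)) => r' g' br'.
by apply: HR => //; apply: Hb.
Qed.

Lemma tdef_rename : renaming_closed (@tdef A).
Proof.
move=> t f [u [v Ht]]; exists u, (fun i => match v i with inl j => inl (f j) | inr m => inr m end).
move=> e; rewrite -Ht; congr (eval _ _); apply: funext => i.
by rewrite /fill; case: (v i).
Qed.

Lemma rdef_rename : renaming_closed (@rdef A).
Proof.
move=> t f [p [n [d [dp dn dd Ht]]]].
exists (fun e => p (fun i => e (f i))), (fun e => n (fun i => e (f i))),
  (fun e => d (fun i => e (f i))).
by split=> //; apply: tdef_rename.
Qed.

Definition mdef := vdef (@tdef A).
Definition kdef := vdef (@rdef A).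

Lemma mdef_tdef t : tdef t -> mdef t.
Proof. exact: vdef_base tdef_rename. Qed.
Lemma kdef_rdef t : rdef t -> kdef t.
Proof. exact: vdef_base rdef_rename. Qed.

Lemma mdef_var i : mdef (fun e => e i).
Proof. by apply: mdef_tdef; apply: tdef_var. Qed.
Lemma mdef_const m : mdef (fun _ => m).
Proof. by apply: mdef_tdef; apply: tdef_const. Qed.
Lemma mdef_add s t : mdef s -> mdef t -> mdef (fun e => addM (s e) (t e)).
Proof.
apply: vdef_comp2 tdef_rename _ => r r' br br'; apply: mdef_tdef; exact: tdef_add.
Qed.
Lemma mdef_pr s t : mdef s -> mdef t -> mdef (fun e => pr (s e) (t e)).
Proof.
apply: vdef_comp2 tdef_rename _ => r r' br br'; apply: mdef_tdef; exact: tdef_pr.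
Qed.

Lemma ddef_meq s t : mdef s -> mdef t -> ddef (fun e => s e = t e).
Proof. apply: ddef_comp2 tdef_rename _ => r r'; apply: ddef_eq; exact: aset. Qed.
Lemma ddef_mlt s t : mdef s -> mdef t -> ddef (fun e => ltM (s e) (t e)).
Proof. apply: ddef_comp2 tdef_rename _ => r r'; apply: ddef_lt; exact: aset. Qed.
Lemma ddef_mmem X t : mdef t -> ddef (fun e => memM (t e) X).
Proof. by apply: (@ddef_comp1 _ (@tdef A) (fun m => memM m X)) => r; apply: ddef_mem. Qed.

Lemma ddef_mball Q t : ddef (fun e => Q (e 0%N) (fun i => e i.+1)) -> mdef t ->
  ddef (fun e => forall x : M, ltM x (t e) -> Q x e).
Proof.
move=> HQ Ht; apply: (Ht id (fun y e => forall x : M, ltM x y -> Q x e)) => r g br.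
apply: (@ddef_ball A (fun x e => Q x (fun i => e (g i))) r) => //.
exact: (ddef_rename (fun i => if i is j.+1 then (g j).+1 else 0%N) HQ).
Qed.

Lemma ddef_mbex Q t : ddef (fun e => Q (e 0%N) (fun i => e i.+1)) -> mdef t ->
  ddef (fun e => exists x : M, ltM x (t e) /\ Q x e).
Proof.
move=> HQ Ht; apply: (Ht id (fun y e => exists x : M, ltM x y /\ Q x e)) => r g br.
apply: (@ddef_bex A (fun x e => Q x (fun i => e (g i))) r) => //.
exact: (ddef_rename (fun i => if i is j.+1 then (g j).+1 else 0%N) HQ).
Qed.

(** Components are at most the code of their pair, so both finding them and establishing that there
    are none are bounded searches. *)
Lemma pair_search n (P : M -> M -> Prop) (B : Prop) :
  (exists i, ltM i (addM n (oneM A)) /\ exists j, ltM j (addM n (oneM A)) /\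
     (n = pr i j /\ P i j)) \/
  ((forall i, ltM i (addM n (oneM A)) -> forall j, ltM j (addM n (oneM A)) -> n <> pr i j) /\ B)
  <-> (exists i j, n = pr i j /\ P i j) \/ ((forall i j, n <> pr i j) /\ B).
Proof.
split=> [[[i [_ [j [_ H]]]]|[H HB]]|[[i [j [E H]]]|[H HB]]].
- by left; exists i, j.
- right; split=> // i j E; apply: (H i _ j) => //; apply/ltM_succ; rewrite E;
    [exact: pr_gel|exact: pr_ger].
- left; exists i; split; first by apply/ltM_succ; rewrite E; exact: pr_gel.
  by exists j; split=> //; apply/ltM_succ; rewrite E; exact: pr_ger.
- by right.
Qed.

Lemma mdef_pair_proj (op : M -> M) (sel : M -> M -> M) t :
  (sel = fun i _ => i) \/ (sel = fun _ j => j) ->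
  (forall i j, op (pr i j) = sel i j) ->
  (forall n, (forall i j, n <> pr i j) -> op n = zeroM A) ->
  mdef t -> mdef (fun e => op (t e)).
Proof.
move=> Hsel op_pr op_out; apply: vdef_comp1 => r dr f Q H.
pose P e (i j : M) := Q (sel i j) e.
apply: (@ddef_ext _ (fun e => (exists i, ltM i (addM (r (fun k => e (f k))) (oneM A)) /\
    exists j, ltM j (addM (r (fun k => e (f k))) (oneM A)) /\
     (r (fun k => e (f k)) = pr i j /\ P e i j)) \/
  ((forall i, ltM i (addM (r (fun k => e (f k))) (oneM A)) ->
    forall j, ltM j (addM (r (fun k => e (f k))) (oneM A)) -> r (fun k => e (f k)) <> pr i j) /\
    Q (zeroM A) e))).
  move=> e; rewrite pair_search; set n := r _; split.
    by case=> [[i [j [-> Hij]]]|[Hn H0]]; [rewrite op_pr|rewrite op_out].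
  have [[i [j ->]]|nn] := pselect (exists i j, n = pr i j).
    by rewrite op_pr => Hq; left; exists i, j.
  have Hn i j : n <> pr i j by move=> E; apply: nn; exists i, j.
  by rewrite op_out // => H0; right.
have dr1 : tdef (fun e => addM (r (fun k => e (f k))) (oneM A)).
  by apply: tdef_add; [apply: tdef_rename|apply: tdef_const].
have dr2 : tdef (fun e => addM (r (fun k => e (f k).+1)) (oneM A)).
  by apply: tdef_add; [apply: (tdef_rename (fun k => (f k).+1))|apply: tdef_const].
have dr3 : tdef (fun e => r (fun k => e (f k).+2)) by apply: (tdef_rename (fun k => (f k).+2)).
have deq : ddef (fun e : env => r (fun k => e (f k).+2) = pr (e 1%N) (e 0%N)).
  by apply: ddef_eq; [exact: aset|exact: dr3|apply: tdef_pr; apply: tdef_var].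
apply: ddef_or.
  apply: (@ddef_bex A (fun i e => exists j, ltM j (addM (r (fun k => e (f k))) (oneM A)) /\
     (r (fun k => e (f k)) = pr i j /\ P e i j))) => //.
  apply: (@ddef_bex A (fun j e => r (fun k => e (f k).+1) = pr (e 0%N) j /\
     P (fun k => e k.+1) (e 0%N) j)) => //.
  apply: ddef_and => //; rewrite /P; case: Hsel => ->.
    by apply: (H (fun e => e 1%N) (fun i => i.+2)); apply: tdef_var.
  by apply: (H (fun e => e 0%N) (fun i => i.+2)); apply: tdef_var.
apply: ddef_and; last by apply: (H (fun _ => zeroM A) id); apply: tdef_const.
apply: (@ddef_ball A (fun i e => forall j, ltM j (addM (r (fun k => e (f k))) (oneM A)) ->
     r (fun k => e (f k)) <> pr i j)) => //.
apply: (@ddef_ball A (fun j e => r (fun k => e (f k).+1) <> pr (e 0%N) j)) => //.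
exact: ddef_not.
Qed.

Lemma mdef_pfst t : mdef t -> mdef (fun e => pfst (t e)).
Proof.
apply: (@mdef_pair_proj (@pfst A) (fun i _ => i) t); [by left|exact: pfst_pr|].
by move=> n Hn; rewrite /pfst; case: pselect => // H; exfalso; have [i [j /Hn]] := H.
Qed.
Lemma mdef_psnd t : mdef t -> mdef (fun e => psnd (t e)).
Proof.
apply: (@mdef_pair_proj (@psnd A) (fun _ j => j) t); [by right|exact: psnd_pr|].
by move=> n Hn; rewrite /psnd; case: pselect => // H; exfalso; have [j [i /Hn]] := H.
Qed.

Lemma kdef_const x : kdef (fun _ => x).
Proof. by apply: kdef_rdef; apply: rdef_const. Qed.
Lemma kdef_num t : mdef t -> kdef (fun e => (t e)%:K).
Proof.
by apply: (@vdef_comp1 _ _ (@tdef A) (@rdef A) (@num A)) => r dr; apply: kdef_rdef; apply: rdef_num.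
Qed.
Lemma kdef_ninv t : mdef t -> kdef (fun e => ninv (t e)).
Proof.
by apply: (@vdef_comp1 _ _ (@tdef A) (@rdef A) (@ninv A)) => r dr; apply: kdef_rdef; apply: rdef_ninv.
Qed.
Lemma kdef_opp t : kdef t -> kdef (fun e => - t e).
Proof.
by apply: (@vdef_comp1 _ _ (@rdef A) (@rdef A) (fun x => - x)) => r dr; apply: kdef_rdef; apply: rdef_opp.
Qed.
Lemma kdef_add s t : kdef s -> kdef t -> kdef (fun e => s e + t e).
Proof.
apply: (@vdef_comp2 _ _ _ (@rdef A) (@rdef A) (@rdef A) +%R) rdef_rename _ => r r' br br'.
by apply: kdef_rdef; apply: rdef_add.
Qed.
Lemma kdef_mul s t : kdef s -> kdef t -> kdef (fun e => s e * t e).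
Proof.
apply: (@vdef_comp2 _ _ _ (@rdef A) (@rdef A) (@rdef A) *%R) rdef_rename _ => r r' br br'.
by apply: kdef_rdef; apply: rdef_mul.
Qed.

Lemma ddef_kle s t : kdef s -> kdef t -> ddef (fun e => s e <= t e).
Proof.
by apply: (@ddef_comp2 _ _ (@rdef A) (@rdef A) (fun x y => is_true (x <= y))) rdef_rename _ => r r'; apply: ddef_rle.
Qed.
Lemma ddef_klt s t : kdef s -> kdef t -> ddef (fun e => s e < t e).
Proof.
by apply: (@ddef_comp2 _ _ (@rdef A) (@rdef A) (fun x y => is_true (x < y))) rdef_rename _ => r r'; apply: ddef_rlt.
Qed.
Lemma ddef_keq s t : kdef s -> kdef t -> ddef (fun e => s e = t e).
Proof.
by apply: (@ddef_comp2 _ _ (@rdef A) (@rdef A) (fun x y => x = y)) rdef_rename _ => r r'; apply: ddef_req.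
Qed.

Lemma kdef_min s t : kdef s -> kdef t -> kdef (fun e => Num.min (s e) (t e)).
Proof.
apply: (@vdef_comp2 _ _ _ (@rdef A) (@rdef A) (@rdef A) Num.min) rdef_rename _.
move=> r r' dr dr' f Q H.
have dr1 := rdef_rename f dr; have dr1' := rdef_rename f dr'.
apply: (@ddef_ext _ (fun e =>
  (r (fun i => e (f i)) <= r' (fun i => e (f i)) /\ Q (r (fun i => e (f i))) e) \/
  (r' (fun i => e (f i)) < r (fun i => e (f i)) /\ Q (r' (fun i => e (f i))) e))).
  move=> e; case: lerP => h; split=> [[[]|[]]//|]; by [left|right].
apply: ddef_or; apply: ddef_and.
- exact: ddef_rle.
- exact: (H _ id dr1).
- exact: ddef_rlt.
- exact: (H _ id dr1').
Qed.

Lemma kdef_abs t : kdef t -> kdef (fun e => `|t e|).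
Proof.
apply: (@vdef_comp1 _ _ (@rdef A) (@rdef A) Num.norm) => r dr f Q H; have dr1 := rdef_rename f dr.
apply: (@ddef_ext _ (fun e =>
  (0 <= r (fun i => e (f i)) /\ Q (r (fun i => e (f i))) e) \/
  (r (fun i => e (f i)) < 0 /\ Q (- r (fun i => e (f i))) e))).
  move=> e; case: (lerP 0 (r (fun i => e (f i)))) => h; rewrite ?(ger0_norm h) ?(ltr0_norm h).
    by split=> [[[]|[]]//|]; left.
  by split=> [[[]|[]]//|]; right.
apply: ddef_or; apply: ddef_and.
- by apply: ddef_rle => //; apply: rdef_const.
- exact: (H _ id dr1).
- by apply: ddef_rlt => //; apply: rdef_const.
- exact: (H _ id (rdef_opp dr1)).
Qed.

Lemma kdef_ratv t : mdef t -> kdef (fun e => ratv (t e)).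
Proof.
move=> dt; rewrite /ratv /trv; apply: kdef_mul; last by apply: kdef_ninv; apply: mdef_psnd.
apply: kdef_add; [|apply: kdef_opp]; apply: kdef_num.
  by do 2 apply: mdef_pfst.
by apply: mdef_psnd; apply: mdef_pfst.
Qed.

Lemma ddef_is_tri t : mdef t -> ddef (fun e => is_tri (t e)).
Proof.
move=> dt; apply: ddef_meq => //; apply: mdef_pr; last exact: mdef_psnd.
by apply: mdef_pr; [apply: mdef_pfst|apply: mdef_psnd]; apply: mdef_pfst.
Qed.

Lemma ddef_israt t : mdef t -> ddef (fun e => israt (t e)).
Proof.
apply: (@ddef_comp1 _ (@tdef A) (@israt A)) => r dr; have dr' := mdef_tdef dr.
apply: (@ddef_ext _ (fun e => is_tri (r e) /\
    forall q', ltM q' (r e) -> is_tri q' -> ratv q' <> ratv (r e))).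
  by move=> e; rewrite isratE.
apply: ddef_and; first exact: ddef_is_tri.
apply: (@ddef_mball (fun q' e => is_tri q' -> ratv q' <> ratv (r e))) => //.
apply: ddef_imp; first by apply: ddef_is_tri; apply: mdef_var.
apply: ddef_not; apply: ddef_keq; apply: kdef_ratv; first exact: mdef_var.
by apply: mdef_tdef; apply: (tdef_rename S dr).
Qed.

End Decoding.

Ltac decodable_step := cbv beta; first
  [ assumption
  | apply: mdef_var
  | apply: ddef_mball | apply: ddef_mbex
  | apply: ddef_mmem | apply: ddef_meq | apply: ddef_mlt | apply: ddef_keq
  | apply: ddef_kle | apply: ddef_klt | apply: ddef_israt
  | apply: ddef_and | apply: ddef_or | apply: ddef_not
  | apply: ddef_imp
  | apply: kdef_ratv | apply: kdef_num | apply: kdef_ninv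
  | apply: kdef_min | apply: kdef_abs
  | apply: kdef_opp | apply: kdef_mul | apply: kdef_add | apply: kdef_const
  | apply: mdef_pfst | apply: mdef_psnd | apply: mdef_pr
  | apply: mdef_add | apply: mdef_const ].
Ltac decodable := repeat decodable_step.
(** * The extension *)

Section Extension.
Local Open Scope ring_scope.
Variable A : arith_model.
Notation M := (dom A).
Notation K := (afld A).
Local Notation "n %:K" := (@num A n) (at level 2, left associativity, format "n %:K").
Variables U F : sdom A.
Hypothesis HF : funcode F.

(* A number [n] codes the cone with apex value [bv n] over the ball of centre
   [bc n] and radius [1 / (bk n + 1)]. *)
Definition bc (n : M) : K := ratv (pfst n).
Definition bv (n : M) : K := ratv (pfst (psnd n)).
Definition bk (n : M) : M := psnd (psnd n).
Definition dist (n : M) (x : K) : K := `|x - bc n| * ((bk n)%:K + 1).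

(* As far as can be seen below [i], the value [bv n] bounds [F] on the ball. *)
Definition good (i n : M) := -1 <= bv n /\
  forall q, ltM q i -> forall s, ltM s i -> forall u, ltM u i ->
    israt q -> memM (pr (pr q s) u) F -> (bk n)%:K <= s%:K ->
    dist n (ratv q) < 1 -> ratv u <= bv n.

(* A number [m] codes a stage, a centre and a radius; as far as can be seen
   below [i], the open set contains that ball from that stage on. *)
Definition ma (m : M) : M := pfst (psnd m).
Definition mr (m : M) : M := psnd (psnd m).
Definition act (i m : M) := israt (ma m) /\ (israt (mr m) /\
  forall n, ltM n i -> (pfst m)%:K <= n%:K -> memM (pr (pr n (ma m)) (mr m)) U).

(* Positive only inside the ball coded by [m], and there large for all but
   boundedly many [n]. *)
Definition penalty (n m : M) (x : K) : K :=
  (n%:K + 1) * ninv m * Num.min 1 (ratv (mr m) - `|x - ratv (ma m)|).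

(** What stage [i] knows of the infimum being at most [y]: some cone, raised by each visible
    penalty, is at most [y] at [x]. Here [u] will be f(q)_i. The condition on it discards cones that
    f refutes at the point itself although [good] has not yet seen this; it keeps h from dropping
    below f on the closed set. *)
Definition above (x : K) (i : M) (u y : K) := exists n, ltM n i /\
  (good i n /\ ((dist n x < 1 -> u <= bv n) /\ (bv n + 2 * dist n x <= y /\
   forall m, ltM m i -> act i m -> bv n + 2 * dist n x + penalty n m x <= y))).

Definition grid (i w : M) : K := -1 + w%:K * ninv i.

(** The grid reaches 1 at w = 2i + 2, so the first disjunct is the cut-off at 1. *)
Definition stop (x : K) (i : M) (u : K) (w : M) :=
  2 * i%:K + 2 <= w%:K \/ above x i u (grid i w).

Definition cut (x : K) (i : M) (u : K) (w : M) :=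
  stop x i u w /\ forall w', ltM w' w -> ~ stop x i u w'.

(** The bound on [w] excludes nothing, by [cut_exists], and makes the search for [w] Delta^0_0. *)
Definition value (x : K) (i : M) (u r : K) := exists w,
  ltM w (addM (addM (addM i i) (addM (oneM A) (oneM A))) (oneM A)) /\ (cut x i u w /\ r = grid i w).

Lemma above_mono x i u y z : y <= z -> above x i u y -> above x i u z.
Proof.
move=> yz [n [ni [gn [un [Hy Hm]]]]]; exists n; split=> //; split=> //; split=> //.
by split=> [|m mi am]; [apply: le_trans yz|apply: le_trans (Hm m mi am) yz].
Qed.

Lemma above_ge x i u y : above x i u y -> -1 <= y.
Proof.
move=> [n [_ [[Hv _] [_ [Hy _]]]]]; apply: le_trans Hy.
have : 0 <= dist n x by rewrite mulr_ge0 // ltW // succ_gt0.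
lra.
Qed.

Lemma ltM_2i2 (i w : M) : ltM w (addM (addM (addM i i) (addM (oneM A) (oneM A))) (oneM A)) <->
  w%:K <= 2 * i%:K + 2.
Proof.
rewrite ltM_succ !numD num1; have -> : i%:K + i%:K + (1 + 1) = 2 * i%:K + 2 by ring.
by [].
Qed.

Lemma cut_exists x i u : exists w, cut x i u w /\ w%:K <= 2 * i%:K + 2.
Proof.
have [||w [Hw Hmin]] := @least A (stop x i u).
- rewrite /stop /above /good /act /penalty /dist /bc /bv /bk /ma /mr /grid.
  by decodable.
- exists (addM (addM i i) (addM (oneM A) (oneM A))).
  by left; rewrite !numD num1; lra.
exists w; split; first split=> // w' /num_lt w'w /Hmin; first by rewrite leNgt w'w.
have -> : 2 * i%:K + 2 = (addM (addM i i) (addM (oneM A) (oneM A)))%:K.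
  by rewrite !numD num1; ring.
by apply: Hmin; left; rewrite !numD num1; lra.
Qed.

Lemma cut_uniq x i u w w' : cut x i u w -> cut x i u w' -> w = w'.
Proof.
move=> [H1 H2] [H1' H2']; apply: num_inj; apply/le_anti; rewrite !leNgt.
by apply/andP; split; apply/negP => /num_lt; [move/H2|move/H2'].
Qed.

Lemma valueE x i u r : value x i u r <-> exists w, cut x i u w /\ r = grid i w.
Proof.
split=> [[w [_ H]]|[w [Hw ->]]]; exists w => //; split=> //.
have [w' [Hw' b]] := cut_exists x i u.
by apply/ltM_2i2; rewrite (cut_uniq Hw Hw').
Qed.

(** h(q)_i is the least grid point that is 1 or visibly above the infimum. The three properties are
    all that the continuity proof uses; the slack [ninv i] in the last one is the mesh of the
    grid. *)
Lemma extension_exists : exists H, funcode H /\ forall q i, israt q ->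
  [/\ -1 <= fnv H q i <= 1,
      fnv H q i < 1 -> above (ratv q) i (fnv F q i) (fnv H q i) &
      forall z, above (ratv q) i (fnv F q i) z -> fnv H q i <= z + ninv i].
Proof.
pose kq (k : M) := pfst (pfst k); pose ki (k : M) := psnd (pfst k); pose kr (k : M) := psnd k.
pose P k := k = pr (pr (kq k) (ki k)) (kr k) /\ (israt (kq k) /\ (israt (kr k) /\
  value (ratv (kq k)) (ki k) (fnv F (kq k) (ki k)) (ratv (kr k)))).
pose body (u k : M) := value (ratv (kq k)) (ki k) (ratv u) (ratv (kr k)).
have dbody : ddef (fun e => body (e O) (e 1%N)).
  rewrite /body /value /cut /stop /above /good /act /penalty /dist /bc /bv /bk /ma /mr /grid
    /kq /ki /kr.
  by decodable.
(* [u] ranges over candidates for the code of f(q)_i. Exactly one of them occurs in [F], so an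
   existential and a universal search define the same set, as Delta^0_1-comprehension requires. *)
pose BA (u k : M) := k = pr (pr (kq k) (ki k)) (kr k) /\ (israt (kq k) /\ (israt (kr k) /\
  (memM (pr (pr (kq k) (ki k)) u) F /\ body u k))).
pose BB (u k : M) := k = pr (pr (kq k) (ki k)) (kr k) /\ (israt (kq k) /\ (israt (kr k) /\
  (memM (pr (pr (kq k) (ki k)) u) F -> body u k))).
have [||k|k|H HH] := @delta1_comprehension A (@amodels A) P BA BB.
- by rewrite /BA /kq /ki /kr; decodable.
- by rewrite /BB /kq /ki /kr; decodable.
- split=> [[E [Rq [Rr Hv]]]|[u [E [Rq [Rr [Hu Hb]]]]]].
    exists (fnc F (kq k) (ki k)); do 3 split=> //; split=> //.
    by have [_ HFu] := fncP HF (ki k) Rq; apply/HFu.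
  do 3 split=> //; have [_ HFu] := fncP HF (ki k) Rq.
  by move: Hb; rewrite /body /fnv; move/HFu: Hu => ->.
- split=> [[E [Rq [Rr Hv]]] u|HB].
    do 3 split=> //; have [_ HFu] := fncP HF (ki k) Rq => /HFu ->; exact: Hv.
  have [E [Rq [Rr Hb]]] := HB (fnc F (kq k) (ki k)).
  by do 3 split=> //; apply: Hb; have [_ HFu] := fncP HF (ki k) Rq; apply/HFu.
have HP q i r : memM (pr (pr q i) r) H <->
    israt q /\ (israt r /\ value (ratv q) i (fnv F q i) (ratv r)).
  by rewrite HH /P /kq /ki /kr !(pfst_pr, psnd_pr); split=> [[]|].
have HfH : funcode H.
  split=> [k /HH [E [Rq [Rr _]]]|q i Rq]; first by exists (kq k), (ki k), (kr k).
  have [w [Hw _]] := cut_exists (ratv q) i (fnv F q i).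
  have [r [Rr Er]] := rat_exists (grid i w); exists r; split.
    by apply/HP; do 2 split=> //; apply/valueE; exists w.
  move=> r' /HP [_ [Rr' /valueE [w' [Hw' Er']]]].
  by apply: israt_inj => //; rewrite Er Er' (cut_uniq Hw Hw').
exists H; split=> // q i Rq; have [_ HHu] := fncP HfH i Rq.
have /HHu/HP [_ [_ /valueE [w [Hw Ew]]]] := erefl (fnc H q i).
have {}Ew : fnv H q i = grid i w by [].
rewrite Ew; have ip := ninv_gt0 i; have ie := ninv_mul i; have i0 := num_ge0 i.
have w0 := num_ge0 w; have [w' [Hw' wb]] := cut_exists (ratv q) i (fnv F q i).
have {Hw' w'} wb : w%:K <= 2 * i%:K + 2 by rewrite (cut_uniq Hw Hw').
case: Hw => Hw Hmin; split.
- rewrite /grid; apply/andP; split; nra.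
- case: Hw => // Hw; rewrite /grid => H1; exfalso; nra.
(* Either the value is the first grid point -1, which is at most [z], or its predecessor on the grid
   fails [stop] and so must lie below [z]. *)
move=> z Hz; have := above_ge Hz; have [w1|w1] := num_01_ge1 w.
  by rewrite /grid w1 mul0r addr0; lra.
have [w2|[v wv]] := zero_or_succ (@amodels A) (aset A) w; first by rewrite w2 num0 in w1; lra.
rewrite leNgt => _; apply/negP => zw; apply: (Hmin v).
  by apply/num_lt; rewrite wv numS; lra.
right; apply: above_mono Hz; move: zw; rewrite /grid wv numS; lra.
Qed.

End Extension.
(** * Continuity of the extension *)

Section Continuity.
Local Open Scope ring_scope.
Variable A : arith_model.
Notation M := (dom A).
Notation K := (afld A).
Local Notation "n %:K" := (@num A n) (at level 2, left associativity, format "n %:K").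
Implicit Types (i j m n b k : M) (x y : K).

Lemma ninv_anti m n : m%:K <= n%:K -> ninv n <= ninv m.
Proof. by move=> mn; rewrite lef_pV2 ?posrE ?succ_gt0 // lerD2r. Qed.

Lemma ninv_le1 n : ninv n <= 1.
Proof. by rewrite invf_le1 ?succ_gt0 // lerDr num_ge0. Qed.

Lemma small_ninv x y : 0 < x -> exists n, ninv n < x /\ y <= n%:K.
Proof.
move=> x0; have [a Ha] := exists_ninv x0; have [n Hn] := num_bound (Num.max a%:K y).
move: Hn; rewrite ge_max => /andP [an yn]; exists n; split=> //.
exact: le_lt_trans (ninv_anti an) Ha.
Qed.

Lemma num_bound2 x y : exists n, x <= n%:K /\ y <= n%:K.
Proof.
by have [n] := num_bound (Num.max x y); rewrite ge_max => /andP [xn yn]; exists n.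
Qed.

(** One stage [s] settles the Pi^0_1 condition that [P i m] holds for all [i], simultaneously for
    all [m] below [b]. The existence of such a stage is Sigma^0_2, and induction on [b] applies: if
    the condition fails for the new number at some [i0], the stage is raised to [i0]. *)
Lemma strong_bounding (P : M -> M -> Prop) (b : M) : ddef (fun e => P (e 0%N) (e 1%N)) ->
  (forall i j m, i%:K <= j%:K -> P j m -> P i m) ->
  exists s, forall m, ltM m b -> P s m -> forall i, P i m.
Proof.
move=> dP Pmono.
pose B b := exists s, forall i, forall m, ltM m b -> P s m -> P i m.
suff [s Hs] : B b by exists s => m mb Ps i; apply: Hs Ps.
pose Q (y x b : M) := forall m, ltM m b -> P x m -> P y m.
apply: (@sigma2_induction A (@amodels A) B Q).
- apply: (@ddef_mball A (fun m e => P (e 1%N) m -> P (e 0%N) m)); last exact: mdef_var.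
  apply: ddef_imp.
    exact: (ddef_rename (fun c => if c is 0%N then 2%N else 0%N) dP).
  exact: (ddef_rename (fun c => if c is 0%N then 1%N else 0%N) dP).
- by [].
- by exists (zeroM A) => i m /(ltm0 (@amodels A) (aset A)).
move=> {}b [s Hs].
have [Hb|/existsNP [i0 Hi0]] := pselect (forall i, P i b).
  exists s => i m /(ltmS (@amodels A) (aset A)) [mb|->] Ps //; exact: Hs Ps.
have [s' [ss' is']] := num_bound2 s%:K i0%:K.
exists s' => i m /(ltmS (@amodels A) (aset A)) [mb|->] Ps.
  by apply: (Hs i m mb); apply: Pmono Ps.
by case: Hi0; apply: Pmono Ps.
Qed.

(** Replaces the balls [ballK], whose strict inequality of reals contains a negation; the two
    notions differ only by a small change of radius. *)
Definition near (s : M -> K) (d x : K) := exists N, forall n, N%:K <= n%:K -> `|s n - x| < d.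

Lemma near_le s d d' x : d <= d' -> near s d x -> near s d' x.
Proof. by move=> dd' [N H]; exists N => n /H Hn; apply: lt_le_trans dd'. Qed.

Lemma near_near s d d' x y : near s d x -> near s d' y -> `|x - y| < d + d'.
Proof.
move=> [N H] [N' H']; have [n [Nn N'n]] := num_bound2 N%:K N'%:K.
have := H n Nn; have := H' n N'n; have := ler_distD (s n) x y.
rewrite (distrC x (s n)); lra.
Qed.

Lemma near_trans s d d' x y : near s d x -> `|x - y| <= d' -> near s (d + d') y.
Proof.
move=> [N H] xy; exists N => n /H; have := ler_distD x (s n) y; lra.
Qed.

Lemma rltK_below (t : M -> K) x y : y < x -> (exists N, forall n, N%:K <= n%:K -> t n <= y) ->
  rltK t (fun _ => x).
Proof.
move=> yx [N H]; split=> [e e0|[_ H']].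
  by exists N => n /H; lra.
have [N' HN'] := H' ((x - y) / 2) ltac:(lra).
have [n [Nn N'n]] := num_bound2 N%:K N'%:K.
have := H n Nn; have := HN' n N'n; lra.
Qed.

Lemma near_ball s d d' x : d < d' -> near s d x -> ballK d' s (fun _ => x).
Proof. by move=> dd' [N H]; apply: (rltK_below dd'); exists N => n /H /ltW. Qed.

(** Strictness leaves a margin at arbitrarily late indices, and the Cauchy property spreads half of
    that margin to all late indices. *)
Lemma ball_near s d x : cauchyK s -> ballK d (fun _ => x) s ->
  exists e, 0 < e /\ near s (d - e) x.
Proof.
move=> Cs [H1 H2].
have [e [e0 He]] : exists e, 0 < e /\ forall N : M, exists n : M,
    N%:K <= n%:K /\ `|x - s n| + e < d.
  apply: contrapT => H; apply: H2; split=> // e e0.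
  apply: contrapT => HN; apply: H; exists e; split=> // N.
  apply: contrapT => Hn; apply: HN; exists N => n Nn; rewrite leNgt; apply/negP => lt.
  by apply: Hn; exists n.
have [N HN] := Cs (e / 2) ltac:(lra); have [m [Nm Hm]] := He N.
exists (e / 2); split; first lra.
exists N => n Nn; have := HN n m (conj Nn Nm); have := ler_distD (s m) (s n) x.
rewrite (distrC (s m) x); lra.
Qed.

(** * How cones and penalties vary with the point *)

Lemma dist_ge0 n x : 0 <= dist n x.
Proof. by rewrite mulr_ge0 // ltW // succ_gt0. Qed.

Lemma dist_lip n x y : dist n y <= dist n x + `|x - y| * ((bk n)%:K + 1).
Proof.
rewrite /dist -mulrDl ler_wpM2r //; first by rewrite ltW // succ_gt0.
by have := ler_distD x y (bc n); rewrite (distrC y x); lra.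
Qed.

(** For a fixed cone this tends to 0, so only boundedly many balls of the complement matter to
    it. *)
Lemma penalty_le n m x : penalty n m x <= (n%:K + 1) * ninv m.
Proof.
rewrite -[leRHS]mulr1 ler_wpM2l ?ge_min ?lexx //.
by rewrite mulr_ge0 ?ltW ?succ_gt0 ?ninv_gt0.
Qed.

Lemma penalty_small n m x y : 0 <= y -> ratv (mr m) - `|x - ratv (ma m)| <= y ->
  penalty n m x <= (n%:K + 1) * y.
Proof.
move=> y0 H; rewrite /penalty -mulrA ler_wpM2l //; first by rewrite ltW ?succ_gt0.
have i1 := ninv_le1 m; have i0 := ninv_gt0 m.
have : Num.min 1 (ratv (mr m) - `|x - ratv (ma m)|) <= y by rewrite ge_min H orbT.
nra.
Qed.

(** The Lipschitz constant n + 1 is independent of [m]: moving the point changes all penalties on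
    one cone by a common amount. *)
Lemma penalty_lip n m x y : penalty n m y <= penalty n m x + (n%:K + 1) * `|x - y|.
Proof.
rewrite /penalty -!mulrA -mulrDr ler_wpM2l //; first by rewrite ltW ?succ_gt0.
have i1 := ninv_le1 m; have i0 := ninv_gt0 m; have xy := normr_ge0 (x - y).
set a := ratv (ma m); set r := ratv (mr m).
have : Num.min 1 (r - `|y - a|) <= Num.min 1 (r - `|x - a|) + `|x - y|.
  have := ler_distD y x a; case: (lerP 1 (r - `|y - a|)); case: (lerP 1 (r - `|x - a|)); lra.
nra.
Qed.

Lemma penalty_big n m x y : y <= Num.min 1 (ratv (mr m) - `|x - ratv (ma m)|) ->
  (n%:K + 1) * ninv m * y <= penalty n m x.
Proof.
by move=> H; rewrite ler_wpM2l // mulr_ge0 ?ltW ?succ_gt0 ?ninv_gt0.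
Qed.

Lemma good_mono (F : sdom A) i j n : i%:K <= j%:K -> good F j n -> good F i n.
Proof.
move=> ij [Hv H]; split=> // q qi s si u ui; apply: H; apply/num_lt; apply: lt_le_trans ij;
by apply/num_lt.
Qed.

Lemma act_mono (U : sdom A) i j m : i%:K <= j%:K -> act U j m -> act U i m.
Proof.
move=> ij [Ha [Hr H]]; do 2 split=> //; move=> n ni; apply: H; apply/num_lt.
by apply: lt_le_trans ij; apply/num_lt.
Qed.

Lemma good_bounding (F : sdom A) b :
  exists s, forall n, ltM n b -> good F s n -> forall i, good F i n.
Proof.
apply: strong_bounding; last exact: good_mono.
by rewrite /good /dist /bc /bv /bk; decodable.
Qed.

Lemma act_bounding (U : sdom A) b :
  exists s, forall m, ltM m b -> act U s m -> forall i, act U i m.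
Proof.
apply: strong_bounding; last exact: act_mono.
by rewrite /act /ma /mr; decodable.
Qed.

Lemma act_all (U : sdom A) m : (forall i, act U i m) ->
  forall n, (pfst m)%:K <= n%:K -> memM (pr (pr n (ma m)) (mr m)) U.
Proof.
move=> H n mn; have [_ [_ Hm]] := H (addM n (oneM A)); apply: Hm => //.
by apply/ltM_succ.
Qed.

Lemma good_all (F : sdom A) n : funcode F -> (forall i, good F i n) ->
  forall q i, israt q -> (bk n)%:K <= i%:K -> dist n (ratv q) < 1 -> fnv F q i <= bv n.
Proof.
move=> HF H q i Rq ki d1; have [Rf Hf] := fncP HF i Rq.
have [N [HN1 HN2]] := num_bound2 (q%:K + 1) (Num.max (i%:K + 1) ((fnc F q i)%:K + 1)).
move: HN2; rewrite ge_max => /andP [HN2 HN3].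
have [_ HN] := H N; apply: (HN q _ i _ (fnc F q i)) => //; try (apply/num_lt; lra).
exact/Hf.
Qed.

(** * The extension near a single real *)

Section AtPoint.
Variables (U F H : sdom A) (X : sdom A).
Hypotheses (HF : funcode F) (HH : funcode H) (RX : realM X).
Hypothesis Hbound : forall q i, israt q -> -1 <= fnv H q i <= 1.
Hypothesis Habove : forall q i, israt q -> fnv H q i < 1 ->
  above U F (ratv q) i (fnv F q i) (fnv H q i).
Hypothesis Hleast : forall q i z, israt q -> above U F (ratv q) i (fnv F q i) z ->
  fnv H q i <= z + ninv i.
Let s := seqv X.

Lemma seqv_near x : 0 < x -> exists N, forall i, N%:K <= i%:K -> near s x (s i).
Proof.
move=> x0; have [_ Cs] := RX; have [N HN] := Cs x x0; exists N => i Ni; exists N => n Nn.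
by apply: HN.
Qed.

(** The ball [m0] around the point lifts every cone from number [b] on to -1 + 2 = 1 or more. A
    value below 1 is thus witnessed by a cone with n < b, which is genuinely good at late stages and
    has a Lipschitz constant bounded in terms of [b]. The same cone then serves at the other
    rational. As the two rationals are interchangeable, one inequality is enough. *)
Lemma oscillation_open x : inopen s U -> 0 < x ->
  exists d N, 0 < d /\ forall q r i j, israt q -> israt r ->
    near s d (ratv q) -> near s d (ratv r) -> N%:K <= i%:K -> N%:K <= j%:K ->
    fnv H r j <= fnv H q i + 3 * x.
Proof.
move=> [N [a [Ra [r [Rr [r0 [Hball Hmem]]]]]]] x0; have [_ Cs] := RX.
have [t [t0 Ht]] := ball_near Cs Hball.
pose m0 := pr N (pr a r).
have m0a : ma m0 = a by rewrite /ma /m0 psnd_pr pfst_pr.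
have m0r : mr m0 = r by rewrite /mr /m0 !psnd_pr.
have act0 i : act U i m0.
  by rewrite /act m0a m0r; do 2 split=> //; move=> n _; rewrite /m0 pfst_pr; apply: Hmem.
(* Rationals that are [t / 2]-near to the real still have distance [t / 2] to the rim of the ball,
   since the real has margin [t]. *)
pose tau := Num.min 1 (t / 2).
have tau0 : 0 < tau by rewrite lt_min ltr01; lra.
have [b Hb] := num_bound (2 * (m0%:K + 1) / tau).
have {}Hb : 2 <= (b%:K + 1) * ninv m0 * tau.
  have Hb' : 2 * (m0%:K + 1) / tau <= b%:K + 1 by lra.
  rewrite ler_pdivrMr // in Hb'; have := ninv_mul m0; have := ninv_gt0 m0; nra.
have b0 := num_ge0 b; have b1 := succ_gt0 b.
have [s1 Hs1] := good_bounding F b.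
have [b' [Hb' _]] := @small_ninv (x / (b%:K + 1)) 0 ltac:(by rewrite divr_gt0).
rewrite ltr_pdivlMr // in Hb'.
have [s2 Hs2] := act_bounding U b'.
(* Two rationals near the real differ by less than 2d. Twice the distance term then changes by at
   most 4d(b + 1) and a penalty by at most 2d(b + 1), whence the 6. *)
pose d := Num.min (t / 2) (x / (6 * (b%:K + 1))).
have d0 : 0 < d by rewrite lt_min !divr_gt0 // mulr_gt0.
have dt : d <= t / 2 by rewrite ge_min lexx.
have dx : d * (6 * (b%:K + 1)) <= x.
  by rewrite -ler_pdivlMr ?mulr_gt0 // ge_min lexx orbT.
pose big := Num.max (m0%:K + 1) (Num.max b%:K (Num.max b'%:K (Num.max s1%:K s2%:K))).
have [N' [HN' bigN]] := @small_ninv x big x0.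
move: bigN; rewrite /big !ge_max => /and5P [N'm N'b N'b' N'1 N'2].
exists d, N'; split=> // q p i j Rq Rp nq np N'i N'j.
have qp := near_near nq np.
have [h1|h1] := lerP 1 (fnv H q i).
  by have /andP [_] := Hbound j Rp; lra.
have [n [ni [gn [_ [Hy Hm]]]]] := Habove Rq h1.
have n0 := num_ge0 n; have [vn _] := gn.
have nb : n%:K < b%:K.
  rewrite ltNge; apply/negP => bn.
  have := Hm m0 ltac:(apply/num_lt; lra) (act0 i).
  have : (n%:K + 1) * ninv m0 * tau <= penalty n m0 (ratv q).
    apply: penalty_big; rewrite m0a m0r le_min /tau !ge_min lexx /=.
    apply/orP; right; have := near_near nq Ht; lra.
  have := dist_ge0 n (ratv q).
  have : (b%:K + 1) * ninv m0 * tau <= (n%:K + 1) * ninv m0 * tau.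
    by apply: ler_wpM2r; [exact: ltW|apply: ler_wpM2r; [exact/ltW/ninv_gt0|rewrite lerD2r]].
  lra.
have gT : forall k, good F k n.
  by apply: Hs1; [apply/num_lt|apply: good_mono gn; lra].
have bkn : (bk n)%:K <= n%:K.
  by apply: le_trans (psnd_le _) (psnd_le _).
(* One [x] pays for moving the cone, another for penalties numbered [b'] or more; the third [x] in
   the claim is the mesh. *)
suff Ha : above U F (ratv p) j (fnv F p j) (fnv H q i + 2 * x).
  have := Hleast Rp Ha; have := ninv_anti N'j; lra.
have nn := normr_ge0 (ratv q - ratv p).
have Hd : 2 * dist n (ratv p) <= 2 * dist n (ratv q) + x.
  have := dist_lip n (ratv q) (ratv p).
  have : `|ratv q - ratv p| * ((bk n)%:K + 1) <= 2 * d * (b%:K + 1).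
    by apply: ler_pM => //; [rewrite ltW ?succ_gt0|lra|lra].
  lra.
exists n; split; first by apply/num_lt; lra.
split=> //; split=> [dp|]; first by apply: good_all dp => //; lra.
split=> [|m mj am]; first lra.
have [mb'|mb'] := ltrP m%:K b'%:K; last first.
  have := penalty_le n m (ratv p).
  have : (n%:K + 1) * ninv m <= (b%:K + 1) * ninv b'.
    apply: ler_pM; [by rewrite ltW ?succ_gt0|by rewrite ltW ?ninv_gt0|lra|exact: ninv_anti].
  lra.
have aT : forall k, act U k m.
  by apply: Hs2; [apply/num_lt|apply: act_mono am; lra].
have := Hm m ltac:(apply/num_lt; lra) (aT i).
have := penalty_lip n m (ratv q) (ratv p).
have : (n%:K + 1) * `|ratv q - ratv p| <= (b%:K + 1) * (2 * d).
  by apply: ler_pM => //; [rewrite ltW ?succ_gt0|lra|lra].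
have := dist_lip n (ratv q) (ratv p).
have : `|ratv q - ratv p| * ((bk n)%:K + 1) <= 2 * d * (b%:K + 1).
  by apply: ler_pM => //; [rewrite ltW ?succ_gt0|lra|lra].
lra.
Qed.

(** [L] approximates f at the point. From above, a single cone of value L + 3x over a small ball is
    good at every stage. From below, any cone that witnesses a value under 1 has the rational in its
    ball, so its value is at least f(q)_i. *)
Lemma limit_closed x : ~ inopen s U -> indom F s -> unitK (appK F X) -> 0 < x ->
  exists L d N, 0 < d /\ forall q i, israt q -> near s d (ratv q) -> N%:K <= i%:K ->
    `|fnv F q i - L| < x /\ `|fnv H q i - L| <= 6 * x.
Proof.
move=> Cx Dx [Fl Fu] x0; have [RsX Cs] := RX.
have [N1 [N10 HN1]] := Dx x x0; pose d1 := N1%:K^-1 / 2.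
have d10 : 0 < d1 by rewrite divr_gt0 ?invr_gt0.
have d1N : d1 < N1%:K^-1 by rewrite /d1 ltr_pdivrMr //; have := d10; rewrite /d1; lra.
(* [k] has two tasks in [good]: it makes the radius small, and it delays the bound on f to indices
   beyond [N1]. *)
have [k [Hk kN1]] := @small_ninv (d1 / 2) N1%:K ltac:(by rewrite divr_gt0).
have k1 := succ_gt0 k.
pose d2 := Num.min (d1 / 2) (x / (4 * (k%:K + 1))).
have d20 : 0 < d2.
  by rewrite lt_min; apply/andP; split; apply: divr_gt0 => //; apply: mulr_gt0.
have d21 : d2 <= d1 / 2 by rewrite ge_min lexx.
have d2x : d2 * (4 * (k%:K + 1)) <= x by rewrite -ler_pdivlMr ?mulr_gt0 // ge_min lexx orbT.
have [N2 HN2] := seqv_near d20.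
pose q0 := seqc X N2; have [Rq0 _] := seqcP RsX N2.
have nq0 : near s d2 (ratv q0) by apply: HN2.
pose L := fnv F q0 N1.
have FL q i : israt q -> near s d1 (ratv q) -> N1%:K <= i%:K -> `|fnv F q i - L| < x.
  move=> Rq nq N1i; apply: HN1 => //; split; apply: near_ball d1N _ => //.
  by apply: near_le nq0; lra.
have [N3 HN3] := Fl x x0; have [N4 HN4] := Fu x x0.
(* The values of f at the point lie in [-1, 1] only up to [x], and [L] is within [x] of them. *)
have [LL LU] : -1 - 2 * x <= L /\ L <= 1 + 2 * x.
  have [i Hi] := num_bound (Num.max N1%:K (Num.max N2%:K (Num.max N3%:K N4%:K))).
  move: Hi; rewrite !ge_max => /and4P [i1 i2 i3 i4].
  have [Ri _] := seqcP RsX i.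
  have : `|appK F X i - L| < x.
    by apply: FL => //; apply: near_le (HN2 i i2); lra.
  have := HN3 i i3; have := HN4 i i4; rewrite ltr_norml => ? ? /andP [? ?].
  by split; lra.
(* The summand 3x puts the apex both above the values of f on the ball and above -1, as L >= -1 -
   2x. *)
have [vq [Rv Ev]] := rat_exists (L + 3 * x).
pose n := pr q0 (pr vq k).
have nc : bc n = ratv q0 by rewrite /bc /n pfst_pr.
have nv : bv n = L + 3 * x by rewrite /bv /n psnd_pr pfst_pr.
have nk : bk n = k by rewrite /bk /n !psnd_pr.
have gT i : good F i n.
  split=> [|q _ j _ u _ Rq Hu kj dq]; first by rewrite nv; lra.
  have [_ Hf] := fncP HF j Rq; move/Hf: Hu => ->; rewrite -/(fnv F q j) nv.
  rewrite nk in kj; have : `|fnv F q j - L| < x.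
    apply: FL => //; last lra; apply: near_le (near_trans nq0 (ltW _)); last first.
      move: dq; rewrite /dist nc nk distrC -ltr_pdivlMr // mul1r => dq; exact: lt_trans Hk.
    lra.
  by rewrite ltr_norml => /andP [_]; lra.
have n0 := num_ge0 n; have n1 := succ_gt0 n.
have [b [Hb _]] := @small_ninv (x / (n%:K + 1)) 0 ltac:(by rewrite divr_gt0).
rewrite ltr_pdivlMr // in Hb.
have [S1 HS1] := act_bounding U b.
pose d := Num.min d2 (x / (2 * (n%:K + 1))).
have d0 : 0 < d.
  by rewrite lt_min d20; apply: divr_gt0 => //; apply: mulr_gt0.
have dd2 : d <= d2 by rewrite ge_min lexx.
have dx : d * (2 * (n%:K + 1)) <= x by rewrite -ler_pdivlMr ?mulr_gt0 // ge_min lexx orbT.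
pose big := Num.max N1%:K (Num.max (n%:K + 1) S1%:K).
have [N [HN bigN]] := @small_ninv x big x0.
move: bigN; rewrite /big !ge_max => /and3P [NN1 Nn NS].
exists L, d, N; split=> // q i Rq nq Ni.
have Hf : `|fnv F q i - L| < x.
  by apply: FL => //; [apply: near_le nq; lra|lra].
split=> //; move: (Hf); rewrite ltr_norml => /andP [f1 f2].
have /andP [h1 h2] := Hbound i Rq.
have lower : L - 2 * x <= fnv H q i.
  have [h3|h3] := lerP 1 (fnv H q i); first lra.
  have [n' [_ [[v1 _] [un [Hy _]]]]] := Habove Rq h3.
  have := dist_ge0 n' (ratv q).
  have [dn|dn] := ltrP (dist n' (ratv q)) 1; last lra.
  by have := un dn; lra.
(* Apex L + 3x, then [x] for the slope and [x] for the penalties; the mesh adds the sixth [x]. *)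
suff Ha : above U F (ratv q) i (fnv F q i) (L + 5 * x).
  have := Hleast Rq Ha; have := ninv_anti Ni; rewrite ler_norml => ? ?.
  by apply/andP; split; lra.
have Hd : 2 * dist n (ratv q) <= x.
  rewrite /dist nc nk; have := near_near nq nq0; have := normr_ge0 (ratv q - ratv q0).
  set w := `|_|; move=> w0 wd.
  have : w * (k%:K + 1) <= 2 * d2 * (k%:K + 1) by apply: ler_wpM2r; [exact: ltW|lra].
  lra.
exists n; split; first by apply/num_lt; lra.
split=> //; split=> [_|]; first by rewrite nv; lra.
rewrite nv; split=> [|m mi am]; first lra.
suff : penalty n m (ratv q) <= x by lra.
have [mb|mb] := ltrP m%:K b%:K; last first.
  apply: le_trans (penalty_le n m (ratv q)) _.
  have : (n%:K + 1) * ninv m <= (n%:K + 1) * ninv b.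
    by apply: ler_wpM2l; [exact: ltW|exact: ninv_anti].
  lra.
have aT : forall j, act U j m.
  by apply: HS1; [apply/num_lt|apply: act_mono am; lra].
apply: (@le_trans _ _ ((n%:K + 1) * (2 * d))); last lra.
apply: penalty_small; first lra.
(* A genuine ball reaching 2d beyond [q] would contain the real itself, which lies outside the open
   set. *)
rewrite leNgt; apply/negP => big_r; apply: Cx.
have [Ra [Rr _]] := aT (zeroM A).
exists (pfst m), (ma m); split=> //; exists (mr m); split=> //.
have aq := normr_ge0 (ratv q - ratv (ma m)).
split; first lra; split; last exact: act_all aT.
apply: (@rltK_below _ _ (ratv (mr m) - d)); first lra.
have [N5 HN5] := nq; exists N5 => j /HN5.
have := ler_distD (ratv q) (s j) (ratv (ma m)); rewrite (distrC (ratv (ma m)) (s j)); lra.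
Qed.

Lemma continuous_at : (~ inopen s U -> indom F s /\ unitK (appK F X)) -> indom H s.
Proof.
move=> HC x x0.
have [d [N [d0 Hd]]] : exists d N, 0 < d /\ forall q r i j, israt q -> israt r ->
    near s d (ratv q) -> near s d (ratv r) -> N%:K <= i%:K -> N%:K <= j%:K ->
    fnv H r j < fnv H q i + x.
  have [Ox|Cx] := pselect (inopen s U).
    have [d [N [d0 Hd]]] := oscillation_open Ox (ltac:(lra) : 0 < x / 4).
    exists d, N; split=> // q r i j Rq Rr nq nr Ni Nj.
    by have := Hd q r i j Rq Rr nq nr Ni Nj; lra.
  have [Dx Ux] := HC Cx.
  (* Two values within 6x/13 of [L] differ by at most 12x/13. *)
  have [L [d [N [d0 Hd]]]] := limit_closed Cx Dx Ux (ltac:(lra) : 0 < x / 13).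
  exists d, N; split=> // q r i j Rq Rr nq nr Ni Nj.
  have [_] := Hd q i Rq nq Ni; have [_] := Hd r j Rr nr Nj.
  by rewrite !ler_norml => /andP [? ?] /andP [? ?]; lra.
have [N' [HN' NN']] := @small_ninv d (Num.max N%:K 1) d0.
move: NN'; rewrite ge_max => /andP [NN' N1].
(* The successor is positive, as [indom] requires, and its inverse is [ninv N']. *)
exists (addM N' (oneM A)); rewrite numS; split; first lra.
have toN q : israt q -> ballK (N'%:K + 1)^-1 s (fun _ => ratv q) -> near s d (ratv q).
  move=> Rq Hq; have [_ Cs] := RX.
  have Hq' : ballK (N'%:K + 1)^-1 (fun _ => ratv q) s.
    move: Hq; rewrite /ballK; congr (rltK _ _); apply: funext => m; exact: distrC.
  have [e [e0 He]] := ball_near Cs Hq'; apply: near_le He.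
  by move: HN'; rewrite /ninv; lra.
move=> q Rq r Rr [/(toN q Rq) nq /(toN r Rr) nr] i j [Ni Nj].
have := Hd q r i j Rq Rr nq nr ltac:(lra) ltac:(lra).
have := Hd r q j i Rr Rq nr nq ltac:(lra) ltac:(lra).
rewrite ltr_norml => ? ?; apply/andP; split; lra.
Qed.

Lemma extends_at : ~ inopen s U -> indom F s -> unitK (appK F X) ->
  rleK (appK F X) (appK H X) /\ rleK (appK H X) (appK F X).
Proof.
move=> Cx Dx Ux; have [RsX _] := RX.
have close_values x : 0 < x -> exists N, forall i, N%:K <= i%:K ->
    `|appK F X i - appK H X i| <= x.
  (* An error below x/7 for f and of at most 6x/7 for h add up to [x]. *)
  move=> x0; have [L [d [N [d0 Hd]]]] := limit_closed Cx Dx Ux (ltac:(lra) : 0 < x / 7).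
  have [N2 HN2] := seqv_near d0; have [N' [NN' N2N']] := num_bound2 N%:K N2%:K.
  exists N' => i N'i; have [Ri _] := seqcP RsX i.
  have [] := Hd (seqc X i) i Ri (HN2 i ltac:(lra)) ltac:(lra).
  rewrite -/(appK F X i) -/(appK H X i) ltr_norml !ler_norml.
  by move=> /andP [? ?] /andP [? ?]; apply/andP; split; lra.
by split=> x /close_values [N HN]; exists N => i /HN; rewrite ler_norml => /andP [? ?]; lra.
Qed.

Lemma unit_at : unitK (appK H X).
Proof.
have [RsX _] := RX; split=> x x0; exists (zeroM A) => i _;
by have [Ri _] := seqcP RsX i; have /andP [] := Hbound i Ri; rewrite /appK; lra.
Qed.

End AtPoint.

Theorem tietze_fields : tietzeK A.
Proof.
move=> U F [HF HC]; have [H [HH Hspec]] := extension_exists U HF.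
have Hbound q i : israt q -> -1 <= fnv H q i <= 1 by move=> Rq; case: (Hspec q i Rq).
have Habove q i : israt q -> fnv H q i < 1 -> above U F (ratv q) i (fnv F q i) (fnv H q i).
  by move=> Rq; case: (Hspec q i Rq).
have Hleast q i z : israt q -> above U F (ratv q) i (fnv F q i) z -> fnv H q i <= z + ninv i.
  by move=> Rq; case: (Hspec q i Rq) => _ _; apply.
exists H; split; last first.
  by move=> X RX Cx; have [Dx Ux] := HC X (conj RX Cx); apply: (@extends_at U).
split=> // X [RX _]; split; last exact: unit_at.
by apply: (@continuous_at U F) => // Cx; apply: HC.
Qed.

End Continuity.
Theorem proposition4p12 : provable RCA0_ISigma2 tietze.
Proof. exact: tietze_from_fields tietze_fields. Qed.
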